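(* Let $n\ge 2$, let $L$ be a compact set in $\mathbb{R}^n$, let $1\le r\le n-1$ and let $\mathbf{r}=(i_1,\dots,i_r)$ be a strictly increasing sequence of integers with $1\le i_1<\cdots<i_r\le n-1$. Let $A$ be an affine map of $\mathbb{R}^n$ that preserves volume and let $T\in SL_n$. Then $$\Phi_{\mathbf{r}}(AL)=\Phi_{\mathbf{r}}(L)\quad\text{and}\quad \Psi_{\mathbf{r}}(TL)=\Psi_{\mathbf{r}}(L).$$
   Context: $|\cdot|$ denotes Lebesgue measure of the appropriate dimension, and $P_F$ the orthogonal projection onto a subspace $F$. For $\mathbf{r}=(i_1,\dots,i_r)$ with $1\le i_1<\cdots<i_r\le n-1$, put $i_0=0$ and $i_{r+1}=n$. $F^n_{\mathbf{r}}$ is the partial flag manifold of all $\xi_{\mathbf{r}}=(F_1,\dots,F_r)$ where $F_1\subset F_2\subset\cdots\subset F_r$ are linear subspaces of $\mathbb{R}^n$ with $\dim F_j=i_j$; it carries its unique $SO_n$-invariant probability measure $d\xi_{\mathbf{r}}$. For compact $L\subset\mathbb{R}^n$ the $\mathbf{r}$-flag quermassintegral and the dual $\mathbf{r}$-flag quermassintegral are $$\Phi_{\mathbf{r}}(L)=\Big(\int_{F^n_{\mathbf{r}}}\prod_{j=1}^r|P_{F_j}L|^{i_{j-1}-i_{j+1}}\,d\xi_{\mathbf{r}}\Big)^{-\frac1{i_rn}},\qquad \Psi_{\mathbf{r}}(L)=\Big(\int_{F^n_{\mathbf{r}}}\prod_{j=1}^r|L\cap F_j|^{i_{j+1}-i_{j-1}}\,d\xi_{\mathbf{r}}\Big)^{\frac1{i_rn}},$$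 with values in $[0,\infty)$, using the conventions that a negative power of $0$ is $+\infty$ and a negative power of $+\infty$ is $0$. $SL_n$ is the group of real $n\times n$ matrices of determinant $1$. *)

(* Defs.v *)
From HB Require Import structures.
From mathcomp Require Import all_boot all_order all_algebra.
From mathcomp Require Import all_classical all_reals all_analysis.

Set Implicit Arguments.
Unset Strict Implicit.
Unset Printing Implicit Defensive.

Import Order.TTheory GRing.Theory Num.Theory.
Import numFieldTopology.Exports numFieldNormedType.Exports.

Local Open Scope classical_set_scope.
Local Open Scope ring_scope.

(* R^n is the type 'cV[R]_n of column vectors, with the Euclidean structure
   x^T *m y; matrices act on the left. *)

(* Real matrices carry the sigma-algebra generated by the entries; as the
   topology on matrices is the product topology of finitely many copies of R,
   this is the Borel sigma-algebra. *)
Definition mx_display : measure_display. Proof. exact: default_measure_display. Qed.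

Section matrix_measurable.
Variables (R : realType) (m n : nat).

Definition mx_cylinders : set (set 'M[R]_(m, n)) :=
  [set A | exists i j, exists2 B : set R,
     measurable B & A = (fun M : 'M[R]_(m, n) => M i j) @^-1` B].

Let mx_set0 : <<s mx_cylinders >> set0.
Proof. exact: sigma_algebra0. Qed.

Let mx_setC A : <<s mx_cylinders >> A -> <<s mx_cylinders >> (~` A).
Proof. exact: sigma_algebraC. Qed.

Let mx_bigcup (F : (set 'M[R]_(m, n))^nat) :
  (forall i, <<s mx_cylinders >> (F i)) -> <<s mx_cylinders >> (\bigcup_i F i).
Proof. exact: sigma_algebra_bigcup. Qed.

HB.instance Definition _ := @isMeasurable.Build mx_display 'M[R]_(m, n)
  <<s mx_cylinders >> mx_set0 mx_setC mx_bigcup.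

End matrix_measurable.

Lemma measurable_mx_entry (R : realType) (m n : nat) i j :
  measurable_fun setT (fun M : 'M[R]_(m, n) => M i j).
Proof.
by move=> _ B mB; rewrite setTI; apply: sub_sigma_algebra; exists i, j, B.
Qed.

Lemma measurable_fun_mx (R : realType) (m n : nat) d (T : measurableType d)
    (f : T -> 'M[R]_(m, n)) :
  (forall i j, measurable_fun setT (fun x => f x i j)) -> measurable_fun setT f.
Proof.
move=> mf; apply: (@measurability _ _ _ _ _ _ (@mx_cylinders R m n)) => //.
move=> _ [_ [i [j [B mB ->]]] <-]; rewrite setTI.
by have := mf i j measurableT B mB; rewrite setTI.
Qed.

Section lebesgue_cV.
Variable R : realType.

Definition cV_cons n (p : measurableTypeR R * 'cV[R]_n) : 'cV[R]_n.+1 :=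
  col_mx (p.1%:M : 'M[R]_1) p.2.

Lemma measurable_cV_cons n : measurable_fun setT (@cV_cons n).
Proof.
apply: measurable_fun_mx => i j; rewrite /cV_cons.
case: (split_ordP (i : 'I_(1 + n))) => k ->.
  rewrite [X in measurable_fun _ X](_ : _ = fst); first exact: measurable_fst.
  by apply/funext => p; rewrite [LHS](@col_mxEu _ 1 n) mxE !ord1 eqxx mulr1n.
rewrite [X in measurable_fun _ X](_ : _ = (fun x : 'cV[R]_n => x k j) \o snd).
  exact: (measurableT_comp (measurable_mx_entry k j) measurable_snd).
by apply/funext => p; rewrite [LHS](@col_mxEd _ 1 n).
Qed.

HB.instance Definition _ n := @isMeasurableFun.Build _ _ _ _
  (@cV_cons n) (@measurable_cV_cons n).

Section step.
Variables (n : nat) (mu : {sigma_finite_measure set 'cV[R]_n -> \bar R}).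

Definition lebesgue_step : set 'cV[R]_n.+1 -> \bar R :=
  pushforward (lebesgue_measure \x mu)%E (@cV_cons n).

Let step0 : lebesgue_step set0 = 0%E.
Proof. exact: measure0. Qed.

Let step_ge0 A : (0 <= lebesgue_step A)%E.
Proof. exact: measure_ge0. Qed.

Let step_sigma_additive : semi_sigma_additive lebesgue_step.
Proof. exact: measure_semi_sigma_additive. Qed.

HB.instance Definition _ := isMeasure.Build _ _ _ lebesgue_step
  step0 step_ge0 step_sigma_additive.

Let step_sigma_finite : sigma_finite setT lebesgue_step.
Proof.
have [F TF Foo] : sigma_finite setT (lebesgue_measure \x mu)%E.
  have /sigma_finiteP[F [TF ndF Foo]] := sigma_finiteT (@lebesgue_measure R).
  have /sigma_finiteP[G [TG ndG Goo]] := sigma_finiteT mu.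
  exists (fun k => F k `*` G k).
    apply/esym; rewrite -subTset => -[x y] _.
    have [a _ Fx] : (\bigcup_k F k) x by rewrite -TF.
    have [b _ Gy] : (\bigcup_k G k) y by rewrite -TG.
    exists (maxn a b) => //; split => /=.
      by move: x Fx; exact/subsetPset/ndF/leq_maxl.
    by move: y Gy; exact/subsetPset/ndG/leq_maxr.
  move=> k; have [mF Fk] := Foo k; have [mG Gk] := Goo k.
  split; first exact: measurableX.
  by rewrite product_measure1E// lte_mul_pinfty// ge0_fin_numE.
pose dec := fun x : 'cV[R]_n.+1 =>
  (x ord0 ord0, dsubmx (x : 'cV_(1 + n))) : measurableTypeR R * 'cV[R]_n.
have mdec : measurable_fun setT dec.
  apply/measurable_fun_pairP; split; first exact: measurable_mx_entry.
  apply: measurable_fun_mx => i j.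
  rewrite [X in measurable_fun _ X](_ : _ =
    (fun x : 'cV[R]_n.+1 => x (rshift 1 i) j)); last first.
    by apply/funext => x; rewrite /= mxE.
  exact: measurable_mx_entry.
have decK p : dec (cV_cons p) = p.
  case: p => a y; rewrite /dec /cV_cons /=; congr pair; last exact: col_mxKd.
  have -> : (ord0 : 'I_n.+1) = lshift n (ord0 : 'I_1) by exact/val_inj.
  by rewrite [LHS](@col_mxEu _ 1 n) mxE eqxx mulr1n.
exists (fun k => dec @^-1` F k).
  by rewrite -preimage_bigcup -TF preimage_setT.
move=> k; have [mF Fk] := Foo k; split.
  by rewrite -[X in measurable X]setTI; exact: mdec.
rewrite /lebesgue_step /pushforward -comp_preimage.
rewrite (_ : dec \o @cV_cons n = id) ?preimage_id//.
by apply/funext => p; exact: decK.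
Qed.

HB.instance Definition _ := Measure_isSigmaFinite.Build _ _ _ lebesgue_step
  step_sigma_finite.

End step.

(* Lebesgue measure on R^n: the n-fold product of Lebesgue measure on R. *)
Fixpoint lebesgue_cV n : {sigma_finite_measure set 'cV[R]_n -> \bar R} :=
  match n with
  | 0 => \d_(0 : 'cV[R]_0)
  | n'.+1 => lebesgue_step (lebesgue_cV n')
  end.

End lebesgue_cV.

Section subspaces.
Variables (R : realType) (n : nat).
Implicit Types (F : {vspace 'cV[R]_n}).

(* The columns of B form an orthonormal basis of F. *)
Definition is_orthonormal_basis F : set 'M[R]_(n, \dim F) :=
  [set B | B^T *m B = 1%:M /\ forall x, x \in F <-> exists y, x = B *m y].

Lemma mulmx_limgP k (B : 'M[R]_(n, k)) (x : 'cV[R]_n) :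
  reflect (exists y : 'cV[R]_k, x = B *m y) (x \in limg (linfun (mulmx B))).
Proof.
apply: (iffP memv_imgP) => [[y _ ->]|[y ->]]; exists y.
- by rewrite lfunE.
- exact: memvf.
- by rewrite lfunE.
Qed.

Lemma cV_dot_eq0 k (w : 'cV[R]_k) : w^T *m w = 0 -> w = 0.
Proof.
move/matrixP/(_ 0 0); rewrite !mxE => /eqP.
rewrite psumr_eq0 => [/allP w0|i _]; last by rewrite mxE -expr2 sqr_ge0.
apply/colP => i; have := w0 i (mem_index_enum i).
by rewrite mxE /= mulf_eq0 orbb mxE => /eqP.
Qed.

Lemma orthonormal_family F k : (k <= \dim F)%N ->
  exists B : 'M[R]_(n, k),
    B^T *m B = 1%:M /\ forall y : 'cV[R]_k, B *m y \in F.
Proof.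
elim: k => [_|k IHk kF].
  exists 0; split; first by apply/matrixP => -[].
  by move=> y; rewrite mul0mx mem0v.
have [B [BB BF]] := IHk (ltnW kF).
have [v vF vB] : exists2 v, v \in F & v \notin limg (linfun (mulmx B)).
  apply/subvPn; apply: contraL kF => /dimvS FB; rewrite -leqNgt.
  apply: leq_trans FB _; rewrite -[X in (_ <= X)%N](_ : \dim {:'cV[R]_k} = k).
    by rewrite -(limg_ker_dim (linfun (mulmx B)) fullv) leq_addl.
  by rewrite dimvf /dim /= muln1.
pose w := v - B *m (B^T *m v).
have wF : w \in F by rewrite rpredB.
have w0 : w != 0.
  by apply: contraNneq vB => /subr0_eq ->; apply/mulmx_limgP; eexists.
have Bw : B^T *m w = 0 by rewrite /w mulmxBr (mulmxA B^T B) BB mul1mx subrr.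
pose q := (w^T *m w) 0 0.
have wwE : w^T *m w = q%:M by exact: mx11_scalar.
have q_gt0 : 0 < q.
  rewrite lt_def; apply/andP; split.
    by apply: contra_neq w0 => q0; apply: cV_dot_eq0; rewrite wwE q0 raddf0.
  by rewrite /q mxE sumr_ge0// => i _; rewrite mxE -expr2 sqr_ge0.
pose u := (Num.sqrt q)^-1 *: w.
have uF : u \in F by rewrite rpredZ.
have Bu : B^T *m u = 0 by rewrite -scalemxAr Bw scaler0.
have uu : u^T *m u = 1%:M.
  have -> : u^T = (Num.sqrt q)^-1 *: w^T by rewrite linearZ.
  rewrite -scalemxAr -scalemxAl wwE scalerA -invfM -expr2.
  by rewrite sqr_sqrtr ?ltW// scale_scalar_mx mulVf// gt_eqF.
have uB : u^T *m B = 0 by rewrite -[B]trmxK -trmx_mul Bu trmx0.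
suff [C [CC CF]] : exists C : 'M[R]_(n, k + 1),
    C^T *m C = 1%:M /\ forall y : 'cV[R]_(k + 1), C *m y \in F.
  by rewrite -addn1; exists C.
exists (row_mx B u); split.
  by rewrite tr_row_mx mul_col_row BB Bu uB uu -scalar_mx_block.
move=> y; rewrite -[y]vsubmxK mul_row_col rpredD ?BF//.
by rewrite [dsubmx y]mx11_scalar mul_mx_scalar rpredZ.
Qed.

Lemma orthonormal_basis_ex F : exists B, @is_orthonormal_basis F B.
Proof.
have [B [BB BF]] := orthonormal_family (leqnn (\dim F)).
exists B; split => // x.
suff FE : limg (linfun (mulmx B)) = F.
  rewrite -[x \in F](congr1 (fun U : {vspace _} => x \in U) FE).
  by split => [/mulmx_limgP|?]; last exact/mulmx_limgP.
apply/eqP; rewrite eqEdim; apply/andP; split.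
  by apply/subvP => _ /mulmx_limgP[y ->]; exact: BF.
rewrite limg_dim_eq; first by rewrite dimvf /dim /= muln1.
apply/eqP; rewrite -subv0; apply/subvP => y.
rewrite memv_cap => /andP[_]; rewrite memv_ker lfunE /= => /eqP By.
by rewrite memv0 -[y]mul1mx -BB -mulmxA By mulmx0.
Qed.

Definition orthonormal_basis F : 'M[R]_(n, \dim F) :=
  xget 0 (@is_orthonormal_basis F).

Lemma orthonormal_basisP F : is_orthonormal_basis (orthonormal_basis F).
Proof. by have [B] := orthonormal_basis_ex F; exact: xgetI. Qed.

(* Lebesgue measure on the Euclidean space F, transported from R^(dim F) by a
   linear isometry; it does not depend on the orthonormal basis. *)
Definition subspace_lebesgue F (S : set 'cV[R]_n) : \bar R :=
  lebesgue_cV R (\dim F) [set y | S (orthonormal_basis F *m y)].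

(* The matrix of P_F. *)
Definition orthoproj F : 'M[R]_n :=
  orthonormal_basis F *m (orthonormal_basis F)^T.

Lemma orthoproj_mem F (x : 'cV[R]_n) : orthoproj F *m x \in F.
Proof.
by apply/(orthonormal_basisP F).2; rewrite -mulmxA; eexists.
Qed.

Lemma orthoproj_orthogonal F (x y : 'cV[R]_n) :
  y \in F -> (x - orthoproj F *m x)^T *m y = 0.
Proof.
have [BB BF] := orthonormal_basisP F.
move=> /BF[z ->]; rewrite mulmxA -[_ *m orthonormal_basis F]trmxK.
rewrite trmx_mul trmxK mulmxBr /orthoproj !mulmxA BB mul1mx subrr.
by rewrite trmx0 mul0mx.
Qed.

End subspaces.

Definition vspace_display : measure_display.
Proof. exact: default_measure_display. Qed.

(* The Grassmannians, gathered in the type of all subspaces, carry the Borel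
   sigma-algebra of the embedding F |-> P_F. *)
Section grassmannian_measurable.
Variables (R : realType) (n : nat).

HB.instance Definition _ := isPointed.Build {vspace 'cV[R]_n} 0%VS.

Definition vspace_measurable : set (set {vspace 'cV[R]_n}) :=
  preimage_set_system setT (@orthoproj R n) measurable.

Let vs_set0 : vspace_measurable set0.
Proof. by exists set0; rewrite ?setTI ?preimage_set0. Qed.

Let vs_setC A : vspace_measurable A -> vspace_measurable (~` A).
Proof.
move=> [B mB <-]; exists (~` B); first exact: measurableC.
by rewrite !setTI preimage_setC.
Qed.

Let vs_bigcup (F : (set {vspace 'cV[R]_n})^nat) :
  (forall i, vspace_measurable (F i)) -> vspace_measurable (\bigcup_i F i).
Proof.
move=> mF; have /choice[B BF] : forall i, exists B : set 'M[R]_n,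
    measurable B /\ @orthoproj R n @^-1` B = F i.
  by move=> i; have [B mB <-] := mF i; exists B; rewrite setTI.
exists (\bigcup_i B i); first by apply: bigcup_measurable => i _; exact: (BF i).1.
by rewrite setTI preimage_bigcup; apply: eq_bigcupr => i _; exact: (BF i).2.
Qed.

HB.instance Definition _ := @isMeasurable.Build vspace_display
  {vspace 'cV[R]_n} vspace_measurable vs_set0 vs_setC vs_bigcup.

End grassmannian_measurable.

Section flags.
Variables (R : realType) (n r : nat) (i : r.-tuple nat).

(* [flag_index j] is i_j, with i_0 = 0 and i_(r+1) = n. *)
Definition flag_index (j : nat) : nat := nth n (0%N :: i) j.

(* The component F_j of a flag is [tnth xi j'], where the ordinal j' is j - 1. *)
Definition flag_manifold : set (r.-tuple {vspace 'cV[R]_n}) :=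
  [set xi | (forall j : 'I_r, \dim (tnth xi j) = flag_index j.+1) /\
            (forall j k : 'I_r, (j <= k)%N -> (tnth xi j <= tnth xi k)%VS)].

Definition special_orthogonal : set 'M[R]_n :=
  [set Q | Q^T *m Q = 1%:M /\ \det Q = 1].

Definition flag_action (Q : 'M[R]_n) (xi : r.-tuple {vspace 'cV[R]_n}) :
    r.-tuple {vspace 'cV[R]_n} :=
  [tuple of [seq (linfun (mulmx Q) @: F)%VS | F : {vspace 'cV[R]_n} <- xi]].

(* The SO_n-invariant probability measure of the flag manifold, seen as a
   measure on all tuples of subspaces. *)
Definition is_flag_measure
    (mu : probability (r.-tuple {vspace 'cV[R]_n}) R) : Prop :=
  mu flag_manifold = 1%E /\
  forall Q, special_orthogonal Q -> forall S, measurable S ->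
    mu (flag_action Q @^-1` S) = mu S.

(* x^p for x >= 0, with 0^p = +oo and +oo^p = 0 when p < 0; the library's
   [poweR] has 0^p = 0 and +oo^p = +oo for such p. *)
Definition xpow (x : \bar R) (p : R) : \bar R :=
  if p < 0 then (poweR x (- p))^-1%E else poweR x p.

Variable mu : probability (r.-tuple {vspace 'cV[R]_n}) R.
Implicit Type L : set 'cV[R]_n.

Definition flag_quermassintegral L : \bar R :=
  xpow (\int[mu]_(xi in flag_manifold)
          \prod_(j < r)
            xpow (subspace_lebesgue (tnth xi j)
                    (mulmx (orthoproj (tnth xi j)) @` L))
                 ((flag_index j)%:R - (flag_index j.+2)%:R)%R)%E
       (- ((flag_index r * n)%:R)^-1).

Definition dual_flag_quermassintegral L : \bar R :=
  xpow (\int[mu]_(xi in flag_manifold)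
          \prod_(j < r)
            xpow (subspace_lebesgue (tnth xi j)
                    (L `&` [set x | x \in tnth xi j]))
                 ((flag_index j.+2)%:R - (flag_index j)%:R)%R)%E
       ((flag_index r * n)%:R)^-1.

End flags.

Definition is_affine (R : realType) (n : nat) (f : 'cV[R]_n -> 'cV[R]_n) :=
  exists (M : 'M[R]_n) (b : 'cV[R]_n), forall x, f x = M *m x + b.

Definition preserves_volume (R : realType) (n : nat)
    (f : 'cV[R]_n -> 'cV[R]_n) :=
  forall E, measurable E -> lebesgue_cV R n (f @` E) = lebesgue_cV R n E.

(* Main.v *)
Require Import Defs.
From HB Require Import structures.
From mathcomp Require Import all_boot all_order all_algebra.
From mathcomp Require Import all_classical all_reals all_analysis.
From mathcomp Require Import perm finmap measurable_realfun.
From mathcomp Require Import ring lra.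

(** A linear map [g] scales the volume of a subspace [F] by a factor
[sigma(g, F)], written [gram_vol (orthoproj F) g] below.  Since [T] maps
[L :&: F] onto [TL :&: TF], sections satisfy
[|TL :&: TF| = sigma(T, F) |L :&: F|]; since [P_F M] is the
transpose of the restriction of [M^T] to [F], projections satisfy
[|P_F(ML + c)| = sigma(M^T, F) |P_F' L|] with [F' = M^T F].  Multiplying over
the components of a flag, the two integrands of each of the two equalities are
related by [f1(xi) = J(g, xi) f2(g xi)], where [g] is [M^T] or [T] and
[J(g, xi)], called [flag_jacobian], is the product of the
[sigma(g, F_j) ^ (i_(j-1) - i_(j+1))].  The theorem is therefore the change of
variables formula of the invariant measure of the flag manifold: if
[|det g| = 1], then [J(g, -)] is the density for which [f2] and
[J(g, -) f2(g -)] have the same integral ([flag_change_of_variables]).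

For that formula, write a flag as [G xi0], with [G] an invertible matrix and
[xi0] the standard flag, whose stabilizer is the group [P] of block upper
triangular matrices.  Let [G] have the density [kappa(G) w(G)] with respect to
Lebesgue measure on matrices, where [w] is any weight invariant under left
rotations and [kappa], called [flag_density], is a product of inverse Gram
volumes, also invariant under left rotations.  The law of [G xi0] is then
invariant under SO_n, hence proportional to the invariant probability measure
([flag_measure_frame_law]); uniqueness follows from Fubini's theorem, the
rotation part of a random [G] replacing Haar measure ([SO_average_unique]).
Substituting [gG] for [G] replaces [kappa(G)] by [kappa(gG) = J(g, G xi0)
kappa(G)] ([flag_jacobian_density]), which is the density looked for, but it
also replaces [w] by [w(g -)].

It remains to see that this second replacement is harmless. The factor [h(G xi0)
kappa(G)] is equivariant under right multiplication by [P], for the character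
such that substituting [G C^-1] for [G], with [C] in [P], exchanges the left and
right Haar measures of [P]; so its integral against [w] depends on the averages
of [w] over the orbits [GP] only ([block_average_swap]). By Gram-Schmidt, [G =
QT] with [Q] a rotation and [T] in [P]; as [w] is invariant under [Q] and Haar
measure on [P] is invariant under [T], these averages do not depend on [G]
([block_average_left], [block_average_right]), and they are the same for [w] and
[w(g -)].

The integrands of the quermassintegrals are treated as arbitrary nonnegative
functions. The integral of a nonnegative function is the supremum of the
integrals of the simple functions below it, so the formula for measurable
functions gives one inequality for arbitrary ones, and applying it to [g^-1]
gives the other. Finally, a volume-preserving affine map has determinant [1] or
[-1], as its action on a cube shows ([preserves_volume_det]). *)

Set Implicit Arguments.
Unset Strict Implicit.
Unset Printing Implicit Defensive.

Import Order.TTheory GRing.Theory Num.Theory.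
Import numFieldTopology.Exports numFieldNormedType.Exports.

Local Open Scope classical_set_scope.
Local Open Scope ring_scope.

(** * Measurability of matrix operations *)

Section matrix_valued_measurable.
Variables (R : realType) (d : measure_display) (T : measurableType d).

Lemma measurable_mx_coord m n (f : T -> 'M[R]_(m, n)) i j :
  measurable_fun setT f -> measurable_fun setT (fun x => f x i j).
Proof. by move=> mf; exact: (measurableT_comp (measurable_mx_entry i j) mf). Qed.

Lemma measurable_mulmx m n p (f : T -> 'M[R]_(m, n)) (g : T -> 'M[R]_(n, p)) :
  measurable_fun setT f -> measurable_fun setT g ->
  measurable_fun setT (fun x => f x *m g x).
Proof.
move=> mf mg; apply: measurable_fun_mx => i j.
under [X in measurable_fun _ X]eq_fun do rewrite mxE.
by apply: measurable_sum => k; apply: measurable_funM; exact: measurable_mx_coord.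
Qed.

Lemma measurable_addmx m n (f g : T -> 'M[R]_(m, n)) :
  measurable_fun setT f -> measurable_fun setT g ->
  measurable_fun setT (fun x => f x + g x).
Proof.
move=> mf mg; apply: measurable_fun_mx => i j.
under [X in measurable_fun _ X]eq_fun do rewrite mxE.
by apply: measurable_funD; exact: measurable_mx_coord.
Qed.

Lemma measurable_oppmx m n (f : T -> 'M[R]_(m, n)) :
  measurable_fun setT f -> measurable_fun setT (fun x => - f x).
Proof.
move=> mf; apply: measurable_fun_mx => i j.
under [X in measurable_fun _ X]eq_fun do rewrite mxE.
by apply: measurable_funN; exact: measurable_mx_coord.
Qed.

Lemma measurable_trmx m n (f : T -> 'M[R]_(m, n)) :
  measurable_fun setT f -> measurable_fun setT (fun x => (f x)^T).
Proof.
move=> mf; apply: measurable_fun_mx => i j.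
under [X in measurable_fun _ X]eq_fun do rewrite mxE.
exact: measurable_mx_coord.
Qed.

Lemma measurable_scalemx m n (c : T -> R) (f : T -> 'M[R]_(m, n)) :
  measurable_fun setT c -> measurable_fun setT f ->
  measurable_fun setT (fun x => c x *: f x).
Proof.
move=> mc mf; apply: measurable_fun_mx => i j.
under [X in measurable_fun _ X]eq_fun do rewrite mxE.
by apply: measurable_funM => //; exact: measurable_mx_coord.
Qed.

Lemma measurable_det n (f : T -> 'M[R]_n) :
  measurable_fun setT f -> measurable_fun setT (fun x => \det (f x)).
Proof.
move=> mf; rewrite /determinant.
apply: measurable_sum => s; apply: measurable_funM => //.
by apply: measurable_prod => i _; exact: measurable_mx_coord.
Qed.

Lemma measurable_mxtrace n (f : T -> 'M[R]_n) :
  measurable_fun setT f -> measurable_fun setT (fun x => \tr (f x)).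
Proof.
by move=> mf; apply: measurable_sum => i; exact: measurable_mx_coord.
Qed.

Lemma measurable_invr (f : T -> R) :
  measurable_fun setT f -> measurable_fun setT (fun x => (f x)^-1).
Proof.
move=> mf.
(* Up to sign, the inverse is a power of the absolute value; this includes [0],
   where both [0^-1] and [powR 0 (-1)] are [0]. *)
have -> : (fun x => (f x)^-1) = (fun x =>
    if 0 <= f x then powR (f x) (-1) else - powR (- f x) (-1)).
  apply/funext => x; case: (leP 0 (f x)) => fx; first by rewrite powR_inv1.
  by rewrite powR_inv1 ?oppr_ge0 ?ltW// invrN opprK.
apply: measurable_fun_ifT.
- exact: measurable_fun_ler.
- exact: (measurableT_comp (@measurable_powR R (-1)) mf).
- apply: measurable_funN; apply: (measurableT_comp (@measurable_powR R (-1))).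
  exact: measurable_funN.
Qed.

Lemma measurable_sqrt (f : T -> R) :
  measurable_fun setT f -> measurable_fun setT (fun x => Num.sqrt (f x)).
Proof.
move=> mf; apply: measurableT_comp => //; apply: continuous_measurable_fun.
exact: sqrt_continuous.
Qed.

Lemma measurable_unitmx n (f : T -> 'M[R]_n) :
  measurable_fun setT f -> measurable_fun setT (fun x => f x \in unitmx).
Proof.
move=> mf; under [X in measurable_fun _ X]eq_fun do rewrite unitmxE unitfE.
by apply: measurable_neg; apply: measurable_fun_eqr => //; exact: measurable_det.
Qed.

Lemma measurable_invmx n (f : T -> 'M[R]_n) :
  measurable_fun setT f -> measurable_fun setT (fun x => invmx (f x)).
Proof.
move=> mf; rewrite /invmx; apply: measurable_fun_ifT => //.
  exact: measurable_unitmx.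
apply: measurable_scalemx; first exact/measurable_invr/measurable_det.
apply: measurable_fun_mx => i j.
under [X in measurable_fun _ X]eq_fun do rewrite mxE.
apply: measurable_funM => //; apply: measurable_det.
apply: measurable_fun_mx => k l.
under [X in measurable_fun _ X]eq_fun do rewrite !mxE.
exact: measurable_mx_coord.
Qed.

End matrix_valued_measurable.

Section Borel_matrix.
Variable R : realType.

Lemma measurable_mx_ball m n (A : 'M[R]_(m, n)) (e : R) :
  measurable [set B : 'M[R]_(m, n) | forall i j, `|A i j - B i j| < e].
Proof.
rewrite (_ : [set B | _] = \bigcap_(ij in [set: 'I_m * 'I_n])
    ((fun B : 'M[R]_(m, n) => B ij.1 ij.2) @^-1` ball (A ij.1 ij.2) e)).
  apply: fin_bigcap_measurable => [|[i j] _]; first exact: finite_finset.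
  rewrite -[X in measurable X]setTI; apply: measurable_mx_entry => //.
  exact: measurable_ball.
by apply/seteqP; split => [B AB [i j] _|B AB i j]; [exact: AB|exact: (AB (i, j))].
Qed.

(** The topology of matrices is second countable: balls with rational centre and
radius [1 / (k + 1)] form a countable basis, so open sets, and with them compact
sets, belong to the sigma-algebra generated by the entries. *)
Lemma open_measurable_mx m n (U : set 'M[R]_(m, n)) : open U -> measurable U.
Proof.
move=> oU.
pose B (q : 'M[rat]_(m, n) * nat) := [set M : 'M[R]_(m, n) |
  forall i j, `|map_mx ratr q.1 i j - M i j| < q.2.+1%:R^-1].
have -> : U = \bigcup_q (if `[< B q `<=` U >] then B q else set0).
  apply/seteqP; split => [M UM|M [q _]]; last first.
    by case: ifPn => // /asboolP qU; exact: qU.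
  have /nbhs_ballP[e /= e0 MU] : nbhs M U by apply: open_nbhs_nbhs.
  have [k ke] : exists k, k.+1%:R^-1 < e / 2 :> R.
    exists (Num.truncn (e / 2)^-1).
    by rewrite invf_plt ?posrE ?divr_gt0// truncnS_gt.
  have ki : 0 < k.+1%:R^-1 :> R by rewrite invr_gt0.
  have /choice[q qM] : forall ij : 'I_m * 'I_n, exists q : rat,
      `|ratr q - M ij.1 ij.2| < k.+1%:R^-1.
    move=> [i j] /=.
    have [q] := @rat_in_itvoo R (M i j - k.+1%:R^-1) (M i j + k.+1%:R^-1)
      ltac:(by rewrite ltrD2l gtrN).
    by rewrite in_itv/= => qij; exists q; rewrite ltr_distl.
  exists (\matrix_(i, j) q (i, j), k) => //; case: ifPn => [_|].
    by move=> i j; rewrite !mxE; exact: (qM (i, j)).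
  move=> /asboolP; apply: contra_notP => _ N BN; apply: MU; split=> [|i j]; first exact: e0.
  rewrite /ball/= (splitr e) (le_lt_trans (ler_distD (ratr (q (i, j))) _ _))//.
  rewrite ltrD//; first by rewrite distrC (lt_trans (qM (i, j))).
  by have := BN i j; rewrite !mxE => /lt_trans; apply.
apply: countable_bigcupT_measurable => [|q]; first exact: countableP.
by case: ifP => // _; exact: measurable_mx_ball.
Qed.

Lemma compact_measurable_mx m n (K : set 'M[R]_(m, n)) :
  compact K -> measurable K.
Proof.
move=> cK; have Kc := compact_closed (@norm_hausdorff R _) cK.
rewrite -[K]setCK; apply: measurableC; apply: open_measurable_mx.
exact: closed_openC.
Qed.

Lemma continuous_mulmx m n p (A : 'M[R]_(m, n)) :
  continuous (mulmx A : 'M[R]_(n, p) -> 'M[R]_(m, p)).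
Proof.
move=> X U [/= P MP PU].
have : forall ij, \forall Y \near X, P ij.1 ij.2 ((A *m Y) ij.1 ij.2).
  move=> [i j] /=.
  have : (fun Y : 'M[R]_(n, p) => (A *m Y) i j) @ X --> (A *m X) i j.
    under eq_fun do rewrite mxE; rewrite mxE.
    apply: cvg_big => [||k _]; [exact: add_continuous|exact: nbhs_filter|].
     exact: (cvgM (cvg_cst (A i k)) (@coord_continuous _ _ _ k j X)).
  by apply; exact: MP.
move=> /(@filter_forall _ _ _ _ (nbhs_filter X)) PX.
apply: (@filterS _ _ (nbhs_filter X) _ _ _ PX) => Y PY.
by apply: PU => i j; exact: (PY (i, j)).
Qed.

End Borel_matrix.

(** The measurability of [f] is an explicit argument, so that the measure structure
does not depend on its being found by inference. *)
Definition image_measure d d' (T : measurableType d) (T' : measurableType d')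
    (R : realType) (m : {measure set T -> \bar R}) (f : T -> T')
    (mf : measurable_fun setT f) : {measure set T' -> \bar R} :=
  measure_function_pushforward__canonical__measure_function_Measure m mf.

Lemma ge0_integral_image_measure d d' (T : measurableType d)
    (T' : measurableType d') (R : realType) (m : {measure set T -> \bar R})
    (g : T -> T') (mg : measurable_fun setT g) (f : T' -> \bar R) :
  measurable_fun setT f -> (forall y, 0 <= f y)%E ->
  (\int[image_measure m mg]_y f y = \int[m]_x f (g x))%E.
Proof.
move=> mf f0.
by rewrite [LHS](ge0_integral_pushforward mg) ?preimage_setT.
Qed.

(** * Lebesgue measure under affine maps *)

Section affine_line.
Variable R : realType.
Notation leb := (@lebesgue_measure R).

Lemma measurable_affine_line (a b : R) :
  measurable_fun setT (fun x : measurableTypeR R => (a * x + b : measurableTypeR R)).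
Proof. by apply: measurable_funD => //; exact: measurable_funM. Qed.

(** The right-hand side is a measure in [A]; by uniqueness of Lebesgue measure it
is enough to compare the two on half-open intervals. *)
Lemma lebesgue_measure_affine (a b : R) (A : set R) : a != 0 -> measurable A ->
  leb A = (`|a|%:E * leb ((fun x => (a * x + b)%R) @^-1` A))%E.
Proof.
move=> a0 mA.
pose m := mscale (NngNum (normr_ge0 a)) (image_measure leb (measurable_affine_line a b)).
suff -> : leb A = m A by [].
apply: lebesgue_measure_unique => // _ [[u v] /= uv <-].
rewrite /m /mscale /=.
rewrite -[pushforward _ _ _]/(leb ((fun x => (a * x + b)%R) @^-1` `]u, v]%classic)).
have [a_lt0|a_gt0|aE] := ltgtP a 0; last by rewrite aE eqxx in a0.
  rewrite (_ : _ @^-1` _ = `[(v - b) / a, (u - b) / a[%classic); last first.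
    apply/seteqP; split => x /=; rewrite !in_itv/= ler_ndivrMr// ltr_ndivlMr//;
      by rewrite ltrBlDr lerBrDr [x * a]mulrC andbC.
  rewrite !lebesgue_measure_itv/= !lte_fin ltr_nM2r ?invr_lt0// ltrD2r.
  case: ltP => _; last by rewrite mule0.
  rewrite -!EFinB -EFinM; congr EFin; rewrite ltr0_norm//.
  by field.
rewrite (_ : _ @^-1` _ = `](u - b) / a, (v - b) / a]%classic); last first.
  apply/seteqP; split => x /=; rewrite !in_itv/= ler_pdivlMr// ltr_pdivrMr//;
      by rewrite ltrBlDr lerBrDr [x * a]mulrC.
rewrite !lebesgue_measure_itv/= !lte_fin ltr_pM2r ?invr_gt0// ltrD2r.
case: ltP => _; last by rewrite mule0.
rewrite -!EFinB -EFinM; congr EFin; rewrite gtr0_norm//.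
by field.
Qed.

Lemma integral_lebesgue_affine (a b : R) (f : measurableTypeR R -> \bar R) :
  a != 0 -> measurable_fun setT f -> (forall x, 0 <= f x)%E ->
  (\int[leb]_x f (a * x + b)%R = `|a|^-1%:E * \int[leb]_x f x)%E.
Proof.
move=> a0 mf f0.
have na : 0 <= `|a| by [].
pose m := mscale (NngNum na) (image_measure leb (measurable_affine_line a b)).
rewrite [in RHS](eq_measure_integral m); last first.
  by move=> A mA _; exact: lebesgue_measure_affine.
rewrite ge0_integral_mscale// ge0_integral_image_measure//=.
by rewrite muleA -EFinM mulVf ?normr_eq0// mul1e.
Qed.

End affine_line.

(** The two orders of integration serve the two triangular shapes: the coordinate
integrated first is the one that the triangular map shifts by a function of the
others. *)
Section lebesgue_cV_fubini.
Variable R : realType.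
Notation leb := (@lebesgue_measure R).
Variable n : nat.
Variable f : 'cV[R]_n.+1 -> \bar R.
Hypotheses (mf : measurable_fun setT f) (f0 : forall x, (0 <= f x)%E).

Let integral_cV_cons :
  (\int[lebesgue_cV R n.+1]_x f x =
   \int[leb \x lebesgue_cV R n]_p f (cV_cons p))%E.
Proof.
change ((\int[pushforward (leb \x lebesgue_cV R n)%E (@cV_cons R n)]_x f x =
   \int[leb \x lebesgue_cV R n]_p f (cV_cons p))%E).
by rewrite ge0_integral_pushforward//; exact: measurable_cV_cons.
Qed.

Let mfc : measurable_fun setT (f \o @cV_cons R n).
Proof. exact: measurableT_comp mf (@measurable_cV_cons R n). Qed.

Lemma integral_cV_head_tail : (\int[lebesgue_cV R n.+1]_x f x =
  \int[leb]_x \int[lebesgue_cV R n]_y f (cV_cons (x, y)))%E.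
Proof. by rewrite integral_cV_cons fubini_tonelli1. Qed.

Lemma integral_cV_tail_head : (\int[lebesgue_cV R n.+1]_x f x =
  \int[lebesgue_cV R n]_y \int[leb]_x f (cV_cons (x, y)))%E.
Proof. by rewrite integral_cV_cons fubini_tonelli2. Qed.

End lebesgue_cV_fubini.

Section triangular_change_of_variables.
Variable R : realType.
Notation leb := (@lebesgue_measure R).

Lemma cV_cons_affine n (A : 'M[R]_(1 + n)) (b : 'cV[R]_(1 + n)) x (y : 'cV_n) :
  A *m cV_cons (x, y) + b =
  cV_cons (A 0 0 * x + ((ursubmx A *m y) 0 0 + b 0 0),
           drsubmx A *m y + (dlsubmx A *m x%:M + dsubmx b)).
Proof.
rewrite -{1}[A]submxK -{1}[b]vsubmxK /cV_cons /= mul_block_col add_col_mx.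
congr col_mx; last by rewrite [RHS]addrCA addrA.
apply/matrixP => i j; rewrite !ord1 !mxE big_ord1 !mxE eqxx !mulr1n -addrA.
by congr (_ * _ + (_ + _)); [congr (A _ _)|congr (b _ _)]; exact/val_inj.
Qed.

Lemma measurable_cV_affine n (A : 'M[R]_n) (b : 'cV[R]_n) :
  measurable_fun setT (fun x : 'cV[R]_n => A *m x + b).
Proof. by apply: measurable_addmx => //; exact: measurable_mulmx. Qed.

Lemma measurable_cV_consr n x : measurable_fun setT (fun y : 'cV[R]_n => cV_cons (x, y)).
Proof.
apply: measurableT_comp; first exact: measurable_cV_cons.
exact: measurable_fun_pair.
Qed.

Lemma measurable_cV_consl n y : measurable_fun setT
  (fun x : measurableTypeR R => cV_cons (x, y) : 'cV[R]_n.+1).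
Proof.
apply: measurableT_comp; first exact: measurable_cV_cons.
exact: measurable_fun_pair.
Qed.

Definition affine_scaling n (A : 'M[R]_n) := forall (b : 'cV[R]_n) f,
  measurable_fun setT f -> (forall x, 0 <= f x)%E ->
  (\int[lebesgue_cV R n]_x f (A *m x + b)%R =
   (`|\det A|^-1)%:E * \int[lebesgue_cV R n]_x f x)%E.

(** The first coordinate of [A x + b] depends on that of [x] alone, and for a
fixed first coordinate the other ones undergo a triangular affine map of smaller
size; so the tail is integrated first, by induction, and the head last. *)
Lemma lower_triangular_scaling n (A : 'M[R]_n) : is_trig_mx A -> \det A != 0 ->
  affine_scaling A.
Proof.
elim: n A => [A _ _ b f mf f0|n IHn].
  rewrite det_mx00 normr1 invr1 mul1e; apply: eq_integral => x _.
  by congr f; rewrite !flatmx0.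
rewrite -[n.+1]/(1 + n)%N => A tA dA b f mf f0.
have ur0 : ursubmx A = 0.
  apply/matrixP => i j; rewrite !mxE; apply: (is_trig_mxP tA).
  by rewrite ord1.
have detA : \det A = A 0 0 * \det (drsubmx A).
  rewrite -{1}[A]submxK ur0 det_lblock det_mx11 !mxE.
  by congr (A _ _ * _); exact/val_inj.
move: dA; rewrite detA mulf_eq0 negb_or => /andP[a0 d0].
have trA : is_trig_mx (drsubmx A).
  by apply/is_trig_mxP => i j ij; rewrite !mxE; exact: (is_trig_mxP tA).
pose G x := (\int[lebesgue_cV R n]_y f (cV_cons (x, y)))%E.
have mG : measurable_fun setT G.
  apply: (@measurable_fun_fubini_tonelli_F _ _ _ _ _ _ (f \o @cV_cons R n)).
    exact: measurableT_comp mf (@measurable_cV_cons R n).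
  by move=> ?; exact: f0.
have G0 x : (0 <= G x)%E by apply: integral_ge0 => y _; exact: f0.
rewrite integral_cV_head_tail//; last first.
  by apply: measurableT_comp => //; exact: measurable_cV_affine.
transitivity (\int[leb]_x ((`|\det (drsubmx A)|^-1)%:E * G (A 0 0 * x + b 0 0)%R))%E.
  apply: eq_integral => x _.
  under eq_integral do rewrite cV_cons_affine ur0 mul0mx [X in X + b 0 0]mxE add0r.
  rewrite (IHn _ trA d0 _ (fun y => f (cV_cons (A 0 0 * x + b 0 0, y))))//.
  by apply: measurableT_comp => //; exact: measurable_cV_consr.
rewrite ge0_integralZl_EFin//; last first.
  by apply: (measurableT_comp mG); exact: measurable_affine_line.
rewrite integral_lebesgue_affine// -(integral_cV_head_tail mf f0).
by rewrite muleA -EFinM normrM invfM [(_ * _)%R]mulrC.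
Qed.

(** Mirror image of the lower triangular case: the tail of [A x + b] depends on
that of [x] alone, so the head is integrated first. *)
Lemma upper_triangular_scaling n (A : 'M[R]_n) : is_trig_mx A^T -> \det A != 0 ->
  affine_scaling A.
Proof.
elim: n A => [A _ _ b f mf f0|n IHn].
  rewrite det_mx00 normr1 invr1 mul1e; apply: eq_integral => x _.
  by congr f; rewrite !flatmx0.
rewrite -[n.+1]/(1 + n)%N => A tA dA b f mf f0.
have dl0 : dlsubmx A = 0.
  apply/matrixP => i j; rewrite !mxE -[LHS]/(A _ _).
  have := is_trig_mxP tA (lshift n j) (rshift 1 i); rewrite mxE; apply.
  by rewrite ord1.
have detA : \det A = A 0 0 * \det (drsubmx A).
  rewrite -{1}[A]submxK dl0 det_ublock det_mx11 !mxE.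
  by congr (A _ _ * _); exact/val_inj.
move: dA; rewrite detA mulf_eq0 negb_or => /andP[a0 d0].
have trA : is_trig_mx (drsubmx A)^T.
  apply/is_trig_mxP => i j ij; rewrite !mxE.
  by have := is_trig_mxP tA (rshift 1 i) (rshift 1 j); rewrite mxE; apply.
pose G y := (\int[leb]_x f (cV_cons (x, y) : 'cV_n.+1))%E.
have mG : measurable_fun setT G.
  apply: (@measurable_fun_fubini_tonelli_G _ _ _ _ _ _ (f \o @cV_cons R n)).
    exact: measurableT_comp mf (@measurable_cV_cons R n).
  by move=> ?; exact: f0.
have G0 y : (0 <= G y)%E by apply: integral_ge0 => x _; exact: f0.
rewrite integral_cV_tail_head//; last first.
  by apply: measurableT_comp => //; exact: measurable_cV_affine.
transitivity (\int[lebesgue_cV R n]_y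
    ((`|A 0 0|^-1)%:E * G (drsubmx A *m y + dsubmx b)%R))%E.
  apply: eq_integral => y _.
  under eq_integral do rewrite cV_cons_affine dl0 mul0mx add0r.
  rewrite (@integral_lebesgue_affine R (A 0 0) _
    (fun x => f (cV_cons (x, (drsubmx A *m y + dsubmx b)%R))))//.
  by apply: measurableT_comp => //; exact: measurable_cV_consl.
rewrite ge0_integralZl_EFin//; last first.
  by apply: (measurableT_comp mG); exact: measurable_cV_affine.
rewrite IHn// -(integral_cV_tail_head mf f0).
by rewrite muleA -EFinM normrM invfM.
Qed.

End triangular_change_of_variables.

(** * Invertible matrices as products of triangular ones *)

Section triangular_generation.
Variable F : fieldType.

Lemma tperm_mx_delta n (i j : 'I_n) : i != j -> tperm_mx i j =
  1%:M + delta_mx i j + delta_mx j i - delta_mx i i - delta_mx j j :> 'M[F]_n.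
Proof.
move=> ij; apply/matrixP => k l; rewrite !mxE.
case: tpermP => [->|->|/eqP ki /eqP kj].
- rewrite eqxx (negbTE ij) /= [j == l]eq_sym [i == l]eq_sym; ring.
- rewrite eqxx [j == i]eq_sym (negbTE ij) /= [j == l]eq_sym [i == l]eq_sym; ring.
- by rewrite (negbTE ki) (negbTE kj) /= !subr0 !addr0.
Qed.

(** Three transvections exchange two coordinates up to a sign, which the diagonal
factor corrects; every factor is triangular. *)
Lemma tperm_mx_transvections n (i j : 'I_n) : i != j -> tperm_mx i j =
  (1%:M - delta_mx j j *+ 2) *m
  ((1%:M + delta_mx i j) *m ((1%:M - delta_mx j i) *m (1%:M + delta_mx i j)))
  :> 'M[F]_n.
Proof.
move=> ij; rewrite tperm_mx_delta//.
have ji : j != i by rewrite eq_sym.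
have d a b c e : delta_mx a b *m delta_mx c e = delta_mx a e *+ (b == c) :> 'M[F]_n.
  exact: mul_delta_mx_cond.
rewrite !(mulmxDl, mulmxDr, mulNmx, mulmxN, mul1mx, mulmx1, d, eqxx, negbTE ij,
  negbTE ji, mulr0n, mulr1n, oppr0, addr0, mulmx0, mul0mx, mulrnBl, mulrnDl).
apply/matrixP => a b; rewrite !mxE; ring.
Qed.

(** By the LUP decomposition an invertible matrix is a product of a permutation, a
lower and an upper triangular matrix, and permutations are products of
transpositions, hence of triangular matrices.  The determinant identities for
linear changes of variables are proved by this induction. *)
Lemma unitmx_triangular_ind n (Pr : 'M[F]_n -> Prop) :
  (forall A, is_trig_mx A -> A \in unitmx -> Pr A) ->
  (forall A, is_trig_mx A^T -> A \in unitmx -> Pr A) ->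
  (forall A B, A \in unitmx -> B \in unitmx -> Pr A -> Pr B -> Pr (A *m B)) ->
  forall A, A \in unitmx -> Pr A.
Proof.
move=> PL PU PM A uA.
have P1 : Pr 1%:M by apply: PL; [exact: scalar_mx_is_trig|exact: unitmx1].
have PMu B C : B \in unitmx /\ Pr B -> C \in unitmx /\ Pr C ->
    B *m C \in unitmx /\ Pr (B *m C).
  by move=> [uB PB] [uC PC]; split; [rewrite unitmx_mul uB|exact: PM].
have trans (i j : 'I_n) (c : F) : i != j ->
    1%:M + c *: delta_mx i j \in unitmx /\ Pr (1%:M + c *: delta_mx i j).
  move=> ij; have uE : 1%:M + c *: delta_mx i j \in unitmx.
    suff /mulmx1_unit[] : (1%:M + c *: delta_mx i j) *m (1%:M - c *: delta_mx i j)
        = 1%:M :> 'M[F]_n by [].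
    rewrite mulmxBr mulmx1 mulmxDl mul1mx -scalemxAl -scalemxAr mul_delta_mx_cond.
    by rewrite eq_sym (negbTE ij) mulr0n !scaler0 addr0 addrK.
  split => //; have [lt_ij|] := ltnP i j.
    apply: PU => //; apply/is_trig_mxP => k l kl; rewrite !mxE.
    rewrite [l == k]eq_sym -val_eqE /= ltn_eqF// mulr0n add0r.
    by case: eqP => [li|]; case: eqP => [kj|] //=; rewrite ?mulr0//;
      move: kl; rewrite li kj ltnNge ltnW.
  rewrite leq_eqVlt => /predU1P[/val_inj ji|lt_ji]; first by rewrite ji eqxx in ij.
  apply: PL => //; apply/is_trig_mxP => k l kl; rewrite !mxE.
  rewrite -val_eqE /= ltn_eqF// mulr0n add0r.
  by case: eqP => [li|]; case: eqP => [kj|] //=; rewrite ?mulr0//;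
    move: kl; rewrite li kj ltnNge ltnW.
have Ptperm (i j : 'I_n) : (tperm_mx i j : 'M[F]_n) \in unitmx /\ Pr (tperm_mx i j).
  have [->|ij] := eqVneq i j.
    by rewrite /tperm_mx tperm1 perm_mx1; split; [exact: unitmx1|exact: P1].
  have ji : j != i by rewrite eq_sym.
  rewrite tperm_mx_transvections//; apply: (PMu); last apply: (PMu); last apply: (PMu).
  - have diagE : 1%:M - delta_mx j j *+ 2 =
        diag_mx (\row_k (1 - (k == j)%:R *+ 2)) :> 'M[F]_n.
      apply/matrixP => k l; rewrite !mxE.
      have [->|kl] := eqVneq k l; first by rewrite andbb mulr1n.
      rewrite !mulr0n add0r; case: andP => [[/eqP kj /eqP lj]|_].
        by rewrite kj lj eqxx in kl.
      by rewrite /= addr0 oppr0.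
    have uD : 1%:M - delta_mx j j *+ 2 \in @unitmx F n.
      rewrite diagE unitmxE unitfE det_diag; apply/prodf_neq0 => k _.
      by rewrite mxE; case: (k == j); rewrite ?mul0rn ?subr0 ?oner_eq0// mulr2n opprD addrA
        subrr sub0r oppr_eq0 oner_eq0.
    by split => //; apply: PL => //; rewrite diagE; apply: diag_mx_is_trig.
  - by have := trans i j 1 ij; rewrite scale1r.
  - by have := trans j i (-1) ji; rewrite scaleN1r.
  - by have := trans i j 1 ij; rewrite scale1r.
have Pperm (s : 'S_n) : (perm_mx s : 'M[F]_n) \in unitmx /\ Pr (perm_mx s).
  have [ts -> _] := prod_tpermP s.
  elim: ts => [|t ts IH]; first by rewrite big_nil perm_mx1; split; [exact: unitmx1|exact: P1].
  by rewrite big_cons perm_mxM; apply: PMu => //; exact: Ptperm.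
case: n => [|n] in A uA Pr PL PU PM P1 PMu trans Ptperm Pperm *.
  by apply: PL => //; apply/is_trig_mxP => -[].
case E : (cormen_lup A) => [[P L] U].
have := cormen_lup_perm A; have := cormen_lup_correct A.
have := cormen_lup_lower A; have := cormen_lup_upper A; rewrite E /= => Uu Ll PA Pp.
have [s Ps] := is_perm_mxP _ Pp.
have uP : P \in unitmx by rewrite Ps; exact: (Pperm s).1.
have : L * U \in unitmx by rewrite -PA unitmx_mul uP.
rewrite unitmx_mul => /andP[uL uU].
have -> : A = invmx P *m (L *m U) by rewrite -[L *m U]PA mulKmx.
apply: (PM); rewrite ?unitmx_inv ?unitmx_mul ?uL//.
  by rewrite Ps -[invmx _]/((perm_mx s)^-1) -perm_mxV; exact: (Pperm _).2.
apply: PM => //.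
  by apply: PL => //; apply/is_trig_mxP => i j ij; rewrite Ll 1?ltnW// -val_eqE /= ltn_eqF.
by apply: PU => //; apply/is_trig_mxP => i j ij; rewrite mxE Uu.
Qed.

End triangular_generation.

Section linear_change_of_variables.
Variable R : realType.

Lemma unitmx_scaling n (A : 'M[R]_n) : \det A != 0 -> affine_scaling A.
Proof.
rewrite -unitfE -unitmxE; move: A.
apply: unitmx_triangular_ind => [A|A|A B uA uB IA IB].
- by move=> tA; rewrite unitmxE unitfE; exact: lower_triangular_scaling.
- by move=> tA; rewrite unitmxE unitfE; exact: upper_triangular_scaling.
move=> b f mf f0.
under eq_integral do rewrite -mulmxA -[X in f (A *m X + b)]addr0.
rewrite (IB 0 (fun x => f (A *m x + b)))//; last first.
  by apply: measurableT_comp => //; exact: measurable_cV_affine.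
by rewrite IA// muleA -EFinM det_mulmx normrM invfM mulrC.
Qed.

Lemma lebesgue_cV_affine_preimage n (A : 'M[R]_n) (b : 'cV[R]_n) (S : set 'cV[R]_n) :
  \det A != 0 -> measurable S ->
  (lebesgue_cV R n [set x : 'cV_n | S (A *m x + b)%R] =
   (`|\det A|^-1)%:E * lebesgue_cV R n S)%E.
Proof.
move=> dA mS.
have mAS : measurable [set x : 'cV_n | S (A *m x + b)].
  by rewrite -[X in measurable X]setTI; exact: measurable_cV_affine.
have IE (B : set 'cV[R]_n) : measurable B ->
    (lebesgue_cV R n B = \int[lebesgue_cV R n]_x (\1_B x)%:E)%E.
  by move=> mB; rewrite integral_indic ?setIT.
rewrite !IE// -(unitmx_scaling dA b) //.
exact/measurable_EFinP/measurable_indic.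
Qed.

End linear_change_of_variables.

(** * Determinants of linear maps between matrices *)

Section determinant_rank_function.
Variable F : comRingType.

(** A matrix that only moves an index to one of larger rank is triangular for any
ordering of the indices by rank.  No ordering is chosen here: a permutation that
contributes to the determinant cannot decrease the rank of any index, so it
preserves all ranks because the total rank is preserved, and it is then the
identity. *)
Lemma det_rank_triangular n (A : 'M[F]_n) (rho : 'I_n -> nat) :
  (forall i j, A i j != 0 -> i = j \/ (rho i < rho j)%N) ->
  \det A = \prod_i A i i.
Proof.
move=> Arho; rewrite /determinant (bigD1 (perm_one 'I_n)) //=.
rewrite odd_perm1 expr0 mul1r; under eq_bigr do rewrite perm1.
rewrite [X in _ + X]big1 ?addr0// => s s1.
have [i Ai0|A0] := pickP (fun i => A i (s i) == 0).
  by rewrite (bigD1 i)//= (eqP Ai0) mul0r mulr0.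
have rho_le i : (rho i <= rho (s i) ?= iff (rho i == rho (s i)))%N.
  split => //; have := Arho i (s i); rewrite A0 => /(_ isT)[<-//|]; exact: ltnW.
have [_ /esym] := leqif_sum (fun i (_ : true) => rho_le i).
have -> : (\sum_i rho (s i) = \sum_i rho i)%N.
  by rewrite [RHS](reindex_inj (@perm_inj _ s)).
rewrite eqxx => /forallP/= rhoE.
case/negP: s1; apply/eqP/permP => i; rewrite perm1.
have := Arho i (s i); rewrite A0 => /(_ isT)[<-//|].
by rewrite (eqP (rhoE i)) ltnn.
Qed.

Lemma lin_mxE n (phi : {linear 'M[F]_n -> 'M[F]_n}) i j k l :
  lin_mx phi (mxvec_index i j) (mxvec_index k l) = phi (delta_mx i j) k l.
Proof. by rewrite !mxE /= vec_mx_delta mxvecE. Qed.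

Lemma det_lin_mx_triangular n (phi : {linear 'M[F]_n -> 'M[F]_n})
    (rho : 'I_n -> 'I_n -> nat) :
  (forall i j k l, phi (delta_mx i j) k l != 0 ->
     (i = k /\ j = l) \/ (rho i j < rho k l)%N) ->
  \det (lin_mx phi) = \prod_i \prod_j phi (delta_mx i j) i j.
Proof.
move=> phirho.
have [unvec vecK unvecK] := curry_mxvec_bij n n.
pose rho' x := let: (i, j) := unvec x in rho i j.
have rho'E i j : rho' (mxvec_index i j) = rho i j.
  by rewrite /rho' (vecK (i, j)).
rewrite (@det_rank_triangular _ _ rho') => [|x y].
  rewrite (reindex _ (curry_mxvec_bij n n)) /=.
  by rewrite pair_bigA /=; apply: eq_bigr => -[i j] _ /=; exact: lin_mxE.
case/mxvec_indexP: x => i j; case/mxvec_indexP: y => k l.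
by rewrite lin_mxE !rho'E => /phirho[[-> ->]|]; [left|right].
Qed.

Lemma lin_mx_comp n (f g h : {linear 'M[F]_n -> 'M[F]_n}) :
  (forall X, h X = g (f X)) -> lin_mx h = lin_mx f *m lin_mx g.
Proof.
move=> hE; apply/row_matrixP => i; rewrite !rowE mulmxA.
by rewrite !mul_rV_lin hE /= mxvecK.
Qed.

End determinant_rank_function.

Section det_multiplication.
Variable F : fieldType.

Lemma mulmx_deltaE n (A : 'M[F]_n) (i j k l : 'I_n) :
  (A *m delta_mx i j) k l = A k i *+ (j == l).
Proof.
rewrite mxE (bigD1 i)//= big1 => [|m mi]; last by rewrite mxE (negbTE mi) mulr0.
by rewrite mxE eqxx /= addr0 eq_sym mulr_natr.
Qed.

Lemma delta_mulmxE n (A : 'M[F]_n) (i j k l : 'I_n) :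
  (delta_mx i j *m A) k l = A j l *+ (i == k).
Proof.
rewrite mxE (bigD1 j)//= big1 => [|m mi]; last by rewrite mxE (negbTE mi) andbF mul0r.
by rewrite mxE eqxx /= addr0 andbT eq_sym mulr_natl.
Qed.

Lemma det_trig_tr n (A : 'M[F]_n) : is_trig_mx A^T -> \det A = \prod_i A i i.
Proof. by move=> tA; rewrite -det_tr det_trig//; apply: eq_bigr => i _; rewrite mxE. Qed.

(** Left multiplication by [A] acts on each of the [n] columns separately. *)
Lemma det_lin_mulmx n (A : 'M[F]_n) : A \in unitmx ->
  \det (lin_mx (mulmx A : 'M[F]_n -> 'M[F]_n)) = \det A ^+ n.
Proof.
move: A; apply: unitmx_triangular_ind => [A tA _|A tA _|A B _ _ IA IB].
- rewrite (@det_lin_mx_triangular _ _ _ (fun i _ => i)).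
    rewrite det_trig// -prodrXl; apply: eq_bigr => i _.
    under eq_bigr do rewrite /= mulmx_deltaE eqxx mulr1n.
    by rewrite prodr_const card_ord.
  move=> i j k l /=; rewrite mulmx_deltaE; case: (j =P l) => [->|_]; last by rewrite eqxx.
  rewrite mulr1n; case: (ltngtP k i) => [ki|ik|/val_inj ->]; [|by right|by left].
  by rewrite (is_trig_mxP tA) ?eqxx.
- rewrite (@det_lin_mx_triangular _ _ _ (fun i _ => n - i)%N).
    rewrite det_trig_tr// -prodrXl; apply: eq_bigr => i _.
    under eq_bigr do rewrite /= mulmx_deltaE eqxx mulr1n.
    by rewrite prodr_const card_ord.
  move=> i j k l /=; rewrite mulmx_deltaE; case: (j =P l) => [->|_]; last by rewrite eqxx.
  rewrite mulr1n; case: (ltngtP k i) => [ki|ik|/val_inj ->]; [right; exact: ltn_sub2l|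
    |by left].
  by have := is_trig_mxP tA _ _ ik; rewrite mxE => ->; rewrite eqxx.
rewrite (@lin_mx_comp _ _ (mulmx B) (mulmx A)) ?det_mulmx ?IA ?IB ?exprMn 1?mulrC//.
by move=> X /=; rewrite mulmxA.
Qed.

Lemma det_lin_mulmxr n (A : 'M[F]_n) : A \in unitmx ->
  \det (lin_mx (mulmxr A : 'M[F]_n -> 'M[F]_n)) = \det A ^+ n.
Proof.
move: A; apply: unitmx_triangular_ind => [A tA _|A tA _|A B _ _ IA IB].
- rewrite (@det_lin_mx_triangular _ _ _ (fun _ j => n - j)%N).
    rewrite det_trig// exchange_big /= -prodrXl; apply: eq_bigr => i _.
    under eq_bigr do rewrite /= delta_mulmxE eqxx mulr1n.
    by rewrite prodr_const card_ord.
  move=> i j k l /=; rewrite delta_mulmxE; case: (i =P k) => [->|_]; last by rewrite eqxx.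
  rewrite mulr1n; case: (ltngtP j l) => [jl|lj|/val_inj ->]; [|right; exact: ltn_sub2l|by left].
  by rewrite (is_trig_mxP tA) ?eqxx.
- rewrite (@det_lin_mx_triangular _ _ _ (fun _ j => j)%N).
    rewrite det_trig_tr// exchange_big /= -prodrXl; apply: eq_bigr => i _.
    under eq_bigr do rewrite /= delta_mulmxE eqxx mulr1n.
    by rewrite prodr_const card_ord.
  move=> i j k l /=; rewrite delta_mulmxE; case: (i =P k) => [->|_]; last by rewrite eqxx.
  rewrite mulr1n; case: (ltngtP j l) => [jl|lj|/val_inj ->]; [by right| |by left].
  by have := is_trig_mxP tA _ _ lj; rewrite mxE => ->; rewrite eqxx.
rewrite (@lin_mx_comp _ _ (mulmxr A) (mulmxr B)) ?det_mulmx ?IA ?IB ?exprMn//.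
by move=> X /=; rewrite mulmxA.
Qed.

End det_multiplication.

Lemma measurable_set_eq0 (R : realType) d (T : measurableType d) (f : T -> R) :
  measurable_fun setT f -> measurable [set x | f x == 0].
Proof.
move=> mf; have m0 : measurable_fun setT (fun x => f x == 0).
  exact: measurable_fun_eqr.
by rewrite -[X in measurable X]setTI; exact: (m0 measurableT [set true]).
Qed.

(** * Lebesgue measure on square matrices *)

Section lebesgue_mx.
Variable R : realType.

Definition mx_of_cV n (v : 'cV[R]_(n * n)) : 'M[R]_n := vec_mx v^T.

Definition cV_of_mx n (X : 'M[R]_n) : 'cV[R]_(n * n) := (mxvec X)^T.

Lemma mx_of_cVK n : cancel (@mx_of_cV n) (@cV_of_mx n).
Proof. by move=> v; rewrite /cV_of_mx /mx_of_cV vec_mxK trmxK. Qed.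

Lemma cV_of_mxK n : cancel (@cV_of_mx n) (@mx_of_cV n).
Proof. by move=> X; rewrite /cV_of_mx /mx_of_cV trmxK mxvecK. Qed.

Lemma measurable_mx_of_cV n : measurable_fun setT (@mx_of_cV n).
Proof.
apply: measurable_fun_mx => i j.
under [X in measurable_fun _ X]eq_fun do rewrite !mxE.
exact: measurable_mx_entry.
Qed.

Lemma measurable_cV_of_mx n : measurable_fun setT (@cV_of_mx n).
Proof.
apply: measurable_fun_mx => i j; case/mxvec_indexP: i => k l.
rewrite (ord1 j); under [X in measurable_fun _ X]eq_fun do rewrite mxE mxvecE.
exact: measurable_mx_entry.
Qed.

Definition lebesgue_mx n : set 'M[R]_n -> \bar R :=
  image_measure (lebesgue_cV R (n * n)) (@measurable_mx_of_cV n).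

HB.instance Definition _ n := Measure.copy (lebesgue_mx (n := n))
  (image_measure (lebesgue_cV R (n * n)) (@measurable_mx_of_cV n)).

Let lebesgue_mx_sigma_finite n : sigma_finite setT (@lebesgue_mx n).
Proof.
have [F TF Foo] := sigma_finiteT (lebesgue_cV R (n * n)).
exists (fun k => (@cV_of_mx n) @^-1` F k).
  by rewrite -preimage_bigcup -TF preimage_setT.
move=> k; have [mF Fk] := Foo k; split.
  by rewrite -[X in measurable X]setTI; exact: measurable_cV_of_mx.
rewrite /lebesgue_mx /= /pushforward -comp_preimage.
rewrite (_ : _ \o _ = id) ?preimage_id//.
by apply/funext => v /=; rewrite mx_of_cVK.
Qed.

HB.instance Definition _ n := Measure_isSigmaFinite.Build _ _ _ (@lebesgue_mx n)
  (@lebesgue_mx_sigma_finite n).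

Lemma integral_lebesgue_mx n (f : 'M[R]_n -> \bar R) :
  measurable_fun setT f -> (forall X, 0 <= f X)%E ->
  (\int[@lebesgue_mx n]_X f X = \int[lebesgue_cV R (n * n)]_v f (mx_of_cV v))%E.
Proof.
move=> mf f0.
exact: (ge0_integral_image_measure (lebesgue_cV R (n * n)) (@measurable_mx_of_cV n) mf f0).
Qed.

Lemma integral_lebesgue_mx_affine n (phi : {linear 'M[R]_n -> 'M[R]_n}) B
    (f : 'M[R]_n -> \bar R) : \det (lin_mx phi) != 0 ->
  measurable_fun setT f -> (forall X, 0 <= f X)%E ->
  measurable_fun setT phi ->
  (\int[@lebesgue_mx n]_X f (phi X + B)%R =
   (`|\det (lin_mx phi)|^-1)%:E * \int[@lebesgue_mx n]_X f X)%E.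
Proof.
move=> dphi mf f0 mphi; rewrite !integral_lebesgue_mx//; last first.
  by apply: (measurableT_comp mf); exact: measurable_addmx.
have dT : \det (lin_mx phi)^T != 0 by rewrite det_tr.
rewrite -[in RHS]det_tr -(unitmx_scaling dT (cV_of_mx B))//; last first.
  by apply: (measurableT_comp mf); exact: measurable_mx_of_cV.
apply: eq_integral => v _; congr f.
rewrite -[in LHS](cV_of_mxK B) -[phi _]mxvecK -mul_vec_lin /mx_of_cV /cV_of_mx.
by rewrite vec_mxK !raddfD /= trmx_mul !trmxK.
Qed.

Lemma integral_lebesgue_mx_mull n (A : 'M[R]_n) (f : 'M[R]_n -> \bar R) :
  \det A != 0 -> measurable_fun setT f -> (forall X, 0 <= f X)%E ->
  (\int[@lebesgue_mx n]_X f (A *m X) =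
   ((`|\det A| ^+ n)^-1)%:E * \int[@lebesgue_mx n]_X f X)%E.
Proof.
move=> dA mf f0; have uA : A \in unitmx by rewrite unitmxE unitfE.
under eq_integral do rewrite -[A *m _]addr0.
rewrite (@integral_lebesgue_mx_affine n (mulmx A : 'M[R]_n -> 'M[R]_n)) ?det_lin_mulmx//.
- by rewrite normrX.
- by rewrite expf_neq0.
- exact: measurable_mulmx.
Qed.

Lemma integral_lebesgue_mx_mulr n (A : 'M[R]_n) (f : 'M[R]_n -> \bar R) :
  \det A != 0 -> measurable_fun setT f -> (forall X, 0 <= f X)%E ->
  (\int[@lebesgue_mx n]_X f (X *m A) =
   ((`|\det A| ^+ n)^-1)%:E * \int[@lebesgue_mx n]_X f X)%E.
Proof.
move=> dA mf f0; have uA : A \in unitmx by rewrite unitmxE unitfE.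
under eq_integral do rewrite -[_ *m A]addr0.
rewrite (@integral_lebesgue_mx_affine n (mulmxr A : 'M[R]_n -> 'M[R]_n)) ?det_lin_mulmxr//.
- by rewrite normrX.
- by rewrite expf_neq0.
- exact: measurable_mulmx.
Qed.

Lemma integral_lebesgue_mx_translation n (B : 'M[R]_n) (f : 'M[R]_n -> \bar R) :
  measurable_fun setT f -> (forall X, 0 <= f X)%E ->
  (\int[@lebesgue_mx n]_X f (X + B)%R = \int[@lebesgue_mx n]_X f X)%E.
Proof.
move=> mf f0.
have id1 : \det (lin_mx (idfun : 'M[R]_n -> 'M[R]_n)) = 1.
  rewrite (_ : lin_mx _ = 1%:M) ?det1//; apply/row_matrixP => i.
  by rewrite !rowE mulmx1 mul_rV_lin /= vec_mxK.
have := @integral_lebesgue_mx_affine n idfun B f; rewrite id1 => ->//.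
  by rewrite normr1 invr1 mul1e.
exact: measurable_id.
Qed.

Definition mx_box m n (a b : R) : set 'M[R]_(m, n) :=
  [set X | forall i j, a <= X i j <= b].
Arguments mx_box : clear implicits.

Lemma measurable_mx_box m n a b : measurable (mx_box m n a b).
Proof.
rewrite (_ : mx_box m n a b = \bigcap_(ij in [set: 'I_m * 'I_n])
    ((fun B : 'M[R]_(m, n) => B ij.1 ij.2) @^-1` `[a, b]%classic)).
  apply: fin_bigcap_measurable => [|[i j] _]; first exact: finite_finset.
  by rewrite -[X in measurable X]setTI; apply: measurable_mx_entry.
apply/seteqP; split => [B AB [i j] _|B AB i j] /=.
  by rewrite in_itv/=; exact: AB.
by have := AB (i, j) Logic.I; rewrite /= in_itv.
Qed.

Lemma cV_cons_head n (p : measurableTypeR R * 'cV[R]_n) k j :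
  cV_cons p (lshift n (k : 'I_1)) j = p.1.
Proof. by rewrite /cV_cons [LHS](@col_mxEu _ 1 n) !ord1 mxE eqxx mulr1n. Qed.

Lemma cV_cons_tail n (p : measurableTypeR R * 'cV[R]_n) i j :
  cV_cons p (rshift 1 i) j = p.2 i j.
Proof. by rewrite /cV_cons [LHS](@col_mxEd _ 1 n). Qed.

Lemma lebesgue_cV_box n (a b : R) : a <= b ->
  lebesgue_cV R n (mx_box n 1 a b) = ((b - a) ^+ n)%:E.
Proof.
move=> ab; elim: n => [|n IHn].
  by rewrite /= diracE mem_set// => -[].
change (((@lebesgue_measure R) \x (lebesgue_cV R n))%E
  ((@cV_cons R n) @^-1` mx_box n.+1 1 a b) = ((b - a) ^+ n.+1)%:E).
have -> : (@cV_cons R n) @^-1` mx_box n.+1 1 a b =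
    `[a, b]%classic `*` mx_box n 1 a b.
  apply/seteqP; split => [[x y] /= xy|[x y] /= [xab yab] i j].
    split => [|i j].
      by have := xy (lshift n (ord0 : 'I_1)) ord0; rewrite cV_cons_head /= in_itv.
    by have := xy (rshift 1 i) j; rewrite cV_cons_tail.
  case: (split_ordP (i : 'I_(1 + n))) => k ->; rewrite ?cV_cons_head ?cV_cons_tail//.
rewrite product_measure1E//; last exact: measurable_mx_box.
rewrite [X in (_ * X)%E]IHn [X in (X * _)%E]lebesgue_measure_itv/= lte_fin.
move: ab; rewrite le_eqVlt => /predU1P[->|->]; last by rewrite -EFinB -EFinM exprS.
by rewrite ltxx mul0e subrr expr0n.
Qed.

Lemma lebesgue_mx_box n (a b : R) : a <= b ->
  @lebesgue_mx n (mx_box n n a b) = ((b - a) ^+ (n * n))%:E.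
Proof.
move=> ab; rewrite -(lebesgue_cV_box _ ab).
change (lebesgue_cV R (n * n) (@mx_of_cV n @^-1` mx_box n n a b) =
  lebesgue_cV R (n * n) (mx_box (n * n) 1 a b)).
congr (lebesgue_cV _ _ _); apply/seteqP; split => v vab i j.
  case/mxvec_indexP: i => k l; have := vab k l.
  by rewrite /mx_of_cV !mxE ord1.
by have := vab (mxvec_index i j) 0; rewrite /mx_of_cV !mxE.
Qed.

Lemma det_shift_null n (A : 'M[R]_n) :
  @lebesgue_measure R [set x | \det (A + x%:M) == 0] = 0.
Proof.
apply: countable_lebesgue_measure0; apply: finite_set_countable.
have -> : [set x | \det (A + x%:M) == 0] = [set x | root (char_poly (- A)) x].
  apply/seteqP; split => x /=; rewrite -eigenvalue_root_char /eigenvalue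
    /eigenspace kermx_eq0 row_free_unit unitmxE unitfE negbK -opprD -scaleN1r detZ
    mulf_eq0 expf_eq0 oppr_eq0 oner_eq0 andbF //.
apply: contrapT => /(infinite_set_fset (size (char_poly (- A)))).
move=> [B Broot]; apply/negP; rewrite -ltnNge; apply: max_poly_roots.
- exact/monic_neq0/char_poly_monic.
- by apply/allP => x xB; exact: Broot.
- exact: fset_uniq.
Qed.

(** Singular matrices are negligible: on each line [X + t 1] the determinant is,
up to sign, a characteristic polynomial in [t], with finitely many roots, so
averaging over the translations by [t 1], [0 <= t <= 1], and Fubini's theorem
give measure [0].  The cases of interest for [phi] are the identity
and the projection onto block upper triangular matrices. *)
Lemma lebesgue_mx_null_det n (phi : {linear 'M[R]_n -> 'M[R]_n}) :
  measurable_fun setT phi -> phi 1%:M = 1%:M ->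
  @lebesgue_mx n [set X | \det (phi X) == 0] = 0.
Proof.
move=> mphi phi1; set N := [set X | _].
have mN : measurable N.
  exact/measurable_set_eq0/measurable_det.
pose f (X : 'M[R]_n) : \bar R := (\1_N X)%:E.
have mf : measurable_fun setT f by exact/measurable_EFinP/measurable_indic.
have f0 X : (0 <= f X)%E by rewrite lee_fin.
pose U : set (measurableTypeR R) := `[0, 1]%classic.
have mU : measurable U by exact: measurable_itv.
have mg : measurable_fun setT
    (fun p : measurableTypeR R * 'M[R]_n => ((\1_U p.1)%:E * f (p.2 + p.1%:M)%R)%E).
  apply: emeasurable_funM.
    apply/measurable_EFinP; apply: (measurableT_comp _ measurable_fst).
    exact: measurable_indic.
  apply: (measurableT_comp mf); apply: measurable_addmx => //.
  apply: measurable_fun_mx => i j.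
  under [X in measurable_fun _ X]eq_fun do rewrite mxE -mulr_natr.
  exact: measurable_funM.
have g0 (p : measurableTypeR R * 'M[R]_n) :
    (0 <= (\1_U p.1)%:E * f (p.2 + p.1%:M)%R)%E.
  by apply: mule_ge0 => //; rewrite lee_fin.
have int_f : (\int[@lebesgue_mx n]_X f X = @lebesgue_mx n N)%E.
  by rewrite integral_indic ?setIT.
have mX x : measurable_fun setT (fun X : 'M[R]_n => f (X + x%:M)).
  by apply: (measurableT_comp mf); exact: measurable_addmx.
have inner x : (\int[@lebesgue_mx n]_X ((\1_U x)%:E * f (X + x%:M)%R) =
    @lebesgue_mx n N * (\1_U x)%:E)%E.
  rewrite ge0_integralZl_EFin// ?lee_fin//.
  by rewrite integral_lebesgue_mx_translation// int_f muleC.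
have outer X :
    (\int[@lebesgue_measure R]_x ((\1_U x)%:E * f (X + x%:M)%R) = 0)%E.
  have mx : measurable_fun setT
      (fun x : measurableTypeR R => ((\1_U x)%:E * f (X + x%:M)%R)%E).
    have mpair : measurable_fun setT
      (fun x : measurableTypeR R => (x, X)) by exact: measurable_fun_pair.
    exact: (measurableT_comp mg mpair).
  apply/eqP; rewrite eq_le; apply/andP; split; last first.
    by apply: integral_ge0 => x _; exact: (g0 (x, X)).
  have mlin : measurable_fun setT (fun x : measurableTypeR R => phi X + x%:M).
    apply: measurable_addmx => //; apply: measurable_fun_mx => i j.
    under [Y in measurable_fun _ Y]eq_fun do rewrite mxE -mulr_natr.
    exact: measurable_funM.
  have mroot := measurable_set_eq0 (measurable_det mlin).
  apply: (@le_trans _ _ (\int[@lebesgue_measure R]_x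
      (\1_[set x : R | \det (phi X + x%:M) == 0] x)%:E)%E); last first.
    by rewrite integral_indic// setIT [leLHS](det_shift_null (phi X)).
  apply: ge0_le_integral => //.
  - by move=> x _; exact: (g0 (x, X)).
  - exact/measurable_EFinP/measurable_indic.
  move=> x _; rewrite -[leRHS]mul1e; apply: lee_pmul; rewrite ?lee_fin//.
  have phiD : phi (X + x%:M) = phi X + x%:M.
    by rewrite -[x%:M]scalemx1 linearD linearZ /= phi1.
  rewrite !indicE (_ : (X + x%:M \in N) =
    (x \in [set x0 : R | \det (phi X + x0%:M) == 0]))//.
  by apply/idP/idP => /set_mem h; apply/mem_set; move: h; rewrite /N /= phiD.
have := fubini_tonelli (m1 := @lebesgue_measure R) (m2 := @lebesgue_mx n) _ mg g0.
rewrite /fubini_F /fubini_G /=; under eq_integral do rewrite inner.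
rewrite ge0_integralZl//; last first.
  exact/measurable_EFinP/measurable_indic.
rewrite integral_indic// setIT [X in (_ * X)%E]lebesgue_measure_itv/= lte_fin ltr01 oppr0 adde0 mule1.
by under eq_integral do rewrite outer; rewrite integral0.
Qed.

End lebesgue_mx.
Arguments mx_box {R} m n a b.
Arguments lebesgue_mx R n : clear implicits.

(** * Volume scaling of linear maps on subspaces *)

Section gram_volume.
Variable R : realType.

Lemma unitmx_inj n (A : 'M[R]_n) :
  (forall x : 'cV[R]_n, A *m x = 0 -> x = 0) -> A \in unitmx.
Proof.
move=> A0; rewrite -unitmx_tr -row_free_unit -kermx_eq0.
apply/eqP/row_matrixP => i; rewrite row0; apply: trmx_inj; rewrite trmx0.
apply: A0; rewrite -{1}[A]trmxK -trmx_mul -row_mul mulmx_ker row0.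
by rewrite trmx0.
Qed.

(** Both sides are the determinant of the block matrix with rows [1, -U] and
[V, 1], factored in two ways. *)
Lemma det_Sylvester m n (U : 'M[R]_(m, n)) (V : 'M[R]_(n, m)) :
  \det (1%:M + U *m V) = \det (1%:M + V *m U).
Proof.
have E1 : block_mx 1%:M (- U) V 1%:M =
    block_mx 1%:M 0 V 1%:M *m block_mx 1%:M (- U) 0 (1%:M + V *m U).
  rewrite mulmx_block !(mul1mx, mul0mx, mulmx1, mulmx0, addr0, add0r).
  by rewrite mulmxN addrC addrK.
have E2 : block_mx 1%:M (- U) V 1%:M =
    block_mx (1%:M + U *m V) (- U) 0 1%:M *m block_mx 1%:M 0 V 1%:M.
  rewrite mulmx_block !(mul1mx, mul0mx, mulmx1, mulmx0, addr0, add0r).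
  by rewrite mulNmx addrK.
have := congr1 determinant E1; rewrite {1}E2 !det_mulmx !det_lblock !det_ublock.
by rewrite !det1 !mulr1 !mul1r.
Qed.

Variable n : nat.
Implicit Types (P M N : 'M[R]_n).

Definition orthogonal_projector P := P^T = P /\ P *m P = P.

(** For the projector [P] onto [F] and the restriction [M|F] of [M] to [F], this is
the Gram operator [(M|F)^T (M|F)] of [F], extended by the identity on the
orthogonal complement of [F] to a square matrix of fixed size.  Thus
[gram_vol P M] is the factor by which [M] scales volume on [F], without a choice
of basis. *)
Definition gram P M := P *m M^T *m M *m P + (1%:M - P).

Definition gram_vol P M := Num.sqrt `|\det (gram P M)|.

(** The orthogonal projector onto the image under [M] of the range of [P], by the
least squares formula [A (A^T A)^-1 A^T] with [A] the restriction of [M]. *)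
Definition image_projector P M := M *m P *m invmx (gram P M) *m P *m M^T.

Lemma gram_tr P M : orthogonal_projector P -> (gram P M)^T = gram P M.
Proof.
move=> [PT PP]; rewrite /gram raddfD /= raddfB /= trmx1 PT !trmx_mul trmxK PT.
by rewrite !mulmxA.
Qed.

Lemma gram_unit P M : orthogonal_projector P -> M \in unitmx ->
  gram P M \in unitmx.
Proof.
move=> [PT PP] uM; apply: unitmx_inj => x gx.
have Qx : (1%:M - P) *m x = 0.
  have QP : (1%:M - P) *m P = 0 by rewrite mulmxBl mul1mx PP subrr.
  have QQ : (1%:M - P) *m (1%:M - P) = 1%:M - P.
    by rewrite mulmxBr mulmx1 QP subr0.
  have : (1%:M - P) *m (gram P M *m x) = (1%:M - P) *m x.
    by rewrite mulmxA /gram mulmxDr !mulmxA QP !mul0mx add0r QQ.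
  by rewrite gx mulmx0.
have MPx : M *m P *m x = 0.
  apply: cV_dot_eq0; have := congr1 (mulmx x^T) gx.
  rewrite /gram mulmxDl Qx addr0 mulmx0 !trmx_mul PT !mulmxA => ->//.
have Px : P *m x = 0 by rewrite -[LHS](mulKmx uM) (mulmxA M) MPx mulmx0.
by move: Qx; rewrite mulmxBl mul1mx Px subr0.
Qed.

Lemma gram_vol_gt0 P M : orthogonal_projector P -> M \in unitmx ->
  0 < gram_vol P M.
Proof.
move=> oP uM; rewrite sqrtr_gt0 normr_gt0 -unitfE -unitmxE.
exact: gram_unit.
Qed.

(** Proof of the cocycle identity.  The matrix [H] below maps [F] to [M F] as [M]
does and the complement of [F] to the complement of [M F] through the component of
[M] there.  Congruence by [H] turns the Gram operator of [N] on [M F] into that of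
[N M] on [F], up to a factor on the complement of [F] that does not depend
on [N]; comparing with [N = 1] eliminates this factor and [det H]. *)
Section one_projector.
Variables (P M : 'M[R]_n).
Hypotheses (oP : orthogonal_projector P) (uM : M \in unitmx).
Let PT : P^T = P := oP.1.
Let PP : P *m P = P := oP.2.
Let g := gram P M.
Let ug : g \in unitmx := gram_unit oP uM.

Let gP : g *m P = P *m M^T *m M *m P.
Proof. by rewrite /g /gram mulmxDl -mulmxA PP mulmxBl mul1mx PP subrr addr0. Qed.

Let Pg : P *m g = P *m M^T *m M *m P.
Proof.
by rewrite /g /gram mulmxDr !mulmxA PP mulmxBr mulmx1 PP subrr addr0.
Qed.

Let PgV : P *m invmx g = invmx g *m P.
Proof.
apply: (can_inj (mulmxK ug)); rewrite (mulmxKV ug).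
by apply: (can_inj (mulKmx ug)); rewrite !mulmxA mulmxV// mul1mx gP Pg.
Qed.

Lemma image_projector_fix : image_projector P M *m (M *m P) = M *m P.
Proof.
rewrite /image_projector -/g -[M *m P *m _]mulmxA PgV !mulmxA.
rewrite -[_ *m P *m P]mulmxA PP -!mulmxA [P *m _](_ : _ = g *m P); last first.
  by rewrite gP !mulmxA.
by rewrite mulKmx.
Qed.

Lemma image_projectorP : orthogonal_projector (image_projector P M).
Proof.
split.
  rewrite /image_projector -/g !trmx_mul trmxK PT trmx_inv gram_tr//.
  by rewrite !mulmxA.
rewrite {2}/image_projector !mulmxA -[_ *m M *m P]mulmxA image_projector_fix.
by [].
Qed.

Let P' := image_projector P M.
Let H := M *m P + (1%:M - P') *m M *m (1%:M - P).

Let P'P' : P' *m P' = P' := image_projectorP.2.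
Let P'T : P'^T = P' := image_projectorP.1.

Let PQ : P *m (1%:M - P) = 0.
Proof. by rewrite mulmxBr mulmx1 PP subrr. Qed.

Let QP : (1%:M - P) *m P = 0.
Proof. by rewrite mulmxBl mul1mx PP subrr. Qed.

Let P'H : P' *m H = M *m P.
Proof.
have P'Q' : P' *m (1%:M - P') = 0 by rewrite mulmxBr mulmx1 P'P' subrr.
by rewrite /H mulmxDr image_projector_fix !mulmxA P'Q' !mul0mx addr0.
Qed.

Let Q'H : (1%:M - P') *m H = (1%:M - P') *m M *m (1%:M - P).
Proof. by rewrite mulmxBl mul1mx P'H /H addrAC subrr add0r. Qed.

Let uH : H \in unitmx.
Proof.
apply: unitmx_inj => x Hx.
have MPx : M *m P *m x = 0 by rewrite -P'H -mulmxA Hx mulmx0.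
have Px : P *m x = 0 by rewrite -[LHS](mulKmx uM) (mulmxA M) MPx mulmx0.
have : (1%:M - P') *m H *m x = 0 by rewrite -mulmxA Hx mulmx0.
rewrite Q'H -!mulmxA [(1%:M - P) *m x]mulmxBl mul1mx Px subr0 mulmxBl mul1mx.
move=> /subr0_eq; rewrite {1}/P' /image_projector -!mulmxA => /(can_inj (mulKmx uM)) xE.
have : P *m x = x by rewrite xE (mulmxA P) PP.
by rewrite Px.
Qed.

Let block (A B : 'M[R]_n) : P *m A *m P + (1%:M - P) *m B *m (1%:M - P) =
  (P *m A *m P + (1%:M - P)) *m (P + (1%:M - P) *m B *m (1%:M - P)).
Proof.
have QQ : (1%:M - P) *m (1%:M - P) = 1%:M - P by rewrite mulmxBr mulmx1 QP subr0.
move: (1%:M - P) PQ QP QQ => Q PQ0 QP0 QQ.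
rewrite mulmxDl !mulmxDr !mulmxA -[P *m A *m P *m P]mulmxA PP.
by rewrite -[P *m A *m P *m Q]mulmxA PQ0 mulmx0 !mul0mx addr0 QP0 add0r QQ.
Qed.

Let congrS (S : 'M[R]_n) :
  H^T *m (P' *m S *m P' + (1%:M - P')) *m H =
  P *m (M^T *m S *m M) *m P + (1%:M - P) *m (M^T *m (1%:M - P') *m M) *m (1%:M - P).
Proof.
move: (H) P'H Q'H => K; move: (P') P'P' P'T => E EE ET EK FK.
have FT : (1%:M - E)^T = 1%:M - E by rewrite raddfB /= trmx1 ET.
have QT : (1%:M - P)^T = 1%:M - P by rewrite raddfB /= trmx1 PT.
have FF : (1%:M - E) *m (1%:M - E) = 1%:M - E.
  by rewrite mulmxBl mul1mx mulmxBr mulmx1 EE subrr subr0.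
have KE : K^T *m E = P *m M^T by rewrite -{1}ET -trmx_mul EK trmx_mul PT.
move: (1%:M - E) (1%:M - P) FT QT FF FK => F Q FT QT FF FK.
rewrite mulmxDr mulmxDl; congr (_ + _).
  by rewrite !mulmxA KE -!mulmxA EK !mulmxA.
have KF : K^T *m F = Q *m M^T *m F by rewrite -{1}FT -trmx_mul FK !trmx_mul QT FT mulmxA.
rewrite -[in LHS]FF !mulmxA -[_ *m F *m K]mulmxA FK KF.
by rewrite !mulmxA -[Q *m M^T *m F *m F]mulmxA FF.
Qed.

Lemma gram_vol_cocycle N :
  gram_vol P (N *m M) = gram_vol P' N * gram_vol P M.
Proof.
have GE S N1 : N1^T *m N1 = M^T *m S *m M ->
    P *m (M^T *m S *m M) *m P + (1%:M - P) = gram P N1.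
  by move=> <-; rewrite /gram !mulmxA.
set c := \det (P + (1%:M - P) *m (M^T *m (1%:M - P') *m M) *m (1%:M - P)).
have E1 : \det H * \det H = \det (gram P M) * c.
  have := congr1 determinant (congrS 1%:M).
  rewrite block (GE 1%:M M) ?mulmx1// P'P' [P' + _]addrC subrK mulmx1.
  by rewrite !det_mulmx det_tr.
have EN : \det H * \det (gram P' N) * \det H = \det (gram P (N *m M)) * c.
  have := congr1 determinant (congrS (N^T *m N)).
  rewrite block (GE _ (N *m M)); last by rewrite trmx_mul !mulmxA.
  rewrite (_ : P' *m (N^T *m N) *m P' + _ = gram P' N); last first.
    by rewrite /gram -/P' !mulmxA.
  by rewrite !det_mulmx det_tr.
have dH : \det H != 0 by rewrite -unitfE -unitmxE.
have c0 : c != 0.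
  by apply: contra_neq dH => c0; apply/eqP; rewrite -(sqrf_eq0 (\det H)) expr2 E1 c0 mulr0.
rewrite /gram_vol -sqrtrM// -normrM; congr (Num.sqrt `| _ |).
by apply: (mulIf c0); rewrite -EN mulrAC E1; ring.
Qed.

End one_projector.

Lemma gram_vol_orthogonal P M Q : Q^T *m Q = 1%:M ->
  gram_vol P (Q *m M) = gram_vol P M.
Proof.
by move=> QQ; rewrite /gram_vol /gram trmx_mul !mulmxA -[_ *m Q^T *m Q]mulmxA QQ mulmx1.
Qed.

Lemma gram_vol_full M : gram_vol 1%:M M = `|\det M|.
Proof.
rewrite /gram_vol /gram mul1mx mulmx1 subrr addr0 det_mulmx det_tr.
by rewrite normrM -expr2 sqrtr_sqr normr_id.
Qed.

Lemma gram_vol0 M : gram_vol 0 M = 1.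
Proof. by rewrite /gram_vol /gram mulmx0 subr0 add0r det1 normr1 sqrtr1. Qed.

(** [C] maps the range of [P] to itself, so [M C] first scales volume there by the
determinant of the restriction of [C]. *)
Lemma gram_vol_mulr P M C : orthogonal_projector P -> C *m P = P *m C *m P ->
  gram_vol P (M *m C) = gram_vol P M * `|\det (P *m C *m P + (1%:M - P))|.
Proof.
move=> [PT PP] CP; set D := P *m C *m P + _.
have QP : (1%:M - P) *m P = 0 by rewrite mulmxBl mul1mx PP subrr.
have PQ : P *m (1%:M - P) = 0 by rewrite mulmxBr mulmx1 PP subrr.
have PD : P *m D = C *m P.
  by rewrite /D mulmxDr PQ addr0 !mulmxA PP CP.
have QD : (1%:M - P) *m D = 1%:M - P.
  by rewrite /D mulmxDr !mulmxA QP !mul0mx add0r mulmxBr mulmx1 QP subr0.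
have DT : D^T *m P = P *m C^T by rewrite -{1}PT -trmx_mul PD trmx_mul PT.
have -> : gram_vol P (M *m C) = Num.sqrt `|\det (D^T *m gram P M *m D)|.
  congr (Num.sqrt `|\det _|); rewrite /gram trmx_mul mulmxDr mulmxDl !mulmxA DT.
  rewrite -[_ *m P *m D]mulmxA PD -[_ *m (1%:M - P) *m D]mulmxA QD.
  congr (_ + _); first by rewrite !mulmxA.
  have QT : (1%:M - P)^T = 1%:M - P by rewrite raddfB /= trmx1 PT.
  by rewrite -{2}QT -trmx_mul QD QT.
rewrite !det_mulmx det_tr mulrAC -expr2 normrM sqrtrM// [_ * Num.sqrt _]mulrC.
by congr (_ * _); rewrite normrX real_normK ?num_real// sqrtr_sqr.
Qed.

End gram_volume.

Section measurable_gram_volume.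
Variables (R : realType) (n : nat) (d : measure_display) (T : measurableType d).
Variables (P M : T -> 'M[R]_n).
Hypotheses (mP : measurable_fun setT P) (mM : measurable_fun setT M).

Lemma measurable_gram : measurable_fun setT (fun x => gram (P x) (M x)).
Proof.
have mMT : measurable_fun setT (fun x => (M x)^T) by exact: measurable_trmx.
rewrite /gram; apply: measurable_addmx; last first.
  by apply: measurable_addmx => //; exact: measurable_oppmx.
apply: measurable_mulmx => //; apply: measurable_mulmx => //.
exact: measurable_mulmx.
Qed.

Lemma measurable_gram_vol : measurable_fun setT (fun x => gram_vol (P x) (M x)).
Proof.
apply: measurable_sqrt; apply: measurableT_comp => //.
by apply: measurable_det; exact: measurable_gram.
Qed.

Lemma measurable_image_projector :
  measurable_fun setT (fun x => image_projector (P x) (M x)).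
Proof.
apply: measurable_mulmx; last exact: measurable_trmx.
apply: measurable_mulmx => //; apply: measurable_mulmx; first exact: measurable_mulmx.
by apply: measurable_invmx; exact: measurable_gram.
Qed.

End measurable_gram_volume.

(** * A measurable Gram-Schmidt process *)

Section step_projector.
Variables (R : realType) (n : nat) (b : 'I_n -> nat).

(** With [b] the block index of a coordinate, these are the projectors onto the
components of the standard flag; with [b] the identity they are those of the
complete flag, which drives the Gram-Schmidt process. *)
Definition step_projector (j : nat) : 'M[R]_n :=
  diag_mx (\row_k (b k < j)%:R).

Lemma step_projectorP j : orthogonal_projector (step_projector j).
Proof.
split; first exact: tr_diag_mx.
rewrite mulmx_diag; congr diag_mx; apply/rowP => k; rewrite !mxE.
by case: (_ < _)%N; rewrite ?mulr1 ?mulr0.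
Qed.

Lemma step_projector_mull j (A : 'M[R]_n) k l :
  (step_projector j *m A) k l = A k l *+ (b k < j)%N.
Proof. by rewrite mul_diag_mx !mxE mulr_natl. Qed.

Lemma step_projector_mulr j (A : 'M[R]_n) k l :
  (A *m step_projector j) k l = A k l *+ (b l < j)%N.
Proof. by rewrite mul_mx_diag !mxE mulr_natr. Qed.

End step_projector.

Section Gram_Schmidt.
Variables (R : realType) (n : nat).
Implicit Types (G U : 'M[R]_n).

Let E (k : nat) := step_projector R (fun i : 'I_n => i : nat) k.

Let Pi G (k : nat) := image_projector (E k) G.

(** Column [k] is the component of column [k] of [G] orthogonal to the columns
before it. *)
Definition gs_residual G : 'M[R]_n := \matrix_(i, k) ((1%:M - Pi G k) *m G) i k.

Definition gs_scale G : 'M[R]_n :=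
  diag_mx (\row_k (Num.sqrt (((gs_residual G)^T *m gs_residual G) k k))^-1).

Definition gs_frame G : 'M[R]_n := gs_residual G *m gs_scale G.

(** The change of sign of the first column that gives the frame determinant [1]. *)
Definition gs_sign G : 'M[R]_n :=
  diag_mx (\row_k (if k == 0%N :> nat then \det (gs_frame G) else 1)).

(** The rotation part of [G].  The value at singular matrices is a rotation as
well, so that [so_factor] takes its values in SO_n everywhere. *)
Definition so_factor G : 'M[R]_n :=
  if G \in unitmx then gs_frame G *m gs_sign G else 1%:M.

Lemma measurable_diag_mx d (T : measurableType d) (f : T -> 'rV[R]_n) :
  measurable_fun setT f -> measurable_fun setT (fun x => diag_mx (f x)).
Proof.
move=> mf; apply: measurable_fun_mx => i j.
under [X in measurable_fun _ X]eq_fun do rewrite mxE -mulr_natr.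
by apply: measurable_funM => //; exact: measurable_mx_coord.
Qed.

Lemma measurable_gs_residual : measurable_fun setT gs_residual.
Proof.
apply: measurable_fun_mx => i k; under [X in measurable_fun _ X]eq_fun do rewrite mxE.
apply: measurable_mx_coord; apply: measurable_mulmx => //.
apply: measurable_addmx => //; apply: measurable_oppmx.
by apply: (@measurable_image_projector R n _ _ (fun=> E k) id).
Qed.

Lemma measurable_gs_frame : measurable_fun setT gs_frame.
Proof.
apply: measurable_mulmx; first exact: measurable_gs_residual.
apply: measurable_diag_mx; apply: measurable_fun_mx => i j.
under [X in measurable_fun _ X]eq_fun do rewrite mxE.
apply: measurable_invr; apply: measurable_sqrt; apply: measurable_mx_coord.
apply: measurable_mulmx; last exact: measurable_gs_residual.
by apply: measurable_trmx; exact: measurable_gs_residual.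
Qed.

Lemma measurable_so_factor : measurable_fun setT so_factor.
Proof.
apply: measurable_fun_ifT => //; first exact: measurable_unitmx.
apply: measurable_mulmx; first exact: measurable_gs_frame.
apply: measurable_diag_mx; apply: measurable_fun_mx => i j.
under [X in measurable_fun _ X]eq_fun do rewrite mxE.
case: (j == 0%N :> nat); last exact: measurable_cst.
by apply: measurable_det; exact: measurable_gs_frame.
Qed.

Lemma gs_residual_mull U G : U^T *m U = 1%:M ->
  gs_residual (U *m G) = U *m gs_residual G.
Proof.
move=> UU; have UUT : U *m U^T = 1%:M by exact: mulmx1C.
have PiU k : (1%:M - Pi (U *m G) k) *m (U *m G) = U *m ((1%:M - Pi G k) *m G).
  rewrite !mulmxBl !mul1mx mulmxBr; congr (_ - _).
  rewrite /Pi /image_projector.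
  have -> : gram (E k) (U *m G) = gram (E k) G.
    by rewrite /gram trmx_mul !mulmxA -[_ *m U^T *m U]mulmxA UU mulmx1.
  by rewrite trmx_mul !mulmxA -[_ *m U^T *m U]mulmxA UU mulmx1.
apply/matrixP => i k; rewrite mxE PiU !mxE; apply: eq_bigr => j _.
by rewrite [in RHS]mxE.
Qed.

Lemma gs_frame_mull U G : U^T *m U = 1%:M -> gs_frame (U *m G) = U *m gs_frame G.
Proof.
move=> UU; have scaleE : gs_scale (U *m G) = gs_scale G.
  rewrite /gs_scale gs_residual_mull//; congr diag_mx; apply/rowP => k.
  rewrite [LHS]mxE [RHS]mxE trmx_mul mulmxA -[_ *m U^T *m U]mulmxA.
  by rewrite UU mulmx1.
by rewrite /gs_frame scaleE gs_residual_mull// mulmxA.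
Qed.

(** The Gram-Schmidt process only uses scalar products of columns, so it commutes
with isometries. *)
Lemma so_factor_mull U G : special_orthogonal U -> G \in unitmx ->
  so_factor (U *m G) = U *m so_factor G.
Proof.
move=> [UU dU] uG; have uU : U \in unitmx by rewrite unitmxE dU unitr1.
rewrite /so_factor unitmx_mul uU uG /= /gs_sign gs_frame_mull// det_mulmx dU mul1r.
by rewrite mulmxA.
Qed.

(** For [m = 0] there is no first entry to carry [d], whence the hypothesis. *)
Lemma det_first_diag m (d : R) : (m = 0%N -> d = 1) ->
  \det (diag_mx (\row_(k < m) if k == 0%N :> nat then d else 1)) = d.
Proof.
rewrite det_diag; case: m => [d1|m _]; first by rewrite big_ord0 d1.
rewrite (bigD1 ord0)//= mxE eqxx big1 ?mulr1// => i i0.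
by rewrite mxE; have /negbTE -> : (i : nat) != 0%N by [].
Qed.

Section invertible.
Variable G : 'M[R]_n.
Hypothesis uG : G \in unitmx.

Let T1 : 'M[R]_n := \matrix_(m, k)
  (1%:M - E k *m (invmx (gram (E k) G) *m E k *m G^T *m G)) m k.

Let residualE : gs_residual G = G *m T1.
Proof.
apply/matrixP => i k.
rewrite mxE; transitivity ((G *m
    (1%:M - E k *m (invmx (gram (E k) G) *m E k *m G^T *m G))) i k).
  by congr fun_of_matrix; rewrite mulmxBl mulmxBr mul1mx mulmx1 /Pi
    /image_projector !mulmxA.
by rewrite !mxE; apply: eq_bigr => j _; rewrite [in RHS]mxE.
Qed.

Let T1_lower (m k : 'I_n) : (k <= m)%N -> T1 m k = (m == k)%:R.
Proof.
move=> km; rewrite mxE [LHS]mxE [X in _ + X]mxE step_projector_mull ltnNge km.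
by rewrite mulr0n subr0 mxE.
Qed.

Let T1_trig : is_trig_mx T1^T.
Proof. by apply/is_trig_mxP => i j ij; rewrite mxE T1_lower 1?ltnW// -val_eqE /= gtn_eqF. Qed.

Let residual_unit : gs_residual G \in unitmx.
Proof.
rewrite residualE unitmx_mul uG unitmxE det_trig_tr// big1 ?unitr1// => i _.
by rewrite T1_lower ?eqxx.
Qed.

Let W := gs_residual G.

Let W_orth (k l : 'I_n) (A : 'M[R]_n) :
  (forall m : 'I_n, (k <= m)%N -> A m l = 0) -> (W^T *m (G *m A)) k l = 0.
Proof.
move=> A0; have [PiT _] := image_projectorP (step_projectorP R (fun i : 'I_n => i : nat) k) uG.
have PiG := image_projector_fix (step_projectorP R (fun i : 'I_n => i : nat) k) uG.
have FT : (1%:M - Pi G k)^T = 1%:M - Pi G k by rewrite raddfB /= trmx1 PiT.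
transitivity ((G^T *m (1%:M - Pi G k) *m G *m A) k l).
  have -> : G^T *m (1%:M - Pi G k) *m G *m A =
      ((1%:M - Pi G k) *m G)^T *m (G *m A).
    by rewrite trmx_mul FT !mulmxA.
  rewrite [LHS]mxE [RHS]mxE; apply: eq_bigr => m _.
  by rewrite [in LHS]mxE [in RHS]mxE /W mxE.
transitivity ((G^T *m (1%:M - Pi G k) *m G *m (E k *m A)) k l).
  rewrite [LHS]mxE [RHS]mxE; apply: eq_bigr => m _; congr (_ * _).
  by rewrite step_projector_mull; case: ltnP => // km; rewrite A0.
have -> : G^T *m (1%:M - Pi G k) *m G *m (E k *m A) = 0.
  rewrite -!mulmxA (mulmxA G (E k)) mulmxBl mul1mx /Pi mulmxA PiG.
  by rewrite subrr mulmx0.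
by rewrite mxE.
Qed.

Let W_diag (k l : 'I_n) : k != l -> (W^T *m W) k l = 0.
Proof.
have lt (i j : 'I_n) : (j < i)%N -> (W^T *m W) i j = 0.
  move=> ji; rewrite {2}/W residualE; apply: W_orth => m im.
  by rewrite T1_lower ?(ltnW (leq_trans ji im))// -val_eqE /= gtn_eqF// (leq_trans ji im).
move=> kl; case: (ltngtP k l) kl => [kl _|lk _|/val_inj ->]; last by rewrite eqxx.
  by rewrite -[W^T *m W]trmxK mxE trmx_mul trmxK lt.
exact: lt.
Qed.

Let W_norm_gt0 (k : 'I_n) : 0 < (W^T *m W) k k.
Proof.
rewrite lt_def mxE sumr_ge0 ?andbT => [|i _]; last by rewrite mxE -expr2 sqr_ge0.
apply/eqP => W0.
have : W *m delta_mx k 0 = 0 :> 'cV_n.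
  apply: cV_dot_eq0; rewrite trmx_mul mulmxA -[_ *m W^T *m W]mulmxA trmx_delta.
  apply/matrixP => i j; rewrite !ord1 -rowE -colE !mxE.
  by rewrite -[RHS]W0.
rewrite -[X in _ = X](mulmx0 _ W) => /(can_inj (mulKmx residual_unit))/matrixP/(_ k 0).
by rewrite !mxE !eqxx => /eqP; rewrite oner_eq0.
Qed.

Let frame_orth : (gs_frame G)^T *m gs_frame G = 1%:M.
Proof.
rewrite /gs_frame trmx_mul tr_diag_mx mulmxA -[_ *m W^T *m W]mulmxA /gs_scale -/W.
move: (W^T *m W) W_diag W_norm_gt0 => S S_diag S_gt0.
apply/matrixP => k l; rewrite mul_mx_diag mxE mul_diag_mx !mxE.
have [<-|kl] := eqVneq k l; last by rewrite (S_diag k l kl) mulr0 mul0r.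
rewrite mulrAC -expr2 exprVn sqr_sqrtr ?mulVf// ?ltW ?S_gt0//.
by rewrite gt_eqF ?S_gt0.
Qed.

Let det_frame2 : \det (gs_frame G) * \det (gs_frame G) = 1.
Proof. by have := congr1 determinant frame_orth; rewrite det_mulmx det_tr det1. Qed.

Let det_sign : \det (gs_sign G) = \det (gs_frame G).
Proof.
apply: det_first_diag => n0.
by move: (gs_frame G); rewrite n0 => F; exact: det_mx00.
Qed.

Let sign2 : gs_sign G *m gs_sign G = 1%:M.
Proof.
rewrite /gs_sign mulmx_diag -diag_const_mx; congr diag_mx; apply/rowP => k; rewrite !mxE.
by case: ifP; rewrite ?mulr1.
Qed.

Lemma so_factor_special : special_orthogonal (so_factor G).
Proof.
rewrite /so_factor uG; split.
  rewrite trmx_mul mulmxA -[_ *m _ *m gs_frame G]mulmxA frame_orth mulmx1.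
  by rewrite /gs_sign tr_diag_mx -/(gs_sign G) sign2.
by rewrite det_mulmx det_sign det_frame2.
Qed.

Lemma so_factor_triangular : exists T : 'M[R]_n,
  [/\ is_trig_mx T^T, T \in unitmx & G = so_factor G *m T].
Proof.
have [QQ dQ] := so_factor_special.
exists ((so_factor G)^T *m G); split.
- apply/is_trig_mxP => k m km.
  rewrite mxE /so_factor uG /gs_frame !trmx_mul /gs_sign !tr_diag_mx -!mulmxA.
  rewrite mul_diag_mx mxE mul_diag_mx mxE.
  suff -> : ((gs_residual G)^T *m G) m k = 0 by rewrite !mulr0.
  have := @W_orth m k 1%:M; rewrite mulmx1; apply.
  by move=> i ki; rewrite mxE -val_eqE /= gtn_eqF// (leq_trans km).
- by rewrite unitmx_mul uG unitmx_tr unitmxE dQ unitr1.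
- by rewrite mulmxA (mulmx1C QQ) mul1mx.
Qed.

End invertible.
End Gram_Schmidt.

(** * Block upper triangular matrices *)

Section block_triangular.
Variables (R : realType) (n : nat) (b : 'I_n -> nat).
Hypothesis b_mono : forall k l : 'I_n, (k <= l)%N -> (b k <= b l)%N.
Notation e := (step_projector R b).
Implicit Types (X C G T : 'M[R]_n).

Definition block_part X : 'M[R]_n :=
  \matrix_(k, l) if (b k <= b l)%N then X k l else 0.

Lemma block_part_is_linear : linear block_part.
Proof.
move=> c X Y; apply/matrixP => k l; rewrite !mxE.
by case: ifP => // _; rewrite mulr0 addr0.
Qed.

HB.instance Definition _ := GRing.isLinear.Build R 'M[R]_n 'M[R]_n _ block_part
  block_part_is_linear.

Definition block_upper C := block_part C = C.

Lemma block_upperP C : (forall k l, ~~ (b k <= b l)%N -> C k l = 0) -> block_upper C.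
Proof.
by move=> C0; apply/matrixP => k l; rewrite mxE; case: ifPn => // /C0.
Qed.

Lemma block_upper0 C k l : block_upper C -> ~~ (b k <= b l)%N -> C k l = 0.
Proof. by move=> <- /negbTE kl; rewrite mxE kl. Qed.

Lemma block_part_upper X : block_upper (block_part X).
Proof. by apply: block_upperP => k l /negbTE kl; rewrite mxE kl. Qed.

Lemma triangular_block_upper T : is_trig_mx T^T -> block_upper T.
Proof.
move=> tT; apply: block_upperP => k l; rewrite -ltnNge => lk.
have := is_trig_mxP tT l k; rewrite mxE; apply.
by rewrite ltnNge; apply: contraL lk => /b_mono; rewrite -leqNgt.
Qed.

Lemma block_upper_mulmx A C : block_upper A -> block_upper C -> block_upper (A *m C).
Proof.
move=> bA bC; apply: block_upperP => k l kl; rewrite mxE big1// => m _.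
have [km|/(block_upper0 bA) ->] := boolP (b k <= b m)%N; last by rewrite mul0r.
rewrite (@block_upper0 C m l)// ?mulr0//; apply: contra kl; exact: leq_trans.
Qed.

Definition block_minor j C := \det (e j *m C *m e j + (1%:M - e j)).

Lemma block_upper_step j C : block_upper C -> C *m e j = e j *m C *m e j.
Proof.
move=> bC; apply/matrixP => k l; rewrite !step_projector_mulr step_projector_mull.
have [lj|//] := ltnP (b l) j; rewrite !mulr1n.
have [//|jk] := ltnP (b k) j; apply: block_upper0 => //.
by rewrite -ltnNge (leq_trans lj).
Qed.

Lemma block_minorM j A C : block_upper C ->
  block_minor j (A *m C) = block_minor j A * block_minor j C.
Proof.
move=> bC; have [eT ee] := step_projectorP R b j; rewrite /block_minor -det_mulmx.
have eC := block_upper_step j bC.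
move: (e j) eT ee eC => E ET EE EC; congr determinant.
have QE : (1%:M - E) *m E = 0 by rewrite mulmxBl mul1mx EE subrr.
have EQ : E *m (1%:M - E) = 0 by rewrite mulmxBr mulmx1 EE subrr.
have QQ : (1%:M - E) *m (1%:M - E) = 1%:M - E by rewrite mulmxBr mulmx1 QE subr0.
move: (1%:M - E) QE EQ QQ => Q QE EQ QQ.
rewrite mulmxDl !mulmxDr QQ !mulmxA QE !mul0mx add0r -[E *m A *m E *m Q]mulmxA EQ.
rewrite mulmx0 addr0 -[E *m A *m E *m E]mulmxA EE; congr (_ + _).
by rewrite -!mulmxA [in LHS]EC !mulmxA.
Qed.

Lemma block_minor_triangular j T : is_trig_mx T^T ->
  block_minor j T = \prod_k (if (b k < j)%N then T k k else 1).
Proof.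
move=> tT; rewrite /block_minor det_trig_tr.
  apply: eq_bigr => k _; rewrite mxE step_projector_mulr step_projector_mull !mxE eqxx.
  by case: ltnP => _; rewrite ?mulr1n ?mulr0n ?subrr ?subr0 ?addr0 ?add0r.
apply/is_trig_mxP => k l kl; rewrite mxE mxE step_projector_mulr step_projector_mull.
have := is_trig_mxP tT k l kl; rewrite mxE => ->; rewrite !mul0rn add0r !mxE.
by rewrite -val_eqE /= gtn_eqF// !mulr0n subrr.
Qed.

Lemma gram_vol1 P : orthogonal_projector P -> gram_vol P (1%:M : 'M[R]_n) = 1.
Proof.
move=> [PT PP]; rewrite /gram_vol /gram trmx1 !mulmx1 PP addrC subrK.
by rewrite det1 normr1 sqrtr1.
Qed.

Lemma gram_vol_block j G C : block_upper C ->
  gram_vol (e j) (G *m C) = gram_vol (e j) G * `|block_minor j C|.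
Proof.
by move=> bC; apply: gram_vol_mulr; [exact: step_projectorP|exact: block_upper_step].
Qed.

Lemma gram_vol_minor j C : block_upper C -> gram_vol (e j) C = `|block_minor j C|.
Proof.
move=> bC; rewrite -[in LHS](mul1mx C) gram_vol_block// gram_vol1 ?mul1r//.
exact: step_projectorP.
Qed.

Lemma block_minor_neq0 j C : block_upper C -> C \in unitmx -> block_minor j C != 0.
Proof.
move=> bC uC; rewrite -normr_gt0 -gram_vol_minor//.
exact/gram_vol_gt0/uC/step_projectorP.
Qed.

(** Multiplication by [T] on the block upper part of [X], the entries below the
blocks being left alone.  The group of block upper triangular matrices is thus
handled inside the space of all matrices, whose Lebesgue measure is at hand. *)
Definition block_mull T X := block_part (T *m block_part X) + (X - block_part X).

Definition block_mulr T X := block_part (block_part X *m T) + (X - block_part X).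

Lemma block_mull_is_linear T : linear (block_mull T).
Proof.
move=> c X Y; rewrite /block_mull !linearP /=.
by rewrite !scalerDr [RHS]addrACA [X in _ = _ + X]addrACA.
Qed.

HB.instance Definition _ T := GRing.isLinear.Build R 'M[R]_n 'M[R]_n _
  (block_mull T) (block_mull_is_linear T).

Lemma block_mulr_is_linear T : linear (block_mulr T).
Proof.
move=> c X Y; rewrite /block_mulr !linearP /= mulmxDl -scalemxAl !linearP /=.
by rewrite !scalerDr [RHS]addrACA [X in _ = _ + X]addrACA.
Qed.

HB.instance Definition _ T := GRing.isLinear.Build R 'M[R]_n 'M[R]_n _
  (block_mulr T) (block_mulr_is_linear T).

Lemma block_part_delta i j : block_part (delta_mx i j : 'M[R]_n) =
  delta_mx i j *+ (b i <= b j)%N.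
Proof.
apply/matrixP => k l; rewrite mxE mulmxnE !mxE.
case: (k =P i) => [->|_]; last by rewrite mul0rn if_same.
case: (l =P j) => [->|_]; last by rewrite mul0rn if_same.
by case: (_ <= _)%N.
Qed.

Lemma block_mull_delta T i j k l : block_mull T (delta_mx i j) k l =
  if (b i <= b j)%N then (if (b k <= b l)%N then T k i *+ (j == l) else 0)
  else (delta_mx i j : 'M[R]_n) k l.
Proof.
rewrite /block_mull block_part_delta; case: ifP => _.
  by rewrite !mulr1n subrr addr0 mxE mulmx_deltaE.
by rewrite !mulr0n mulmx0 linear0 subr0 add0r.
Qed.

Lemma block_mulr_delta T i j k l : block_mulr T (delta_mx i j) k l =
  if (b i <= b j)%N then (if (b k <= b l)%N then T j l *+ (i == k) else 0)
  else (delta_mx i j : 'M[R]_n) k l.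
Proof.
rewrite /block_mulr block_part_delta; case: ifP => _.
  by rewrite !mulr1n subrr addr0 mxE delta_mulmxE.
by rewrite !mulr0n mul0mx linear0 subr0 add0r.
Qed.

Lemma det_block_mull T : is_trig_mx T^T ->
  \det (lin_mx (block_mull T)) = \prod_l block_minor (b l).+1 T.
Proof.
move=> tT; rewrite (@det_lin_mx_triangular _ _ _ (fun i _ => n - i)%N).
  rewrite exchange_big /=; apply: eq_bigr => l _; rewrite block_minor_triangular//.
  apply: eq_bigr => k _; rewrite block_mull_delta ltnS.
  by case: leqP => _; rewrite ?mxE ?eqxx ?mulr1n.
move=> i j k l; rewrite block_mull_delta; case: ifP => _.
  case: ifP => _; last by rewrite eqxx.
  case: (j =P l) => [->|_]; last by rewrite eqxx.
  rewrite mulr1n; case: (ltngtP k i) => [ki|ik|/val_inj ->];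
    [by right; exact: ltn_sub2l| |by left].
  by have := is_trig_mxP tT i k ik; rewrite mxE => ->; rewrite eqxx.
rewrite mxE; case: (k =P i) => [->|_]; last by rewrite eqxx.
by case: (l =P j) => [->|_]; [left|rewrite eqxx].
Qed.

Lemma det_block_mulr T : is_trig_mx T^T ->
  \det (lin_mx (block_mulr T)) * \prod_k block_minor (b k) T = \det T ^+ n.
Proof.
move=> tT; rewrite (@det_lin_mx_triangular _ _ _ (fun _ j => j)%N).
  rewrite -big_split /= -[X in _ ^+ X]card_ord -prodr_const.
  apply: eq_bigr => k _; rewrite block_minor_triangular// -big_split /= det_trig_tr//.
  apply: eq_bigr => l _; rewrite block_mulr_delta.
  by case: leqP => _; rewrite ?mxE ?eqxx ?mulr1n ?mulr1 ?mul1r.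
move=> i j k l; rewrite block_mulr_delta; case: ifP => _.
  case: ifP => _; last by rewrite eqxx.
  case: (i =P k) => [->|_]; last by rewrite eqxx.
  rewrite mulr1n; case: (ltngtP j l) => [jl|lj|/val_inj ->]; [by right| |by left].
  by have := is_trig_mxP tT l j lj; rewrite mxE => ->; rewrite eqxx.
rewrite mxE; case: (k =P i) => [->|_]; last by rewrite eqxx.
by case: (l =P j) => [->|_]; [left|rewrite eqxx].
Qed.

(** The density, with respect to Lebesgue measure on block upper triangular
matrices, of the left Haar measure of their invertible elements; it is the inverse
determinant of left multiplication, which acts on column [l] by the leading part of
the factor, up to and including the block of [l]. *)
Definition left_modulus C := if C \in unitmx then
  \prod_l `|block_minor (b l).+1 C|^-1 else 0.

(** The density of the right Haar measure.  Row [k] of a block upper triangular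
matrix is acted upon by the trailing part of the factor; its determinant is that
of the whole over that of the leading part before the block of [k]. *)
Definition right_modulus C := if C \in unitmx then
  (`|\det C| ^+ n)^-1 * \prod_l `|block_minor (b l) C| else 0.

Lemma left_modulusM A C : A \in unitmx -> block_upper C ->
  left_modulus (A *m C) = left_modulus A * left_modulus C.
Proof.
move=> uA bC; rewrite /left_modulus unitmx_mul uA /=.
case: ifP => _; last by rewrite mulr0.
rewrite -big_split /=; apply: eq_bigr => l _.
by rewrite block_minorM// normrM invfM.
Qed.

Lemma right_modulusM A C : C \in unitmx -> block_upper C ->
  right_modulus (A *m C) = right_modulus A * right_modulus C.
Proof.
move=> uC bC; rewrite /right_modulus unitmx_mul uC andbT.
case: ifP => _; last by rewrite mul0r.
rewrite det_mulmx normrM exprMn invfM mulrACA -big_split /=; congr (_ * _).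
by apply: eq_bigr => l _; rewrite block_minorM// normrM.
Qed.

Lemma left_modulus_gt0 C : block_upper C -> C \in unitmx -> 0 < left_modulus C.
Proof.
move=> bC uC; rewrite /left_modulus uC; apply: prodr_gt0 => l _.
by rewrite invr_gt0 normr_gt0 block_minor_neq0.
Qed.

Lemma right_modulus_gt0 C : block_upper C -> C \in unitmx -> 0 < right_modulus C.
Proof.
move=> bC uC; rewrite /right_modulus uC mulr_gt0//.
  by rewrite invr_gt0 exprn_gt0// normr_gt0 -unitfE -unitmxE.
by apply: prodr_gt0 => l _; rewrite normr_gt0 block_minor_neq0.
Qed.

Lemma left_modulus_ge0 C : 0 <= left_modulus C.
Proof.
by rewrite /left_modulus; case: ifP => // _; apply: prodr_ge0 => l _; rewrite invr_ge0.
Qed.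

Lemma right_modulus_ge0 C : 0 <= right_modulus C.
Proof.
rewrite /right_modulus; case: ifP => // _; apply: mulr_ge0; last exact: prodr_ge0.
by rewrite invr_ge0 exprn_ge0.
Qed.

Lemma det_block_mull_modulus T : is_trig_mx T^T -> T \in unitmx ->
  `|\det (lin_mx (block_mull T))|^-1 = left_modulus T.
Proof. by move=> tT uT; rewrite det_block_mull// normr_prod -prodfV /left_modulus uT. Qed.

Lemma det_block_mulr_modulus T : is_trig_mx T^T -> T \in unitmx ->
  `|\det (lin_mx (block_mulr T))|^-1 = right_modulus T.
Proof.
move=> tT uT; rewrite /right_modulus uT -normrX -det_block_mulr// normrM invfM.
rewrite normr_prod mulfVK//; apply/prodf_neq0 => l _.
by rewrite normr_eq0 block_minor_neq0//; exact: triangular_block_upper.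
Qed.

End block_triangular.

(** * Averaging over block upper triangular matrices *)

Section block_averaging.
Variables (R : realType) (n : nat) (b : 'I_n -> nat).
Hypothesis b_mono : forall k l : 'I_n, (k <= l)%N -> (b k <= b l)%N.
Notation leb := (lebesgue_mx R n).
Notation bpart := (@block_part R n b).
Implicit Types (X P C G T : 'M[R]_n).

Lemma measurable_block_part : measurable_fun setT bpart.
Proof.
apply: measurable_fun_mx => k l.
under [X in measurable_fun _ X]eq_fun do rewrite mxE.
by case: (b k <= b l)%N; [exact: measurable_mx_entry|exact: measurable_cst].
Qed.

Lemma measurable_block_mull T : measurable_fun setT (block_mull b T).
Proof.
apply: measurable_addmx; last first.
  apply: measurable_addmx; first exact: measurable_id.
  by apply: measurable_oppmx; exact: measurable_block_part.
apply: (measurableT_comp measurable_block_part).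
by apply: measurable_mulmx => //; exact: measurable_block_part.
Qed.

Lemma measurable_block_mulr T : measurable_fun setT (block_mulr b T).
Proof.
apply: measurable_addmx; last first.
  apply: measurable_addmx; first exact: measurable_id.
  by apply: measurable_oppmx; exact: measurable_block_part.
apply: (measurableT_comp measurable_block_part).
by apply: measurable_mulmx => //; exact: measurable_block_part.
Qed.

Lemma measurable_block_minor j : measurable_fun setT (@block_minor R n b j).
Proof.
apply: measurable_det; apply: measurable_addmx => //.
by apply: measurable_mulmx => //; exact: measurable_mulmx.
Qed.

Lemma measurable_left_modulus : measurable_fun setT (@left_modulus R n b).
Proof.
apply: measurable_fun_ifT => //; first exact: measurable_unitmx.
apply: measurable_prod => l _; apply: measurable_invr.
by apply: measurableT_comp => //; exact: measurable_block_minor.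
Qed.

Lemma measurable_right_modulus : measurable_fun setT (@right_modulus R n b).
Proof.
apply: measurable_fun_ifT => //; first exact: measurable_unitmx.
apply: measurable_funM.
  apply: measurable_invr; apply: measurable_funX; apply: measurableT_comp => //.
  exact: measurable_det.
apply: measurable_prod => l _.
by apply: measurableT_comp => //; exact: measurable_block_minor.
Qed.

(** The entries below the blocks are dummy variables, each integrated
over [0, 1]. *)
Definition off_block_box : set 'M[R]_n :=
  [set X | forall k l, ~~ (b k <= b l)%N -> 0 <= X k l <= 1].

Lemma measurable_off_block_box : measurable off_block_box.
Proof.
rewrite (_ : off_block_box = \bigcap_(ij in [set ij : 'I_n * 'I_n |
    ~~ (b ij.1 <= b ij.2)%N]) ((fun B : 'M[R]_n => B ij.1 ij.2) @^-1` `[0, 1]%classic)).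
  apply: fin_bigcap_measurable => [|[i j] _]; first exact: finite_finset.
  by rewrite -[X in measurable X]setTI; apply: measurable_mx_entry.
apply/seteqP; split => [B AB [i j] /= ij|B AB i j ij] /=.
  by rewrite in_itv/=; exact: AB.
by have := AB (i, j) ij; rewrite /= in_itv.
Qed.

(** Integration over the block upper triangular matrices: the mass of the dummy
entries is [1]. *)
Definition block_integral (f : 'M[R]_n -> R) : \bar R :=
  (\int[leb]_X (\1_off_block_box X * f (bpart X))%:E)%E.

Lemma measurable_block_integrand (f : 'M[R]_n -> R) : measurable_fun setT f ->
  measurable_fun setT (fun X => (\1_off_block_box X * f (bpart X))%:E).
Proof.
move=> mf; apply/measurable_EFinP; apply: measurable_funM.
  by apply: measurable_indic; exact: measurable_off_block_box.
by apply: (measurableT_comp mf); exact: measurable_block_part.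
Qed.

Lemma block_integralZ (c : R) (f : 'M[R]_n -> R) : 0 <= c ->
  measurable_fun setT f -> (forall X, 0 <= f X) ->
  block_integral (fun P => c * f P) = (c%:E * block_integral f)%E.
Proof.
move=> c0 mf f0; rewrite /block_integral -ge0_integralZl_EFin//.
- by apply: eq_integral => X _; rewrite -EFinM mulrCA.
- by move=> X _; rewrite lee_fin mulr_ge0.
- exact: measurable_block_integrand.
Qed.

Lemma eq_block_integral (f g : 'M[R]_n -> R) :
  (forall P, block_upper b P -> f P = g P) -> block_integral f = block_integral g.
Proof.
move=> fg; apply: eq_integral => X _; rewrite fg//; exact: block_part_upper.
Qed.

Lemma block_partB X : bpart (X - bpart X) = 0.
Proof. by rewrite linearB /= (block_part_upper b X) subrr. Qed.

Lemma off_block_box_congr (X Y : 'M[R]_n) :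
  (forall k l, ~~ (b k <= b l)%N -> X k l = Y k l) ->
  \1_off_block_box X = \1_off_block_box Y :> R.
Proof.
move=> XY; rewrite !indicE; congr (nat_of_bool _)%:R.
by apply/idP/idP => /set_mem h; apply/mem_set => k l kl; have := h k l kl;
  rewrite XY.
Qed.

Lemma block_integral_mull T (f : 'M[R]_n -> R) :
  is_trig_mx T^T -> T \in unitmx ->
  measurable_fun setT f -> (forall X, 0 <= f X) ->
  block_integral (fun P => f (T *m P)) =
    ((left_modulus b T)%:E * block_integral f)%E.
Proof.
move=> tT uT mf f0; have bT := triangular_block_upper b_mono tT.
rewrite -det_block_mull_modulus// /block_integral.
rewrite -(@integral_lebesgue_mx_affine R n (block_mull b T) 0).
- apply: eq_integral => X _; rewrite addr0 /block_mull linearD /= block_partB addr0.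
  rewrite block_part_upper (block_upper_mulmx bT (block_part_upper b X)).
  congr (_ * _)%:E; apply: off_block_box_congr => k l kl.
  by rewrite !mxE (negbTE kl) add0r subr0.
- rewrite det_block_mull//; apply/prodf_neq0 => l _; exact: block_minor_neq0.
- exact: measurable_block_integrand.
- by move=> X; rewrite lee_fin mulr_ge0.
- exact: measurable_block_mull.
Qed.

Lemma block_integral_mulr T (f : 'M[R]_n -> R) :
  is_trig_mx T^T -> T \in unitmx ->
  measurable_fun setT f -> (forall X, 0 <= f X) ->
  block_integral (fun P => f (P *m T)) =
    ((right_modulus b T)%:E * block_integral f)%E.
Proof.
move=> tT uT mf f0; have bT := triangular_block_upper b_mono tT.
rewrite -det_block_mulr_modulus// /block_integral.
rewrite -(@integral_lebesgue_mx_affine R n (block_mulr b T) 0).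
- apply: eq_integral => X _; rewrite addr0 /block_mulr linearD /= block_partB addr0.
  rewrite block_part_upper (block_upper_mulmx (block_part_upper b X) bT).
  congr (_ * _)%:E; apply: off_block_box_congr => k l kl.
  by rewrite !mxE (negbTE kl) add0r subr0.
- have : \det T ^+ n != 0 by rewrite expf_neq0 -?unitfE -?unitmxE.
  by rewrite -(det_block_mulr b tT) mulf_eq0 negb_or => /andP[].
- exact: measurable_block_integrand.
- by move=> X; rewrite lee_fin mulr_ge0.
- exact: measurable_block_mulr.
Qed.

Lemma left_Haar_invariance T (f : 'M[R]_n -> R) :
  is_trig_mx T^T -> T \in unitmx ->
  measurable_fun setT f -> (forall X, 0 <= f X) ->
  block_integral (fun P => f (T *m P) * left_modulus b P) =
    block_integral (fun P => f P * left_modulus b P).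
Proof.
move=> tT uT mf f0; have bT := triangular_block_upper b_mono tT.
have mT := left_modulus_gt0 bT uT.
pose h P := f P * left_modulus b P.
have mh : measurable_fun setT h by apply: measurable_funM => //; exact: measurable_left_modulus.
have h0 P : 0 <= h P by rewrite mulr_ge0// left_modulus_ge0.
transitivity (block_integral (fun P => (left_modulus b T)^-1 * h (T *m P))).
  apply: eq_block_integral => P bP; rewrite /h left_modulusM//.
  by rewrite mulrCA mulrA [_ * (_ * left_modulus b P)]mulrA; field; rewrite gt_eqF.
rewrite block_integralZ ?invr_ge0 ?ltW//; last first.
  by apply: (measurableT_comp mh); exact: measurable_mulmx.
by rewrite block_integral_mull// muleA -EFinM mulVf ?gt_eqF// mul1e.
Qed.

Lemma right_Haar_invariance T (f : 'M[R]_n -> R) :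
  is_trig_mx T^T -> T \in unitmx ->
  measurable_fun setT f -> (forall X, 0 <= f X) ->
  block_integral (fun P => f (P *m T) * right_modulus b P) =
    block_integral (fun P => f P * right_modulus b P).
Proof.
move=> tT uT mf f0; have bT := triangular_block_upper b_mono tT.
have mT := right_modulus_gt0 bT uT.
pose h P := f P * right_modulus b P.
have mh : measurable_fun setT h by apply: measurable_funM => //; exact: measurable_right_modulus.
have h0 P : 0 <= h P by rewrite mulr_ge0// right_modulus_ge0.
transitivity (block_integral (fun P => (right_modulus b T)^-1 * h (P *m T))).
  apply: eq_block_integral => P bP; rewrite /h right_modulusM//.
  by field; rewrite gt_eqF.
rewrite block_integralZ ?invr_ge0 ?ltW//; last first.
  by apply: (measurableT_comp mh); exact: measurable_mulmx.
by rewrite block_integral_mulr// muleA -EFinM mulVf ?gt_eqF// mul1e.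
Qed.

(** Write [G = QT]; the weight does not see the rotation [Q], and left Haar
measure does not see [T]. *)
Lemma block_average_left (w : 'M[R]_n -> R) G :
  measurable_fun setT w -> (forall X, 0 <= w X) ->
  (forall Q X, special_orthogonal Q -> w (Q *m X) = w X) -> G \in unitmx ->
  block_integral (fun P => w (G *m P) * left_modulus b P) =
  block_integral (fun P => w P * left_modulus b P).
Proof.
move=> mw w0 wQ uG; have [T [tT uT GE]] := so_factor_triangular uG.
rewrite -(left_Haar_invariance tT uT mw w0); apply: eq_block_integral => P _.
by rewrite GE -mulmxA wQ//; exact: so_factor_special.
Qed.

Lemma block_average_right (w : 'M[R]_n -> R) G :
  measurable_fun setT w -> (forall X, 0 <= w X) ->
  (forall Q X, special_orthogonal Q -> w (Q *m X) = w X) -> G \in unitmx ->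
  block_integral (fun P => w (G *m invmx P) * right_modulus b P) =
  block_integral (fun P => w (invmx P) * right_modulus b P).
Proof.
move=> mw w0 wQ uG; have [T [tT uT GE]] := so_factor_triangular uG.
pose f P := w (T *m invmx P).
have mf : measurable_fun setT f.
  apply: (measurableT_comp mw); apply: measurable_mulmx => //.
  exact: measurable_invmx.
transitivity (block_integral (fun P => f P * right_modulus b P)).
  by apply: eq_block_integral => P _; rewrite GE -mulmxA wQ//; exact: so_factor_special.
rewrite -(right_Haar_invariance tT uT mf (fun X => w0 _)); apply: eq_block_integral => P _.
rewrite /right_modulus; case: ifPn => uP; last by rewrite !mulr0.
rewrite /f; congr (w _ * _); apply: (can_inj (mulKmx uP)).
by rewrite mulmxA mulmxV ?mulmxV// unitmx_mul uP.
Qed.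

(** The character for which the substitution of [G C^-1] for [G] turns the product of
[F(G) dG] and the left Haar measure of the [C] into the product of [F(G) dG] and
their right Haar measure. *)
Definition block_equivariant (F : 'M[R]_n -> R) :=
  forall G C, G \in unitmx -> block_upper b C -> C \in unitmx ->
  F (G *m C) * right_modulus b C = F G * (`|\det C| ^+ n)^-1 * left_modulus b C.

(** Both sides integrate [F(G) w(G) theta(G')] over pairs of matrices in the same
orbit of [P]: exchange the integrals and substitute [G P^-1] for [G]. *)
Lemma block_average_swap (F w theta : 'M[R]_n -> R) :
  measurable_fun setT F -> (forall X, 0 <= F X) ->
  measurable_fun setT w -> (forall X, 0 <= w X) ->
  measurable_fun setT theta -> (forall X, 0 <= theta X) ->
  (forall G, G \notin unitmx -> w G = 0) ->
  (forall G, G \notin unitmx -> theta G = 0) ->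
  block_equivariant F ->
  (\int[leb]_G ((F G * w G)%:E *
     block_integral (fun P => (theta (G *m P) * left_modulus b P)%R)) =
   \int[leb]_G ((F G * theta G)%:E *
     block_integral (fun P => (w (G *m invmx P) * right_modulus b P)%R)))%E.
Proof.
move=> mF F0 mw w0 mt t0 wN tN Feq.
have mbp := measurable_block_part.
have chi0 X : 0 <= \1_off_block_box X :> R by [].
have mchi : measurable_fun setT (fun X => \1_off_block_box X : R).
  by apply: measurable_indic; exact: measurable_off_block_box.
have mbp2 : measurable_fun setT (fun p : 'M[R]_n * 'M[R]_n => bpart p.2).
  exact: (measurableT_comp mbp measurable_snd).
have lm0 := left_modulus_ge0 b; have rm0 := right_modulus_ge0 b.
pose h1 (p : 'M[R]_n * 'M[R]_n) := F p.1 * w p.1 * (\1_off_block_box p.2 *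
  (theta (p.1 *m bpart p.2) * left_modulus b (bpart p.2))).
pose h2 (p : 'M[R]_n * 'M[R]_n) := F p.1 * theta p.1 * (\1_off_block_box p.2 *
  (w (p.1 *m invmx (bpart p.2)) * right_modulus b (bpart p.2))).
have mh1 : measurable_fun setT (EFin \o h1).
  apply/measurable_EFinP; apply: measurable_funM.
    by apply: measurable_funM; [exact: (measurableT_comp mF)|exact: (measurableT_comp mw)].
  apply: measurable_funM; first exact: (measurableT_comp mchi).
  apply: measurable_funM; last exact: (measurableT_comp measurable_left_modulus).
  by apply: (measurableT_comp mt); exact: measurable_mulmx.
have mh2 : measurable_fun setT (EFin \o h2).
  apply/measurable_EFinP; apply: measurable_funM.
    by apply: measurable_funM; [exact: (measurableT_comp mF)|exact: (measurableT_comp mt)].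
  apply: measurable_funM; first exact: (measurableT_comp mchi).
  apply: measurable_funM; last exact: (measurableT_comp measurable_right_modulus).
  apply: (measurableT_comp mw); apply: measurable_mulmx => //.
  exact: measurable_invmx.
have h10 p : (0 <= (EFin \o h1) p)%E by rewrite /= lee_fin !mulr_ge0.
have h20 p : (0 <= (EFin \o h2) p)%E by rewrite /= lee_fin !mulr_ge0.
transitivity (\int[leb]_G \int[leb]_X (h1 (G, X))%:E)%E.
  apply: eq_integral => G _; rewrite -ge0_integralZl_EFin//.
  - by move=> X _; rewrite lee_fin !mulr_ge0.
  - apply: (@measurable_block_integrand (fun P => theta (G *m P) * left_modulus b P)).
    apply: measurable_funM; last exact: measurable_left_modulus.
    by apply: (measurableT_comp mt); exact: measurable_mulmx.
  - by rewrite mulr_ge0.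
transitivity (\int[leb]_G \int[leb]_X (h2 (G, X))%:E)%E; last first.
  apply: eq_integral => G _; rewrite -ge0_integralZl_EFin//.
  - by move=> X _; rewrite lee_fin !mulr_ge0.
  - apply: (@measurable_block_integrand (fun P => w (G *m invmx P) * right_modulus b P)).
    apply: measurable_funM; last exact: measurable_right_modulus.
    apply: (measurableT_comp mw); apply: measurable_mulmx => //; exact: measurable_invmx.
  - by rewrite mulr_ge0.
have T1 := fubini_tonelli (m1 := leb) (m2 := leb) _ mh1 h10.
have T2 := fubini_tonelli (m1 := leb) (m2 := leb) _ mh2 h20.
rewrite /fubini_F /fubini_G /= in T1 T2.
rewrite T1 T2 {T1 T2}; apply: eq_integral => X _.
have [uP|uP] := boolP (bpart X \in unitmx); last first.
  by apply: eq_integral => G _; rewrite /h1 /h2 /left_modulus /right_modulus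
    (negbTE uP) !mulr0.
set P := bpart X in uP *.
have dV : \det (invmx P) != 0 by rewrite -unitfE -unitmxE unitmx_inv.
have dP : \det P != 0 by rewrite -unitfE -unitmxE.
have mh1X : measurable_fun setT (fun G => (h1 (G, X))%:E).
  by apply: (measurableT_comp mh1); exact: measurable_fun_pair.
have mh1XV : measurable_fun setT (fun G => (h1 (G *m invmx P, X))%:E).
  apply: (measurableT_comp mh1X); exact: measurable_mulmx.
have := integral_lebesgue_mx_mulr dV mh1X (fun G => h10 (G, X)).
rewrite det_inv normfV exprVn invrK => E.
have dPn : 0 < `|\det P| ^+ n by apply: exprn_gt0; rewrite normr_gt0; exact: dP.
(* The substitution of [G P^-1] for [G]. *)
transitivity (((`|\det P| ^+ n)^-1)%:E * \int[leb]_G (h1 (G *m invmx P, X))%:E)%E.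
  by rewrite E muleA -EFinM mulVf ?gt_eqF// mul1e.
rewrite -ge0_integralZl_EFin//; first last.
  by move=> G _; exact: h10.
apply: eq_integral => G _; rewrite -EFinM; congr EFin.
rewrite /h1 /h2 /= -/P mulmxKV//.
have [uG|uG] := boolP (G \in unitmx); last by rewrite tN// wN ?(mulr0, mul0r)//
  unitmx_mul (negbTE uG).
have uGV : G *m invmx P \in unitmx by rewrite unitmx_mul uG unitmx_inv.
have := Feq _ _ uGV (block_part_upper b X) uP; rewrite -/P mulmxKV// => FE.
transitivity (F (G *m invmx P) * (`|\det P| ^+ n)^-1 * left_modulus b P *
  (w (G *m invmx P) * (\1_off_block_box X * theta G))); first by ring.
rewrite -FE; ring.
Qed.

End block_averaging.

(** * A weight with finite positive averages *)

Section positive_integral.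
Variables (R : realType) (n : nat).
Notation leb := (lebesgue_mx R n).

Lemma mxtrace_sqr (A : 'M[R]_n) : \tr (A^T *m A) = \sum_j \sum_i A i j ^+ 2.
Proof.
by apply: eq_bigr => j _; rewrite mxE; apply: eq_bigr => i _; rewrite mxE expr2.
Qed.

Lemma entry_le_mxtrace_sqr (A : 'M[R]_n) i j : A i j ^+ 2 <= \tr (A^T *m A).
Proof.
rewrite mxtrace_sqr (bigD1 j)//= (bigD1 i)//= -addrA lerDl addr_ge0//.
  by apply: sumr_ge0 => k _; exact: sqr_ge0.
by apply: sumr_ge0 => k _; apply: sumr_ge0 => l _; exact: sqr_ge0.
Qed.

Lemma mxtrace_sqr_le (A : 'M[R]_n) : (forall i j, `|A i j| <= 1) ->
  \tr (A^T *m A) <= (n * n)%:R.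
Proof.
move=> A1; rewrite mxtrace_sqr; apply: (@le_trans _ _ (\sum_(j < n) \sum_(i < n) 1)).
  apply: ler_sum => j _; apply: ler_sum => i _.
  by rewrite -real_normK ?num_real// expr_le1.
by rewrite !sumr_const !card_ord -mulrnA.
Qed.

(** A nonnegative function of integral [0] vanishes almost everywhere, while the
unit box has measure [1] and the exceptional matrices are negligible. *)
Lemma positive_integral (f : 'M[R]_n -> R) (phi : {linear 'M[R]_n -> 'M[R]_n}) :
  measurable_fun setT f -> (forall X, 0 <= f X) ->
  measurable_fun setT phi -> phi 1%:M = 1%:M ->
  (forall X, mx_box n n 0 1 X -> \det (phi X) != 0 -> 0 < f X) ->
  (0 < \int[leb]_X (f X)%:E)%E.
Proof.
move=> mf f0 mphi phi1 fpos; rewrite lt_def integral_ge0 ?andbT; last first.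
  by move=> X _; rewrite lee_fin.
apply/eqP => int0.
have mEf : measurable_fun setT (EFin \o f) by exact/measurable_EFinP.
have [] := ae_eq_integral_abs leb measurableT mEf.
have -> : (\int[leb]_x `|(EFin \o f) x| = 0)%E.
  by rewrite -[RHS]int0; apply: eq_integral => X _ /=; rewrite ger0_norm.
move=> /(_ erefl) [N [mN N0 fN]] _.
have mD := measurable_set_eq0 (measurable_det mphi).
have boxN : mx_box n n 0 1 `<=` N `|` [set X : 'M[R]_n | \det (phi X) == 0].
  move=> X bX; have [dX|dX] := boolP (\det (phi X) == 0); first by right.
  left; apply: fN => /= /(_ Logic.I) [fX].
  by have := fpos X bX dX; rewrite fX ltxx.
have := @lebesgue_mx_box R n 0 1 ler01.
rewrite subr0 expr1n => box1.
have : (leb (mx_box n n 0 1) <= 0)%E.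
  apply: (@le_trans _ _ (leb (N `|` [set X : 'M[R]_n | \det (phi X) == 0]))).
    apply: le_measure boxN; apply/mem_set; first exact: measurable_mx_box.
    exact: measurableU.
  apply: (le_trans (measureU2 _ _ _)) => //.
  have NE : (leb N + leb [set X : 'M[R]_n | (\det (phi X) == 0)%R] = 0)%E.
    by rewrite [X in (X + _)%E]N0 [X in (_ + X)%E](lebesgue_mx_null_det mphi phi1) adde0.
  by rewrite [leLHS]NE.
by rewrite box1 lee_fin ler10.
Qed.

Lemma bounded_integral (f : 'M[R]_n -> R) (a c : R) : a <= c ->
  measurable_fun setT f -> (forall X, 0 <= f X) -> (forall X, f X <= 1) ->
  (forall X, f X != 0 -> mx_box n n a c X) ->
  (\int[leb]_X (f X)%:E < +oo)%E.
Proof.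
move=> ac mf f0 f1 fbox.
have mB := @measurable_mx_box R n n a c.
apply: (@le_lt_trans _ _ (\int[leb]_X (\1_(mx_box n n a c) X)%:E)%E).
  apply: ge0_le_integral => //.
  - by move=> X _; rewrite lee_fin.
  - exact/measurable_EFinP.
  - by apply/measurable_EFinP; exact: measurable_indic.
  move=> X _; rewrite lee_fin indicE.
  have [fX0|/fbox bX] := eqVneq (f X) 0; first by rewrite fX0.
  by rewrite mem_set.
rewrite integral_indic// setIT.
by rewrite [X in (X < _)%E](lebesgue_mx_box n ac) ltry.
Qed.

End positive_integral.

Section averaging_weight.
Variables (R : realType) (n : nat) (b : 'I_n -> nat).
Hypothesis b_mono : forall k l : 'I_n, (k <= l)%N -> (b k <= b l)%N.
Notation leb := (lebesgue_mx R n).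
Notation V j G := (gram_vol (step_projector R b j) G).
Implicit Types (X P C G T : 'M[R]_n).

(** The product [V_(b l).+1 V_(b l)] over all coordinates [l] is the product of the
[V_j], each raised to the power that is the size of the two blocks adjacent to
step [j]; its quotient at [gG] and [G] depends on [g] and the flag of [G]
only. *)
Definition flag_density G := \prod_l (V (b l).+1 G * V (b l) G)^-1.

(** A weight invariant under left rotations and positive at the invertible matrices
of bounded norm.  The trace condition bounds the support; of the two products, the first makes
[flag_density * weight] at most [1] and the second makes [weight * left_modulus]
at most [1], so that the total mass and the average over block upper triangular
matrices are both finite. *)
Definition weight G := if (G \in unitmx) && (\tr (G^T *m G) <= (n * n)%:R) then
  Num.min (\prod_l (V (b l).+1 G * V (b l) G)) (\prod_l V (b l).+1 G) else 0.

Lemma measurable_step_gram_vol j : measurable_fun setT (fun G => V j G).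
Proof. by apply: (@measurable_gram_vol R n _ _ (fun=> step_projector R b j) id). Qed.

Lemma measurable_flag_density : measurable_fun setT flag_density.
Proof.
apply: measurable_prod => l _; apply: measurable_invr.
by apply: measurable_funM; exact: measurable_step_gram_vol.
Qed.

Lemma measurable_weight : measurable_fun setT weight.
Proof.
apply: measurable_fun_ifT => //.
  apply: measurable_and; first exact: measurable_unitmx.
  apply: measurable_fun_ler => //; apply: measurable_mxtrace.
  by apply: measurable_mulmx => //; exact: measurable_trmx.
apply: measurable_minr; apply: measurable_prod => l _.
  by apply: measurable_funM; exact: measurable_step_gram_vol.
exact: measurable_step_gram_vol.
Qed.

Lemma step_gram_vol_gt0 j G : G \in unitmx -> 0 < V j G.
Proof. by apply: gram_vol_gt0; exact: step_projectorP. Qed.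

Lemma flag_density_ge0 G : 0 <= flag_density G.
Proof. by apply: prodr_ge0 => l _; rewrite invr_ge0 mulr_ge0// sqrtr_ge0. Qed.

Lemma flag_density_gt0 G : G \in unitmx -> 0 < flag_density G.
Proof.
by move=> uG; apply: prodr_gt0 => l _; rewrite invr_gt0 mulr_gt0// step_gram_vol_gt0.
Qed.

Lemma weight_ge0 G : 0 <= weight G.
Proof.
rewrite /weight; case: ifP => // _; rewrite le_min; apply/andP; split;
  by apply: prodr_ge0 => l _; rewrite ?mulr_ge0// sqrtr_ge0.
Qed.

Lemma weight_gt0 G : G \in unitmx -> \tr (G^T *m G) <= (n * n)%:R -> 0 < weight G.
Proof.
move=> uG trG; rewrite /weight uG trG/= lt_min; apply/andP; split;
  by apply: prodr_gt0 => l _; rewrite ?mulr_gt0// step_gram_vol_gt0.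
Qed.

Lemma weight_nonunit G : G \notin unitmx -> weight G = 0.
Proof. by rewrite /weight => /negbTE ->. Qed.

Lemma weight_support G : weight G != 0 ->
  (G \in unitmx) /\ \tr (G^T *m G) <= (n * n)%:R.
Proof. by rewrite /weight; case: ifP => [/andP[]//|_]; rewrite eqxx. Qed.

Lemma weight_orthogonal Q G : special_orthogonal Q -> weight (Q *m G) = weight G.
Proof.
move=> [QQ dQ]; have uQ : Q \in unitmx by rewrite unitmxE dQ unitr1.
have VE j : V j (Q *m G) = V j G by exact: gram_vol_orthogonal.
rewrite /weight unitmx_mul uQ/= trmx_mul mulmxA -[_ *m Q^T *m Q]mulmxA QQ mulmx1.
by case: ifP => // _; congr Num.min; apply: eq_bigr => l _; rewrite !VE.
Qed.

Lemma flag_density_orthogonal Q G : special_orthogonal Q ->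
  flag_density (Q *m G) = flag_density G.
Proof.
move=> [QQ _]; have VE j : V j (Q *m G) = V j G by exact: gram_vol_orthogonal.
by apply: eq_bigr => l _; rewrite !VE.
Qed.

Lemma flag_density_block G C : block_upper b C -> C \in unitmx ->
  flag_density (G *m C) * right_modulus b C =
  flag_density G * (`|\det C| ^+ n)^-1 * left_modulus b C.
Proof.
move=> bC uC; rewrite /right_modulus /left_modulus uC.
rewrite mulrCA -[in RHS]mulrA [in RHS]mulrCA; congr (_ * _).
rewrite -!big_split /=; apply: eq_bigr => l _; rewrite !gram_vol_block//.
have := block_minor_neq0 (b l) bC uC; rewrite -normr_eq0 => D0.
by rewrite mulrACA mulrA invfM mulfVK// invfM.
Qed.

Lemma flag_density_weight_le1 G : flag_density G * weight G <= 1.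
Proof.
rewrite /weight; case: ifP => [/andP[uG _]|_]; last by rewrite mulr0.
have f0 := flag_density_gt0 uG.
apply: (@le_trans _ _ (flag_density G * \prod_l (V (b l).+1 G * V (b l) G))).
  by rewrite ler_pM2l// ge_min lexx.
rewrite /flag_density -big_split /= big1// => l _.
by rewrite mulVf// gt_eqF// mulr_gt0// step_gram_vol_gt0.
Qed.

Lemma weight_modulus_le1 P : block_upper b P -> weight P * left_modulus b P <= 1.
Proof.
move=> bP; rewrite /weight; case: ifP => [/andP[uP _]|_]; last by rewrite mul0r.
have l0 := left_modulus_gt0 bP uP.
apply: (@le_trans _ _ ((\prod_l V (b l).+1 P) * left_modulus b P)).
  by rewrite ler_pM2r// ge_min lexx orbT.
rewrite /left_modulus uP -big_split /= big1// => l _.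
by rewrite gram_vol_minor// mulfV// normr_eq0 block_minor_neq0.
Qed.

Lemma mxtrace_box G : \tr (G^T *m G) <= (n * n)%:R -> mx_box n n (- n%:R) n%:R G.
Proof.
move=> trG i j; rewrite -ler_norml -(@ler_pXn2r _ 2)// ?nnegrE//.
rewrite real_normK ?num_real// (le_trans (entry_le_mxtrace_sqr G i j))//.
by rewrite (le_trans trG)// natrM expr2.
Qed.

Lemma box_mxtrace (phi : 'M[R]_n -> 'M[R]_n) G :
  (forall i j, phi G i j = G i j \/ phi G i j = 0) ->
  mx_box n n 0 1 G -> \tr ((phi G)^T *m phi G) <= (n * n)%:R.
Proof.
move=> phiG G01; apply: mxtrace_sqr_le => i j.
have /andP[G0 G1] := G01 i j.
by have [->|->] := phiG i j; [rewrite ger0_norm|rewrite normr0].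
Qed.

Definition total_mass : \bar R := (\int[leb]_G (flag_density G * weight G)%:E)%E.

Definition block_mass : \bar R :=
  block_integral b (fun P => weight P * left_modulus b P).

Lemma total_mass_fin : (0 < total_mass < +oo)%E.
Proof.
have m : measurable_fun setT (fun G => flag_density G * weight G).
  apply: measurable_funM; [exact: measurable_flag_density|exact: measurable_weight].
have ge G : 0 <= flag_density G * weight G.
  by rewrite mulr_ge0 ?flag_density_ge0 ?weight_ge0.
apply/andP; split.
  apply: (@positive_integral _ _ _ idfun) => //; first exact: measurable_id.
  move=> X X01 dX.
  have uX : X \in unitmx by rewrite unitmxE unitfE.
  rewrite mulr_gt0// ?flag_density_gt0// weight_gt0//.
  by apply: (@box_mxtrace id) => // i j; left.
apply: (@bounded_integral _ _ _ (- n%:R) n%:R) => //.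
- by rewrite (@le_trans _ _ 0) ?oppr_le0.
- exact: flag_density_weight_le1.
move=> X; rewrite mulf_eq0 negb_or => /andP[_ /weight_support[_]].
exact: mxtrace_box.
Qed.

Lemma block_mass_fin : (0 < block_mass < +oo)%E.
Proof.
have mm : measurable_fun setT (fun P => weight P * left_modulus b P).
  apply: measurable_funM; [exact: measurable_weight|exact: measurable_left_modulus].
have ge P : 0 <= weight P * left_modulus b P.
  by rewrite mulr_ge0 ?weight_ge0 ?left_modulus_ge0.
have mbp := @measurable_block_part R n b.
have m : measurable_fun setT (fun X => \1_(off_block_box b) X *
    (weight (block_part b X) * left_modulus b (block_part b X)) : R).
  by have /measurable_EFinP := measurable_block_integrand b mm.
apply/andP; split.
  apply: (@positive_integral _ _ _ (block_part b)) => //.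
  - by move=> X; rewrite mulr_ge0.
  - apply/matrixP => i j; rewrite !mxE; case: ifPn => // ij.
    by case: (i =P j) => // eij; rewrite eij leqnn in ij.
  move=> X X01 dX.
  have uX : block_part b X \in unitmx by rewrite unitmxE unitfE.
  rewrite indicE mem_set ?mul1r; last by move=> k l _; exact: X01.
  rewrite mulr_gt0 ?left_modulus_gt0//; last exact: block_part_upper.
  rewrite weight_gt0//; apply: (@box_mxtrace (block_part b)) => // i j.
  by rewrite mxE; case: ifP => _; [left|right].
apply: (@bounded_integral _ _ _ (- n%:R) n%:R) => //.
- by rewrite (@le_trans _ _ 0) ?oppr_le0.
- by move=> X; rewrite mulr_ge0.
- move=> X; rewrite mulr_ile1// ?weight_modulus_le1//; last exact: block_part_upper.
move=> X; rewrite mulf_eq0 negb_or => /andP[offX].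
rewrite mulf_eq0 negb_or => /andP[/weight_support[_ /mxtrace_box bX] _] i j.
have [ij|ij] := boolP (b i <= b j)%N; first by have := bX i j; rewrite mxE ij.
have offX' : off_block_box b X.
  by move: offX; rewrite indicE; case: (boolP (X \in _)) => [/set_mem//|_]; rewrite eqxx.
have /andP[X0 X1] := offX' i j ij; apply/andP; split.
  by rewrite (le_trans _ X0)// oppr_le0.
by rewrite (le_trans X1)// ler1n; case: n i {j ij bX X0 X1 offX offX' X} => [[]|].
Qed.

(** Apply the exchange of averages to the pair [w(h -)], [w], for [h = g] and for
[h = 1]: the averages are constants [c] and [c'], the same in both cases, and
[c] can be cancelled. *)
Lemma block_average_invariance (w F : 'M[R]_n -> R) (g : 'M[R]_n) :
  measurable_fun setT w -> (forall G, 0 <= w G) ->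
  (forall G, G \notin unitmx -> w G = 0) ->
  (forall Q X, special_orthogonal Q -> w (Q *m X) = w X) ->
  (0 < block_integral b (fun P => (w P * left_modulus b P)%R) < +oo)%E ->
  measurable_fun setT F -> (forall G, 0 <= F G) -> block_equivariant b F ->
  g \in unitmx ->
  (\int[leb]_G (F G * w (g *m G))%:E = \int[leb]_G (F G * w G)%:E)%E.
Proof.
move=> mw w0 wN wQ; set c := block_integral b _ => c_fin mF F0 Feq ug.
have c0 : (0 <= c)%E by have /andP[/ltW] := c_fin.
have clE G : G \in unitmx ->
    block_integral b (fun P => w (G *m P) * left_modulus b P) = c.
  exact: block_average_left.
have c'0 : (0 <= block_integral b (fun P => (w (invmx P) * right_modulus b P)%R))%E.
  by apply: integral_ge0 => X _; rewrite lee_fin !mulr_ge0// right_modulus_ge0.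
have crE G : G \in unitmx ->
    block_integral b (fun P => w (G *m invmx P) * right_modulus b P) =
    block_integral b (fun P => w (invmx P) * right_modulus b P).
  exact: block_average_right.
move: c (block_integral b (fun P => w (invmx P) * right_modulus b P))
  c0 c'0 c_fin clE crE => {}c c' c0 c'0 c_fin clE crE.
have Zl (k : \bar R) (f : 'M[R]_n -> \bar R) : (0 <= k)%E ->
    measurable_fun setT f -> (forall G, 0 <= f G)%E ->
    (k * \int[leb]_G f G = \int[leb]_G (k * f G))%E.
  by move=> k0 mf f0; rewrite ge0_integralZl.
have swapg h : h \in unitmx ->
    (c * \int[leb]_G (F G * w (h *m G))%:E = c' * \int[leb]_G (F G * w G)%:E)%E.
  move=> uh.
  have mh : measurable_fun setT (fun G => w (h *m G)).
    by apply: (measurableT_comp mw); exact: measurable_mulmx.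
  have hN G : G \notin unitmx -> w (h *m G) = 0.
    by move=> uG; rewrite wN// unitmx_mul uh.
  have h0 X : 0 <= w (h *m X) by exact: w0.
  have mFh : measurable_fun setT (fun G => (F G * w (h *m G))%:E).
    by apply/measurable_EFinP; exact: measurable_funM.
  have mFw : measurable_fun setT (fun G => (F G * w G)%:E).
    by apply/measurable_EFinP; exact: measurable_funM.
  have Fh0 G : (0 <= (F G * w (h *m G))%:E)%E by rewrite lee_fin mulr_ge0.
  have Fw0 G : (0 <= (F G * w G)%:E)%E by rewrite lee_fin mulr_ge0.
  rewrite (Zl _ _ c0 mFh Fh0) (Zl _ _ c'0 mFw Fw0).
  have := block_average_swap mF F0 mh h0 mw w0 hN wN Feq.
  rewrite (eq_integral (fun G => c * (F G * w (h *m G))%:E)%E).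
    move=> ->; apply: eq_integral => G _; rewrite muleC.
    have [uG|uG] := boolP (G \in unitmx); last by rewrite (wN _ uG) mulr0 !mule0.
    rewrite -(crE (h *m G)); last by rewrite unitmx_mul uh.
    by congr (_ * _)%E; apply: eq_block_integral => P _; rewrite mulmxA.
  move=> G _; rewrite muleC; have [uG|uG] := boolP (G \in unitmx); last first.
    by rewrite (hN _ uG) mulr0 !mule0.
  by rewrite (clE _ uG).
have E1 : (c * \int[leb]_G (F G * w G)%:E = c' * \int[leb]_G (F G * w G)%:E)%E.
  rewrite -(swapg 1%:M) ?unitmx1//.
  by congr (_ * _)%E; apply: eq_integral => G _; rewrite mul1mx.
have Eg := swapg g ug; rewrite -E1 in Eg.
case: c c_fin Eg {c0 clE swapg E1} => [r| |] //; last by rewrite ltxx andbF.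
rewrite lte_fin => /andP[r0 _] Eg.
have rK (x : \bar R) : (r^-1%:E * (r%:E * x) = x)%E.
  by rewrite muleA -EFinM mulVf ?gt_eqF// mul1e.
by rewrite -[LHS]rK Eg rK.
Qed.

Lemma block_average (F : 'M[R]_n -> R) (g : 'M[R]_n) :
  measurable_fun setT F -> (forall G, 0 <= F G) -> block_equivariant b F ->
  g \in unitmx ->
  (\int[leb]_G (F G * weight (g *m G))%:E = \int[leb]_G (F G * weight G)%:E)%E.
Proof.
apply: block_average_invariance.
- exact: measurable_weight.
- exact: weight_ge0.
- exact: weight_nonunit.
- exact: weight_orthogonal.
- exact: block_mass_fin.
Qed.

End averaging_weight.

(** * Subspaces and their projectors *)

Section subspace_projectors.
Variables (R : realType) (n : nat).
Implicit Types (P Q A : 'M[R]_n) (F U : {vspace 'cV[R]_n}).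

Lemma orthoprojP F : orthogonal_projector (orthoproj F).
Proof.
have [BB _] := orthonormal_basisP F; rewrite /orthoproj; split.
  by rewrite trmx_mul trmxK.
by rewrite mulmxA -[_ *m _^T *m _]mulmxA BB mulmx1.
Qed.

Lemma orthoproj_fix F (x : 'cV[R]_n) : x \in F <-> orthoproj F *m x = x.
Proof.
have [BB BF] := orthonormal_basisP F; split; last by move=> <-; exact: orthoproj_mem.
move=> /BF[y ->]; rewrite /orthoproj -mulmxA (mulmxA _^T) BB mul1mx.
by [].
Qed.

Lemma projector_sub P Q : orthogonal_projector P ->
  (forall x : 'cV[R]_n, P *m x = x -> Q *m x = x) -> Q *m P = P.
Proof.
move=> [_ PP] PQ; apply/matrixP => i j.
have := PQ (col j P); rewrite !colE !mulmxA PP => /(_ erefl) /colP/(_ i).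
by rewrite -!colE mxE => ->; rewrite mxE.
Qed.

Lemma projector_eq P Q : orthogonal_projector P -> orthogonal_projector Q ->
  (forall x : 'cV[R]_n, P *m x = x <-> Q *m x = x) -> P = Q.
Proof.
move=> oP oQ PQ; have QP : Q *m P = P by apply: projector_sub => // x /PQ.
have : P *m Q = Q by apply: projector_sub => // x /PQ.
by move/(congr1 trmx); rewrite trmx_mul oP.1 oQ.1 QP.
Qed.

Lemma mem_mulmx_imgP A F (x : 'cV[R]_n) :
  reflect (exists2 y, y \in F & x = A *m y) (x \in (linfun (mulmx A) @: F)%VS).
Proof.
by apply: (iffP memv_imgP) => -[y yF ->]; exists y; rewrite ?lfunE.
Qed.

Lemma mem_mulmx_limgP A (x : 'cV[R]_n) :
  reflect (exists y : 'cV[R]_n, x = A *m y) (x \in limg (linfun (mulmx A))).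
Proof.
apply: (iffP (mem_mulmx_imgP _ _ _)) => [[y _ ->]|[y ->]]; exists y => //.
exact: memvf.
Qed.

Lemma orthoproj_limg P : orthogonal_projector P ->
  orthoproj (limg (linfun (mulmx P))) = P.
Proof.
move=> oP; apply: projector_eq => //; first exact: orthoprojP.
move=> x; rewrite -orthoproj_fix; split; last by move=> <-; apply/mem_mulmx_limgP; eexists.
by move=> /mem_mulmx_limgP[y ->]; rewrite mulmxA oP.2.
Qed.

Lemma orthoproj_img A F : A \in unitmx ->
  orthoproj (linfun (mulmx A) @: F)%VS = image_projector (orthoproj F) A.
Proof.
move=> uA; have oP := orthoprojP F; apply: projector_eq; first exact: orthoprojP.
  exact: image_projectorP.
move=> x; rewrite -orthoproj_fix; split => [/mem_mulmx_imgP[y /orthoproj_fix yF ->]|xE].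
  by rewrite -yF (mulmxA A) mulmxA image_projector_fix.
apply/mem_mulmx_imgP; exists (orthoproj F *m
  (invmx (gram (orthoproj F) A) *m (orthoproj F *m (A^T *m x)))).
  exact: orthoproj_mem.
by rewrite -{1}xE /image_projector !mulmxA.
Qed.

Lemma dim_mulmx_img A F : A \in unitmx -> \dim (linfun (mulmx A) @: F)%VS = \dim F.
Proof.
move=> uA; apply: limg_dim_eq; apply/eqP; rewrite -subv0; apply/subvP => x.
rewrite memv_cap memv_ker lfunE /= memv0 => /andP[_ /eqP Ax].
by rewrite -[x](mulKmx uA) Ax mulmx0.
Qed.

Lemma mxtrace_orthoproj F : \tr (orthoproj F) = (\dim F)%:R.
Proof.
have [BB _] := orthonormal_basisP F.
by rewrite /orthoproj mxtrace_mulC BB mxtrace1.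
Qed.

Lemma orthoproj_subv F U : (F <= U)%VS <-> orthoproj U *m orthoproj F = orthoproj F.
Proof.
split => [/subvP FU|UF].
  apply: projector_sub; first exact: orthoprojP.
  by move=> x /orthoproj_fix /FU /orthoproj_fix.
apply/subvP => x /orthoproj_fix xF; apply/orthoproj_fix.
by rewrite -xF mulmxA UF.
Qed.

Lemma mulmx_imgM A C F :
  (linfun (mulmx (A *m C)) @: F)%VS = (linfun (mulmx A) @: (linfun (mulmx C) @: F))%VS.
Proof.
apply/vspaceP => x; apply/mem_mulmx_imgP/mem_mulmx_imgP => [[y yF ->]|].
  by exists (C *m y); rewrite ?mulmxA//; apply/mem_mulmx_imgP; exists y.
by move=> [_ /mem_mulmx_imgP[y yF ->] ->]; exists y; rewrite ?mulmxA.
Qed.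

Lemma mulmx_img1 F : (linfun (mulmx 1%:M) @: F)%VS = F.
Proof.
apply/vspaceP => x; apply/mem_mulmx_imgP/idP => [[y yF ->]|xF].
  by rewrite mul1mx.
by exists x; rewrite ?mul1mx.
Qed.

End subspace_projectors.

Section measurable_subspaces.
Variables (R : realType) (n : nat).

Lemma measurable_orthoproj : measurable_fun setT (@orthoproj R n).
Proof. by move=> _ B mB; exists B. Qed.

Lemma measurable_fun_vspace d (T : measurableType d) (f : T -> {vspace 'cV[R]_n}) :
  measurable_fun setT (fun x => orthoproj (f x)) -> measurable_fun setT f.
Proof.
move=> mf _ _ [B mB <-]; rewrite !setTI -comp_preimage -[X in measurable X]setTI.
exact: (mf measurableT B mB).
Qed.

Lemma measurable_mulmx_img d (T : measurableType d) (A : T -> 'M[R]_n)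
    (F : T -> {vspace 'cV[R]_n}) :
  (forall x, A x \in unitmx) -> measurable_fun setT A -> measurable_fun setT F ->
  measurable_fun setT (fun x => linfun (mulmx (A x)) @: F x)%VS.
Proof.
move=> uA mA mF; apply: measurable_fun_vspace.
under [X in measurable_fun _ X]eq_fun do rewrite orthoproj_img//.
have mP : measurable_fun setT (fun x => orthoproj (F x)).
  exact: (measurableT_comp measurable_orthoproj mF).
exact: measurable_image_projector.
Qed.

Variables (r : nat) (i : r.-tuple nat).
Notation flags := (r.-tuple {vspace 'cV[R]_n}).

Lemma tnth_flag_action (A : 'M[R]_n) (xi : flags) j :
  tnth (flag_action A xi) j = (linfun (mulmx A) @: tnth xi j)%VS.
Proof. exact: tnth_map. Qed.

Lemma flag_actionM (A C : 'M[R]_n) (xi : flags) :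
  flag_action (A *m C) xi = flag_action A (flag_action C xi).
Proof. by apply: eq_from_tnth => j; rewrite !tnth_flag_action mulmx_imgM. Qed.

Lemma flag_action1 (xi : flags) : flag_action 1%:M xi = xi.
Proof. by apply: eq_from_tnth => j; rewrite tnth_flag_action mulmx_img1. Qed.

Lemma measurable_flag_action d (T : measurableType d) (A : T -> 'M[R]_n)
    (xi : T -> flags) :
  (forall x, A x \in unitmx) -> measurable_fun setT A -> measurable_fun setT xi ->
  measurable_fun setT (fun x => flag_action (A x) (xi x)).
Proof.
move=> uA mA mxi; apply/measurable_fun_tnthP => j; rewrite /comp.
under [X in measurable_fun _ X]eq_fun do rewrite tnth_flag_action.
apply: measurable_mulmx_img => //.
exact: (measurableT_comp (measurable_tnth j) mxi).
Qed.

Lemma flag_manifold_action (A : 'M[R]_n) (xi : flags) : A \in unitmx ->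
  flag_manifold i xi -> flag_manifold i (flag_action A xi).
Proof.
move=> uA [xi_dim xi_sub]; split => [j|j k jk].
  by rewrite tnth_flag_action dim_mulmx_img.
by rewrite !tnth_flag_action limgS// xi_sub.
Qed.

(** The dimension is the trace of the projector, and inclusion is a matrix
equation between projectors. *)
Lemma measurable_flag_manifold : measurable (@flag_manifold R n r i).
Proof.
have mP (j : 'I_r) : measurable_fun setT (fun xi : flags => orthoproj (tnth xi j)).
  exact: (measurableT_comp measurable_orthoproj (measurable_tnth j)).
have -> : @flag_manifold R n r i =
    (\bigcap_(j in [set: 'I_r]) [set xi : flags |
      \tr (orthoproj (tnth xi j)) - (flag_index n i j.+1)%:R == 0]) `&`
    (\bigcap_(jk in [set jk : 'I_r * 'I_r | (jk.1 <= jk.2)%N])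
      \bigcap_(ab in [set: 'I_n * 'I_n]) [set xi : flags |
        (orthoproj (tnth xi jk.2) *m orthoproj (tnth xi jk.1) -
         orthoproj (tnth xi jk.1)) ab.1 ab.2 == 0]).
  apply/seteqP; split => xi [xi1 xi2]; split.
  - by move=> j _ /=; rewrite mxtrace_orthoproj xi1 subrr.
  - move=> [j k] /= jk [a c] _ /=.
    by have /orthoproj_subv -> := xi2 j k jk; rewrite subrr mxE.
  - move=> j; have := xi1 j Logic.I; rewrite /= mxtrace_orthoproj subr_eq0 eqr_nat.
    by move/eqP.
  - move=> j k jk; apply/orthoproj_subv/matrixP => a c.
    have /eqP := xi2 (j, k) jk (a, c) Logic.I.
    by rewrite /= mxE [X in _ + X]mxE => /subr0_eq.
apply: measurableI.
  apply: fin_bigcap_measurable => [|j _]; first exact: finite_finset.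
  apply: measurable_set_eq0; apply: measurable_funB => //.
  exact: measurable_mxtrace.
apply: fin_bigcap_measurable => [|[j k] _]; first exact: finite_finset.
apply: fin_bigcap_measurable => [|[a c] _]; first exact: finite_finset.
apply: measurable_set_eq0; apply: measurable_mx_coord.
apply: measurable_addmx; first exact: measurable_mulmx.
exact: measurable_oppmx.
Qed.

End measurable_subspaces.

(** * The standard flag and adapted frames *)

Section block_index.

Lemma sorted_count_leq (s : seq nat) k j : sorted ltn s -> (j < size s)%N ->
  (count (fun m => m <= k)%N s < j.+1)%N = (k < nth 0 s j)%N.
Proof.
elim: s j => [|a s IHs] j //= sa; have ss := path_sorted sa.
have [ak|ka] := leqP a k.
  case: j => [_|j] /=; first by rewrite add1n ltnS ltn0 ltnNge ak.
  by rewrite ltnS add1n ltnS => /(IHs _ ss).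
have c0 : count (fun m => m <= k)%N s = 0%N.
  apply/eqP; rewrite -leqn0 leqNgt -has_count; apply/hasPn => m ms.
  rewrite -ltnNge (ltn_trans ka)//.
  by have /allP := order_path_min ltn_trans sa; apply.
rewrite c0 addn0 => js; apply/esym; case: j js => [|j] //= js.
rewrite (ltn_trans ka)//.
by have /allP := order_path_min ltn_trans sa; apply; exact: mem_nth.
Qed.

Lemma sum_ltn_ord n d : (d <= n)%N -> (\sum_(k < n) (k < d)%N = d)%N.
Proof.
move=> dn; rewrite -(big_mkord xpredT (fun k => (k < d)%N : nat)).
rewrite (big_cat_nat _ dn)//= big_nat_cond [X in (_ + X)%N]big_nat_cond.
rewrite (eq_bigr (fun=> 1%N)); last by move=> k /andP[/andP[_ ->]].
rewrite [X in (_ + X)%N]big1; last by move=> k /andP[/andP[dk _] _]; rewrite ltnNge dk.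
by rewrite -big_nat_cond sum_nat_const_nat subn0 muln1 addn0.
Qed.

End block_index.

Section adapted_frames.
Variables (R : realType) (n r : nat) (i : r.-tuple nat).
Hypothesis i_incr : sorted ltn i.
Hypothesis i_range : all (fun k => (1 <= k <= n.-1)%N) i.
Notation flags := (r.-tuple {vspace 'cV[R]_n}).

(** The number of the block, counted from [0], that contains coordinate [k]: block
[m] consists of the [k] with [i_m <= k < i_(m+1)]. *)
Definition block_index (k : 'I_n) := count (fun m => m <= k)%N i.

Notation e := (step_projector R block_index).

Lemma block_index_mono (k l : 'I_n) : (k <= l)%N -> (block_index k <= block_index l)%N.
Proof. by move=> kl; apply: sub_count => m mk; exact: leq_trans mk kl. Qed.

Lemma flag_indexS (j : 'I_r) : flag_index n i j.+1 = nth 0%N i j.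
Proof. by rewrite /flag_index /=; apply: set_nth_default; rewrite size_tuple. Qed.

Lemma block_index_lt (k : 'I_n) (j : 'I_r) :
  (block_index k < j.+1)%N = (k < flag_index n i j.+1)%N.
Proof. by rewrite flag_indexS sorted_count_leq// size_tuple. Qed.

Lemma flag_index_le (j : 'I_r) : (flag_index n i j.+1 <= n)%N.
Proof.
rewrite flag_indexS; have /allP := i_range.
move=> /(_ (nth 0%N i j)) /(_ (mem_nth _ _)); rewrite size_tuple => /(_ (ltn_ord j)).
by case/andP => _ /leq_trans; apply; exact: leq_pred.
Qed.

Lemma mxtrace_step_projector (j : 'I_r) : \tr (e j.+1) = (flag_index n i j.+1)%:R.
Proof.
rewrite -[in RHS](sum_ltn_ord (flag_index_le j)) natr_sum.
by apply: eq_bigr => k _; rewrite !mxE eqxx mulr1n block_index_lt.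
Qed.

Definition std_flag : flags :=
  [tuple limg (linfun (mulmx (e j.+1))) | j < r].

Lemma tnth_std_flag j : tnth std_flag j = limg (linfun (mulmx (e j.+1))).
Proof. exact: tnth_mktuple. Qed.

Lemma orthoproj_std_flag j : orthoproj (tnth std_flag j) = e j.+1.
Proof. by rewrite tnth_std_flag orthoproj_limg//; exact: step_projectorP. Qed.

Lemma dim_std_flag j : \dim (tnth std_flag j) = flag_index n i j.+1.
Proof.
apply/eqP; rewrite -(eqr_nat R) -mxtrace_orthoproj orthoproj_std_flag.
by rewrite mxtrace_step_projector.
Qed.

Lemma std_flag_manifold : flag_manifold i std_flag.
Proof.
split => [j|j k jk]; first exact: dim_std_flag.
apply/orthoproj_subv; rewrite !orthoproj_std_flag mulmx_diag; congr diag_mx.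
apply/rowP => m; rewrite !mxE -natrM mulnb.
case: (boolP (block_index m < j.+1)%N) => [mj|_]; last by rewrite andbF.
by rewrite (leq_trans mj).
Qed.

Lemma std_flag_block C : block_upper block_index C -> C \in unitmx ->
  flag_action C std_flag = std_flag.
Proof.
move=> bC uC; apply: eq_from_tnth => j; rewrite tnth_flag_action.
apply/eqP; rewrite eqEdim dim_mulmx_img// leqnn andbT.
apply/subvP => x /mem_mulmx_imgP[z zF ->]; move: zF.
rewrite tnth_std_flag => /mem_mulmx_limgP[y ->]; apply/mem_mulmx_limgP.
by rewrite mulmxA block_upper_step// -!mulmxA; eexists.
Qed.

Lemma dim_basis_size (vT : vectType R) (U : {vspace vT}) (X : seq vT) :
  basis_of U X -> \dim U = size X.
Proof. exact: (@size_basis _ _ _ _ (in_tuple X)). Qed.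

(** Extend a basis of each subspace by one of a complement in the next. *)
Lemma adapted_basis (vT : vectType R) (U : nat -> {vspace vT}) m :
  (forall j k, (j <= k)%N -> (U j <= U k)%VS) ->
  exists2 X, basis_of (U m) X &
    forall j, (j <= m)%N -> U j = <<take (\dim (U j)) X>>%VS.
Proof.
move=> U_mono; elim: m => [|m [X XU Xtake]].
  exists (vbasis (U 0%N)); first exact: vbasisP.
  move=> j; rewrite leqn0 => /eqP ->; rewrite take_oversize ?size_tuple//.
  by rewrite (span_basis (vbasisP _)).
pose W := (U m.+1 :\: U m)%VS.
have UW : (U m + W)%VS = U m.+1.
  by rewrite addvC addv_diff; apply/addv_idPl; exact: U_mono.
have dUW : directv (U m + W) by apply/directv_addP; rewrite capvC capv_diff.
have XWb : basis_of (U m.+1) (X ++ vbasis W).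
  by rewrite -UW; apply: cat_basis => //; exact: vbasisP.
exists (X ++ vbasis W) => // j; rewrite leq_eqVlt => /predU1P[->|]; last first.
  rewrite ltnS => jm; rewrite [LHS](Xtake j jm); congr (<<_>>)%VS.
  by rewrite takel_cat// -(dim_basis_size XU); exact/dimvS/U_mono.
by rewrite take_oversize ?(dim_basis_size XWb)// (span_basis XWb).
Qed.

(** GL_n acts transitively on flags: the columns of [G] form a basis adapted to
[xi]. *)
Lemma flag_frame (xi : flags) : flag_manifold i xi ->
  exists2 G : 'M[R]_n, G \in unitmx & flag_action G std_flag = xi.
Proof.
move=> [xi_dim xi_sub].
(* The default value closes the flag with the whole space. *)
pose U (j : nat) : {vspace 'cV[R]_n} := nth fullv xi j.
have UE (j : 'I_r) : U j = tnth xi j by rewrite (tnth_nth fullv).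
have Ufull j : (r <= j)%N -> U j = fullv.
  by move=> rj; rewrite /U nth_default// size_tuple.
have U_mono j k : (j <= k)%N -> (U j <= U k)%VS.
  move=> jk; have [kr|rk] := ltnP k r; last by rewrite [U k]Ufull// subvf.
  rewrite (UE (Ordinal (leq_ltn_trans jk kr))) (UE (Ordinal kr)).
  exact: xi_sub.
have [X Xb Xtake] := @adapted_basis _ U r U_mono.
rewrite Ufull// in Xb.
have Xn : size X = n by rewrite -(dim_basis_size Xb) dimvf /dim /= muln1.
pose G : 'M[R]_n := \matrix_(k, l) (nth 0 X l : 'cV[R]_n) k 0.
have GX (l : 'I_n) : G *m delta_mx l 0 = nth 0 X l.
  by rewrite -colE; apply/colP => k; rewrite !mxE.
have uG : G \in unitmx.
  apply: unitmx_inj => y Gy0.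
  have /eqP Xsize := Xn; have Xfree := basis_free Xb.
  have {}Xfree := @freeP _ _ _ (Tuple Xsize) Xfree.
  apply/colP => l; rewrite [RHS]mxE; apply: (Xfree (fun l => y l 0)).
  rewrite -[RHS]Gy0; apply/colP => k; rewrite summxE mxE.
  by apply: eq_bigr => m _; rewrite !mxE mulrC.
exists G => //; apply: eq_from_tnth => j; rewrite tnth_flag_action -UE.
apply/esym/eqP; rewrite eqEdim dim_mulmx_img// dim_std_flag UE xi_dim leqnn andbT.
rewrite -UE (Xtake j (ltnW (ltn_ord j))) UE xi_dim.
apply/span_subvP => x xX.
have d_le : (flag_index n i j.+1 <= size X)%N by rewrite Xn flag_index_le.
have : (index x (take (flag_index n i j.+1) X) < flag_index n i j.+1)%N.
  by rewrite -[X in (_ < X)%N](size_takel d_le) index_mem.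
set k := index _ _ => kd.
have kn : (k < n)%N by rewrite (leq_trans kd)// flag_index_le.
apply/mem_mulmx_imgP; exists (delta_mx (Ordinal kn) 0); last first.
  by rewrite GX /= -(nth_take _ kd) nth_index.
rewrite tnth_std_flag; apply/mem_mulmx_limgP; exists (delta_mx (Ordinal kn) 0).
apply/colP => l; rewrite mul_diag_mx !mxE andbT.
case: eqP => [->|_]; last by rewrite mulr0.
by rewrite block_index_lt /= kd mulr1.
Qed.

End adapted_frames.

(** * Uniqueness of the invariant measure *)

Section invariant_measure.
Variables (R : realType) (n r : nat) (i : r.-tuple nat).
Hypothesis i_incr : sorted ltn i.
Hypothesis i_range : all (fun k => (1 <= k <= n.-1)%N) i.
Notation flags := (r.-tuple {vspace 'cV[R]_n}).
Notation leb := (lebesgue_mx R n).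
Notation b := (@block_index n r i).
Notation xi0 := (std_flag R n i).
Let b_mono := @block_index_mono n r i.

(** Flags [G xi0] are only well behaved for invertible [G]; singular matrices, of
weight [0], are replaced by the identity to obtain an everywhere measurable
map. *)
Definition regularize (G : 'M[R]_n) : 'M[R]_n := if G \in unitmx then G else 1%:M.

Lemma regularize_unit G : regularize G \in unitmx.
Proof. by rewrite /regularize; case: ifP => // _; exact: unitmx1. Qed.

Lemma regularizeE G : G \in unitmx -> regularize G = G.
Proof. by rewrite /regularize => ->. Qed.

Lemma measurable_regularize : measurable_fun setT regularize.
Proof.
apply: measurable_fun_ifT; [exact: measurable_unitmx|exact: measurable_id|].
exact: measurable_cst.
Qed.

Definition frame_kernel (G : 'M[R]_n) : R := flag_density b G * weight b G.

Lemma measurable_frame_kernel : measurable_fun setT frame_kernel.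
Proof.
by apply: measurable_funM; [exact: measurable_flag_density|exact: measurable_weight].
Qed.

Lemma frame_kernel_ge0 G : 0 <= frame_kernel G.
Proof. by rewrite mulr_ge0// ?flag_density_ge0 ?weight_ge0. Qed.

Lemma frame_kernel_nonunit G : G \notin unitmx -> frame_kernel G = 0.
Proof. by move=> uG; rewrite /frame_kernel weight_nonunit ?mulr0. Qed.

Lemma frame_kernel_orthogonal Q G : special_orthogonal Q ->
  frame_kernel (Q *m G) = frame_kernel G.
Proof.
by move=> sQ; rewrite /frame_kernel flag_density_orthogonal// weight_orthogonal.
Qed.

Lemma special_orthogonal_unit (Q : 'M[R]_n) : special_orthogonal Q -> Q \in unitmx.
Proof. by move=> [_ dQ]; rewrite unitmxE dQ unitr1. Qed.

Lemma special_orthogonal_tr (Q : 'M[R]_n) :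
  special_orthogonal Q -> special_orthogonal Q^T.
Proof.
by move=> [QQ dQ]; split; [rewrite trmxK; exact: mulmx1C|rewrite det_tr].
Qed.

Lemma so_factor_SO (G : 'M[R]_n) : special_orthogonal (so_factor G).
Proof.
have [uG|uG] := boolP (G \in unitmx); first exact: so_factor_special.
by rewrite /so_factor (negbTE uG); split; rewrite ?trmx1 ?mul1mx ?det1.
Qed.

Lemma integral_mull_SO (Q : 'M[R]_n) (f : 'M[R]_n -> \bar R) : special_orthogonal Q ->
  measurable_fun setT f -> (forall G, 0 <= f G)%E ->
  (\int[leb]_G f (Q *m G) = \int[leb]_G f G)%E.
Proof.
move=> [QQ dQ] mf f0; rewrite integral_lebesgue_mx_mull ?dQ ?oner_eq0//.
by rewrite normr1 expr1n invr1 mul1e.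
Qed.

Lemma flag_SO_frame (xi : flags) : flag_manifold i xi ->
  exists2 Q : 'M[R]_n, special_orthogonal Q & flag_action Q xi0 = xi.
Proof.
move=> /(flag_frame i_incr i_range)[G uG <-].
have [T [tT uT GE]] := so_factor_triangular uG.
exists (so_factor G); first exact: so_factor_SO.
rewrite [in RHS]GE flag_actionM (_ : flag_action T xi0 = xi0)//.
by apply: std_flag_block => //; exact: triangular_block_upper.
Qed.

(** The average of [h] over the SO_n-orbit of the standard flag, up to the factor
[total_mass]: the rotation part of a random matrix plays the role of a
Haar-distributed rotation. *)
Definition SO_average (h : flags -> R) : \bar R :=
  (\int[leb]_G (frame_kernel G * h (flag_action (so_factor G)^T xi0))%:E)%E.

Section invariant_law.
Variables (d : measure_display) (Y : measurableType d).
Variable rho : {sigma_finite_measure set Y -> \bar R}.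
Variables (phi : Y -> flags) (k : Y -> R).
Hypotheses (mphi : measurable_fun setT phi) (mk : measurable_fun setT k).
Hypothesis k0 : forall y, 0 <= k y.
Hypothesis phi_flag : forall y, k y != 0 -> flag_manifold i (phi y).
Hypothesis invariant : forall Q, special_orthogonal Q ->
  forall h : flags -> R, measurable_fun setT h -> (forall xi, 0 <= h xi) ->
  (\int[rho]_y (h (flag_action Q (phi y)) * k y)%:E =
   \int[rho]_y (h (phi y) * k y)%:E)%E.

(** Average [h(q(G)^T phi(y))], [q(G)] being the rotation part of [G], over [G]
and [y].  Integrating [y] first, the invariance hypothesis removes [q(G)^T];
integrating [G] first, [phi(y)] is replaced by the standard flag, because it is a
rotation of it and the law of [G] is invariant under rotations.  The law is given
by a map and a density, so as to cover the invariant probability measure as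
well as the flags of random frames. *)
Lemma SO_average_unique (h : flags -> R) :
  measurable_fun setT h -> (forall xi, 0 <= h xi) ->
  (total_mass R b * \int[rho]_y (h (phi y) * k y)%:E =
   SO_average h * \int[rho]_y (k y)%:E)%E.
Proof.
move=> mh h0.
have msoT : measurable_fun setT (fun G : 'M[R]_n => (so_factor G)^T).
  by apply: measurable_trmx; exact: measurable_so_factor.
have usoT (G : 'M[R]_n) : (so_factor G)^T \in unitmx.
  by rewrite unitmx_tr; apply: special_orthogonal_unit; exact: so_factor_SO.
pose f (p : 'M[R]_n * Y) : \bar R :=
  (frame_kernel p.1 * (h (flag_action (so_factor p.1)^T (phi p.2)) * k p.2))%:E.
have mf : measurable_fun setT f.
  apply/measurable_EFinP; apply: measurable_funM.
    exact: (measurableT_comp measurable_frame_kernel).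
  apply: measurable_funM; last exact: (measurableT_comp mk).
  apply: (measurableT_comp mh).
  apply: (@measurable_flag_action R n r _ _ (fun p : 'M[R]_n * Y => (so_factor p.1)^T)
    (fun p => phi p.2)) => //.
  - exact: (measurableT_comp msoT).
  - exact: (measurableT_comp mphi).
have f0 p : (0 <= f p)%E.
  by rewrite lee_fin; apply: mulr_ge0; [exact: frame_kernel_ge0|exact: mulr_ge0].
have mhk : measurable_fun setT (fun y => (h (phi y) * k y)%:E).
  apply/measurable_EFinP; apply: measurable_funM => //.
  exact: (measurableT_comp mh).
have mh1 : measurable_fun setT
    (fun G => frame_kernel G * h (flag_action (so_factor G)^T xi0)).
  apply: measurable_funM; first exact: measurable_frame_kernel.
  apply: (measurableT_comp mh).
  exact: (@measurable_flag_action R n r _ _ _ (fun _ => xi0)).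
have left_side : (\int[leb]_G \int[rho]_y f (G, y) =
    total_mass R b * \int[rho]_y (h (phi y) * k y)%:E)%E.
  transitivity (\int[leb]_G ((frame_kernel G)%:E * \int[rho]_y (h (phi y) * k y)%:E))%E.
    apply: eq_integral => G _.
    rewrite -(invariant (special_orthogonal_tr (so_factor_SO G)) mh h0).
    rewrite -ge0_integralZl_EFin//.
    - by move=> y _; rewrite lee_fin mulr_ge0.
    - apply/measurable_EFinP; apply: measurable_funM => //; apply: (measurableT_comp mh).
      exact: (@measurable_flag_action R n r _ _ (fun _ => (so_factor G)^T)).
    - exact: frame_kernel_ge0.
  rewrite ge0_integralZr//.
  - by apply/measurable_EFinP; exact: measurable_frame_kernel.
  - by move=> G _; rewrite lee_fin frame_kernel_ge0.
  - by apply: integral_ge0 => y _; rewrite lee_fin mulr_ge0.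
have right_side : (\int[rho]_y \int[leb]_G f (G, y) =
    SO_average h * \int[rho]_y (k y)%:E)%E.
  transitivity (\int[rho]_y (SO_average h * (k y)%:E))%E; last first.
    rewrite ge0_integralZl//; first exact/measurable_EFinP.
      by move=> y _; rewrite lee_fin.
    by apply: integral_ge0 => G _; rewrite lee_fin mulr_ge0// frame_kernel_ge0.
  apply: eq_integral => y _.
  transitivity (\int[leb]_G
    ((frame_kernel G * h (flag_action (so_factor G)^T (phi y)))%:E * (k y)%:E))%E.
    by apply: eq_integral => G _; rewrite -EFinM /f /= mulrA.
  rewrite ge0_integralZr//; last 3 first.
  - apply/measurable_EFinP; apply: measurable_funM; first exact: measurable_frame_kernel.
    apply: (measurableT_comp mh).
    exact: (@measurable_flag_action R n r _ _ _ (fun _ => phi y)).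
  - by move=> G _; rewrite lee_fin mulr_ge0// frame_kernel_ge0.
  - by rewrite lee_fin.
  have [->|ky] := eqVneq (k y) 0; first by rewrite !mule0.
  congr (_ * _)%E; have [U sU <-] := flag_SO_frame (phi_flag ky).
  rewrite /SO_average -(integral_mull_SO (special_orthogonal_tr sU)); last 2 first.
  - exact/measurable_EFinP.
  - by move=> G; rewrite lee_fin mulr_ge0// frame_kernel_ge0.
  apply: eq_integral => G _; congr EFin.
  rewrite (frame_kernel_orthogonal _ (special_orthogonal_tr sU)).
  have [uG|uG] := boolP (G \in unitmx); last by rewrite frame_kernel_nonunit ?mul0r.
  rewrite so_factor_mull//; last exact: special_orthogonal_tr.
  by rewrite trmx_mul trmxK flag_actionM.
by rewrite -left_side -right_side; exact: (fubini_tonelli (m1 := leb) (m2 := rho) f mf f0).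
Qed.

End invariant_law.

Definition frame_law (h : flags -> R) : \bar R :=
  (\int[leb]_G (h (flag_action (regularize G) xi0) * frame_kernel G)%:E)%E.

Lemma measurable_frame_flag :
  measurable_fun setT (fun G => flag_action (regularize G) xi0).
Proof.
apply: (@measurable_flag_action R n r _ _ _ (fun _ => xi0)) => //.
  exact: regularize_unit.
exact: measurable_regularize.
Qed.

Lemma total_mass_cancel (x y : \bar R) : (total_mass R b * x = total_mass R b * y)%E -> x = y.
Proof.
have := total_mass_fin R b; case: (total_mass R b) => [m| |] //=; last first.
  by rewrite ltxx andbF.
rewrite lte_fin => /andP[m0 _] mxy.
have mK (z : \bar R) : (m^-1%:E * (m%:E * z) = z)%E.
  by rewrite muleA -EFinM mulVf ?gt_eqF// mul1e.
by rewrite -[LHS]mK mxy mK.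
Qed.

Lemma frame_law_SO_average (h : flags -> R) :
  measurable_fun setT h -> (forall xi, 0 <= h xi) -> frame_law h = SO_average h.
Proof.
move=> mh h0; apply: total_mass_cancel; rewrite [RHS]muleC.
apply: (@SO_average_unique _ _ _ (fun G => flag_action (regularize G) xi0) frame_kernel) => //.
- exact: measurable_frame_flag.
- exact: measurable_frame_kernel.
- exact: frame_kernel_ge0.
- move=> G _; apply: flag_manifold_action; first exact: regularize_unit.
  exact: std_flag_manifold.
move=> Q sQ h' mh' h'0.
have mint : measurable_fun setT
    (fun G => (h' (flag_action (regularize G) xi0) * frame_kernel G)%:E).
  apply/measurable_EFinP; apply: measurable_funM; last exact: measurable_frame_kernel.
  exact: (measurableT_comp mh' measurable_frame_flag).
rewrite -(integral_mull_SO sQ mint); last first.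
  by move=> G; rewrite lee_fin mulr_ge0// frame_kernel_ge0.
apply: eq_integral => G _; rewrite frame_kernel_orthogonal//; congr EFin.
have [uG|uG] := boolP (G \in unitmx); last by rewrite frame_kernel_nonunit ?mulr0.
rewrite !regularizeE// ?flag_actionM//.
by rewrite unitmx_mul (special_orthogonal_unit sQ).
Qed.

Variable mu : probability flags R.
Hypothesis hmu : is_flag_measure i mu.
Notation D := (@flag_manifold R n r i).

(** Both laws are invariant under SO_n and carried by the flag manifold, so both are
proportional to [SO_average]. *)
Lemma flag_measure_frame_law (h : flags -> R) :
  measurable_fun setT h -> (forall xi, 0 <= h xi) ->
  (total_mass R b * \int[mu]_xi (h xi * \1_D xi)%:E = frame_law h)%E.
Proof.
move=> mh h0; rewrite frame_law_SO_average//.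
have mD := @measurable_flag_manifold R n r i.
have m1D : measurable_fun setT (\1_D : flags -> R) by exact: measurable_indic.
rewrite (@SO_average_unique _ flags mu id (fun xi => \1_D xi)) //.
- rewrite integral_indic// setIT.
  by have [mu1 _] := hmu; rewrite [X in (_ * X)%E]mu1 mule1.
- by move=> xi; rewrite indicE pnatr_eq0 eqb0 negbK => /set_mem.
move=> Q sQ h' mh' h'0.
have uQ := special_orthogonal_unit sQ.
have mQ : measurable_fun setT (@flag_action R n r Q).
  exact: (@measurable_flag_action R n r _ _ (fun _ => Q) id).
have mint : measurable_fun setT (fun xi : flags => (h' xi * \1_D xi)%:E).
  by apply/measurable_EFinP; exact: measurable_funM.
have int0 xi : (0 <= (h' xi * \1_D xi)%:E)%E by rewrite lee_fin mulr_ge0.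
transitivity (\int[image_measure mu mQ]_xi (h' xi * \1_D xi)%:E)%E.
  rewrite ge0_integral_image_measure//; apply: eq_integral => xi _.
  congr (_ * _)%:E; rewrite !indicE; congr (nat_of_bool _)%:R.
  apply/idP/idP => /set_mem Dxi; apply/mem_set; last first.
    rewrite -[xi]flag_action1 -(mulVmx uQ) flag_actionM.
    by apply: flag_manifold_action => //; rewrite unitmx_inv.
  exact: flag_manifold_action.
apply: eq_measure_integral => S mS _.
by have [_ muQ] := hmu; exact: muQ.
Qed.

End invariant_measure.

(** * Quasi-invariance under volume-preserving linear maps *)

Section quasi_invariance.
Variables (R : realType) (n r : nat) (i : r.-tuple nat).
Hypothesis i_incr : sorted ltn i.
Hypothesis i_range : all (fun k => (1 <= k <= n.-1)%N) i.
Notation flags := (r.-tuple {vspace 'cV[R]_n}).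
Notation leb := (lebesgue_mx R n).
Notation b := (@block_index n r i).
Notation xi0 := (std_flag R n i).
Notation e := (step_projector R b).
Notation V j G := (gram_vol (step_projector R b j) G).
Notation fi := (flag_index n i).

Lemma block_index_le (l : 'I_n) : (b l < r.+1)%N.
Proof. by rewrite ltnS -[X in (_ <= X)%N](size_tuple i) count_size. Qed.

Lemma flag_index0 : fi 0%N = 0%N. Proof. by []. Qed.

(** The convention [i_(r+1) = n] comes from the default value of [nth]. *)
Lemma flag_index_last : fi r.+1 = n.
Proof. by rewrite /flag_index /= nth_default// size_tuple. Qed.

Lemma sum_block_index_lt m : (m <= r.+1)%N -> (\sum_(l < n) (b l < m)%N = fi m)%N.
Proof.
case: m => [_|m]; first by rewrite flag_index0 big1.
rewrite leq_eqVlt => /predU1P[[->]|].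
  rewrite flag_index_last (eq_bigr (fun=> 1%N)) ?sum1_card ?card_ord// => l _.
  by rewrite block_index_le.
rewrite ltnS => mr; have := sum_ltn_ord (flag_index_le i_range (Ordinal mr)).
by move=> <-; apply: eq_bigr => l _; rewrite -(block_index_lt i_incr _ (Ordinal mr)).
Qed.

Definition block_size m := (\sum_(l < n) (b l == m))%N.

Lemma flag_index_block m : (m <= r)%N -> (fi m.+1 = fi m + block_size m)%N.
Proof.
move=> mr; rewrite -!sum_block_index_lt//; last exact: leqW.
rewrite /block_size -big_split /=; apply: eq_bigr => l _.
by rewrite ltnS leq_eqVlt; case: ltngtP.
Qed.

Lemma prod_block_index (u : nat -> R) :
  \prod_(l < n) u (b l) = \prod_(m < r.+1) u m ^+ block_size m.
Proof.
rewrite (partition_big (fun l => Ordinal (block_index_le l)) xpredT)//=.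
apply: eq_bigr => m _; rewrite /block_size -big_mkcond /= sum1_card.
under eq_bigl do rewrite -val_eqE /=.
rewrite (eq_bigr (fun=> u m)); last by move=> l /eqP ->.
by rewrite prodr_const.
Qed.

(** The ordinal [j] stands for [j + 1], so the exponent is [i_j - i_(j+2)] with the
neighbours of [i_(j+1)]. *)
Definition flag_jacobian (g : 'M[R]_n) (xi : flags) : R :=
  \prod_(j < r) (gram_vol (orthoproj (tnth xi j)) g) `^ ((fi j)%:R - (fi j.+2)%:R).

Lemma flag_jacobian_ge0 g xi : 0 <= flag_jacobian g xi.
Proof. by apply: prodr_ge0 => j _; exact: powR_ge0. Qed.

Lemma measurable_flag_jacobian g : measurable_fun setT (flag_jacobian g).
Proof.
apply: measurable_prod => j _; apply: (measurableT_comp (@measurable_powR R _)).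
have mP : measurable_fun setT (fun xi : flags => orthoproj (tnth xi j)).
  exact: (measurableT_comp (@measurable_orthoproj R n) (measurable_tnth j)).
exact: measurable_gram_vol.
Qed.

(** By the cocycle identity, [sigma(g, F_m)] is the ratio [v m] of the Gram volumes
of [gG] and [G] at step [m].  In the product over coordinates, [v m] occurs once
for each coordinate of the two blocks adjacent to step [m], that is
[i_(m+1) - i_(m-1)] times.  The extreme ratios are [v 0 = 1] and
[v r.+1 = |det g| = 1]. *)
Lemma flag_jacobian_density (g G : 'M[R]_n) : `|\det g| = 1 -> G \in unitmx ->
  flag_jacobian g (flag_action G xi0) * flag_density b G = flag_density b (g *m G).
Proof.
move=> dg uG.
have ug : g \in unitmx by rewrite unitmxE unitfE -normr_eq0 dg oner_eq0.
have ugG : g *m G \in unitmx by rewrite unitmx_mul ug.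
have V_gt0 m (A : 'M[R]_n) : A \in unitmx -> 0 < V m A by exact: step_gram_vol_gt0.
pose v m := V m (g *m G) / V m G.
have v_gt0 m : 0 < v m by rewrite divr_gt0// V_gt0.
have v_0 : v 0%N = 1.
  have e0 : e 0 = 0 by apply/matrixP => k l; rewrite !mxE ltn0 mul0rn.
  by rewrite /v e0 !gram_vol0 divr1.
have v_last : v r.+1 = 1.
  have e1 : e r.+1 = 1%:M.
    by apply/matrixP => k l; rewrite !mxE block_index_le.
  rewrite /v e1 !gram_vol_full det_mulmx normrM dg mul1r divff//.
  by rewrite normr_eq0 -unitfE -unitmxE.
have jacE : flag_jacobian g (flag_action G xi0) =
    \prod_(m < r) (v m.+1 ^+ (block_size m + block_size m.+1))^-1.
  apply: eq_bigr => m _.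
  rewrite tnth_flag_action orthoproj_img// orthoproj_std_flag.
  have -> : gram_vol (image_projector (e m.+1) G) g = v m.+1.
    rewrite /v gram_vol_cocycle//; last exact: step_projectorP.
    by rewrite mulfK// gt_eqF// V_gt0.
  have -> : fi m.+2 = (fi m + (block_size m + block_size m.+1))%N.
    by rewrite !flag_index_block ?addnA// ltnW// ltn_ord.
  rewrite natrD opprD addrA subrr sub0r powRN powR_mulrn//.
  exact: ltW.
have prod1 : \prod_(l < n) v (b l).+1 = \prod_(m < r) v m.+1 ^+ block_size m.
  rewrite (prod_block_index (fun m => v m.+1)) big_ord_recr /=.
  by rewrite v_last expr1n mulr1.
have prod0 : \prod_(l < n) v (b l) = \prod_(m < r) v m.+1 ^+ block_size m.+1.
  by rewrite (prod_block_index v) big_ord_recl /= v_0 expr1n mul1r.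
rewrite jacE prodfV; under eq_bigr do rewrite exprD.
rewrite big_split /= -prod1 -prod0 -big_split -prodfV -big_split /=.
apply: eq_bigr => l _; rewrite /v -invfM mulf_div divfK//.
by rewrite mulf_neq0// gt_eqF// V_gt0.
Qed.

Variable mu : probability flags R.
Hypothesis hmu : is_flag_measure i mu.
Notation D := (@flag_manifold R n r i).

(** In the frame law, substitute [g^-1 G] for [G]: the Jacobian is absorbed in the
density, and the weight [w(g^-1 -)] can be replaced by [w] by averaging. *)
Lemma flag_measure_quasi_invariance (g : 'M[R]_n) (h : flags -> R) :
  `|\det g| = 1 -> measurable_fun setT h -> (forall xi, 0 <= h xi) ->
  (\int[mu]_xi (h (flag_action g xi) * flag_jacobian g xi * \1_D xi)%:E =
   \int[mu]_xi (h xi * \1_D xi)%:E)%E.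
Proof.
move=> dg mh h0.
have ug : g \in unitmx by rewrite unitmxE unitfE -normr_eq0 dg oner_eq0.
have mg : measurable_fun setT (@flag_action R n r g).
  exact: (@measurable_flag_action R n r _ _ (fun _ => g) id).
have law := flag_measure_frame_law i_incr i_range hmu.
apply: (@total_mass_cancel R n r i); rewrite [RHS]law//.
transitivity (frame_law i (fun xi => h (flag_action g xi) * flag_jacobian g xi)).
  apply: law; last by move=> xi; rewrite mulr_ge0// flag_jacobian_ge0.
  apply: measurable_funM; last exact: measurable_flag_jacobian.
  exact: (measurableT_comp mh mg).
pose F (G : 'M[R]_n) := h (flag_action (regularize G) xi0) * flag_density b G.
have mF : measurable_fun setT F.
  apply: measurable_funM; last exact: measurable_flag_density.
  exact: (measurableT_comp mh (@measurable_frame_flag R n r i)).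
have F0 G : 0 <= F G by rewrite mulr_ge0// flag_density_ge0.
have Feq : block_equivariant b F.
  move=> G C uG bC uC; rewrite /F !regularizeE// ?unitmx_mul ?uG ?uC//.
  rewrite flag_actionM std_flag_block// -mulrA flag_density_block//.
  by rewrite !mulrA.
pose f (G : 'M[R]_n) := F G * weight b (invmx g *m G).
have mf : measurable_fun setT (EFin \o f).
  apply/measurable_EFinP; apply: measurable_funM => //.
  by apply: (measurableT_comp (measurable_weight b)); exact: measurable_mulmx.
have f0 G : (0 <= (EFin \o f) G)%E by rewrite /= lee_fin mulr_ge0// weight_ge0.
transitivity (\int[leb]_G (f G)%:E)%E; last first.
  rewrite (block_average (@block_index_mono n r i) mF F0 Feq) ?unitmx_inv//.
  by apply: eq_integral => G _; rewrite /F /frame_kernel mulrA.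
have dg0 : \det g != 0 by rewrite -unitfE -unitmxE.
(* The substitution costs [|det g| ^ n = 1]. *)
have := integral_lebesgue_mx_mull dg0 mf f0.
rewrite dg expr1n invr1 mul1e => <-.
apply: eq_integral => G _; congr EFin; rewrite /f mulKmx//.
have [uG|uG] := boolP (G \in unitmx); last first.
  by rewrite frame_kernel_nonunit// weight_nonunit// !mulr0.
rewrite /F !regularizeE ?unitmx_mul ?ug//.
rewrite -(flag_jacobian_density dg uG) /frame_kernel flag_actionM.
by rewrite !mulrA.
Qed.

End quasi_invariance.

(** * Change of variables for arbitrary integrands *)

Section lower_integral.
Variables (R : realType) (d : measure_display) (T : measurableType d).
Variable mu : {measure set T -> \bar R}.
Import HBNNSimple.

Lemma le_integral_nonmeasurable (f g : T -> \bar R) (D E : set T) :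
  (forall x, D x -> 0 <= f x)%E -> (forall x, E x -> 0 <= g x)%E ->
  (forall x, (f \_ D) x <= (g \_ E) x)%E ->
  (\int[mu]_(x in D) f x <= \int[mu]_(x in E) g x)%E.
Proof.
move=> f0 g0 fg; rewrite !ge0_integralE//; apply: ereal_sup_le => _ [h /= hf <-].
by exists h => // x; exact: le_trans (hf x) (fg x).
Qed.

Lemma integral_le_simple (f : T -> \bar R) (D : set T) (y : \bar R) :
  (forall x, D x -> 0 <= f x)%E ->
  (forall h : T -> R, measurable_fun setT h -> (forall x, 0 <= h x) ->
    (forall x, (h x)%:E <= (f \_ D) x)%E -> (\int[mu]_x (h x)%:E <= y)%E) ->
  (\int[mu]_(x in D) f x <= y)%E.
Proof.
move=> f0 fy; rewrite ge0_integralE//; apply: ge_ereal_sup => _ [h /= hf <-].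
by rewrite -integralT_nnsfun; apply: fy.
Qed.

End lower_integral.

Section flag_change_of_variables.
Variables (R : realType) (n r : nat) (i : r.-tuple nat).
Hypothesis i_incr : sorted ltn i.
Hypothesis i_range : all (fun k => (1 <= k <= n.-1)%N) i.
Notation flags := (r.-tuple {vspace 'cV[R]_n}).
Notation D := (@flag_manifold R n r i).
Notation J := (@flag_jacobian R n r i).
Variable mu : probability flags R.
Hypothesis hmu : is_flag_measure i mu.

Lemma flag_jacobianM (A C : 'M[R]_n) (xi : flags) : A \in unitmx -> C \in unitmx ->
  J (A *m C) xi = J A (flag_action C xi) * J C xi.
Proof.
move=> uA uC; rewrite /flag_jacobian -big_split /=; apply: eq_bigr => j _.
rewrite tnth_flag_action orthoproj_img// gram_vol_cocycle//; last exact: orthoprojP.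
by rewrite powRM// sqrtr_ge0.
Qed.

Lemma flag_jacobian1 (xi : flags) : J 1%:M xi = 1.
Proof.
rewrite /flag_jacobian big1// => j _; rewrite gram_vol1 ?powR1//; exact: orthoprojP.
Qed.

(** A simple function [h] below [f2] gives a measurable function
[J(g, -) h(g -)] below [f1] with the same integral as [h]. *)
Lemma flag_integral_le (g : 'M[R]_n) (f1 f2 : flags -> \bar R) : `|\det g| = 1 ->
  (forall xi, 0 <= f1 xi)%E -> (forall xi, 0 <= f2 xi)%E ->
  (forall xi, D xi -> f1 xi = (J g xi)%:E * f2 (flag_action g xi))%E ->
  (\int[mu]_(xi in D) f2 xi <= \int[mu]_(xi in D) f1 xi)%E.
Proof.
move=> dg f10 f20 f12.
have ug : g \in unitmx by rewrite unitmxE unitfE -normr_eq0 dg oner_eq0.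
apply: integral_le_simple => // h mh h0 hf2.
have h_off xi : ~ D xi -> h xi = 0.
  move=> nD; apply/eqP; rewrite eq_le h0 andbT -lee_fin.
  by have := hf2 xi; rewrite patchE memNset.
have -> : (\int[mu]_xi (h xi)%:E = \int[mu]_xi (h xi * \1_D xi)%:E)%E.
  apply: eq_integral => xi _; rewrite indicE; have [Dxi|nD] := pselect (D xi).
    by rewrite mem_set// mulr1.
  by rewrite h_off// mul0r.
rewrite -(flag_measure_quasi_invariance i_incr i_range hmu dg mh h0).
apply: le_integral_nonmeasurable => // xi.
  by rewrite lee_fin !mulr_ge0// flag_jacobian_ge0.
rewrite patch_setT patchE indicE; case: ifPn => [/set_mem Dxi|nD]; last by rewrite mulr0.
rewrite mulr1 f12// mulrC EFinM; apply: lee_wpmul2l.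
  by rewrite lee_fin flag_jacobian_ge0.
have := hf2 (flag_action g xi); rewrite patchE mem_set//.
exact: flag_manifold_action.
Qed.

Lemma flag_change_of_variables (g : 'M[R]_n) (f1 f2 : flags -> \bar R) :
  `|\det g| = 1 ->
  (forall xi, 0 <= f1 xi)%E -> (forall xi, 0 <= f2 xi)%E ->
  (forall xi, D xi -> f1 xi = (J g xi)%:E * f2 (flag_action g xi))%E ->
  (\int[mu]_(xi in D) f1 xi = \int[mu]_(xi in D) f2 xi)%E.
Proof.
move=> dg f10 f20 f12.
have ug : g \in unitmx by rewrite unitmxE unitfE -normr_eq0 dg oner_eq0.
have uV : invmx g \in unitmx by rewrite unitmx_inv.
apply/eqP; rewrite eq_le (flag_integral_le dg f10 f20 f12) andbT.
apply: (@flag_integral_le (invmx g)) => //.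
  by rewrite det_inv normfV dg invr1.
move=> xi Dxi; rewrite f12; last exact: flag_manifold_action.
rewrite muleA -EFinM -flag_actionM mulmxV// flag_action1 mulrC -flag_jacobianM//.
by rewrite mulmxV// flag_jacobian1 mul1e.
Qed.

End flag_change_of_variables.

(** * Volumes of sections and projections *)

Section subspace_volumes.
Variable R : realType.

(** The dimensions of [F] and [g F] are equal but not convertible, so the matrix of
[g] from [F] to [g F] has a determinant only through [M^T *m M]. *)
Lemma rect_preimage_volume d d' (M : 'M[R]_(d', d)) (c : 'cV[R]_d') (S : set 'cV[R]_d') :
  d = d' -> \det (M^T *m M) != 0 -> measurable S ->
  (lebesgue_cV R d [set x : 'cV[R]_d | S (M *m x + c)%R] =
   ((Num.sqrt `|\det (M^T *m M)|)^-1)%:E * lebesgue_cV R d' S)%E.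
Proof.
move=> dd'; case: _ / dd' in M c S *.
rewrite det_mulmx det_tr mulf_eq0 orbb => dM mS.
by rewrite lebesgue_cV_affine_preimage// normrM -expr2 sqrtr_sqr normr_id.
Qed.

Lemma det_mul_tr_rect d d' (M : 'M[R]_(d', d)) : d = d' ->
  \det (M^T *m M) = \det (M *m M^T).
Proof. by move=> dd'; case: _ / dd' in M *; rewrite !det_mulmx mulrC. Qed.

Variable n : nat.
Implicit Types (F : {vspace 'cV[R]_n}) (g T : 'M[R]_n).
Notation O := (@orthonormal_basis R n).

(** In an orthonormal basis of [F] the extended Gram matrix is
[1 + B (S - 1) B^T], with [S] the Gram matrix of size [dim F]. *)
Lemma gram_vol_frame F g :
  gram_vol (orthoproj F) g = Num.sqrt `|\det ((O F)^T *m g^T *m g *m O F)|.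
Proof.
have [BB _] := orthonormal_basisP F.
rewrite /gram_vol /gram /orthoproj; move: (O F) BB => B BB.
set S := B^T *m g^T *m g *m B; congr (Num.sqrt `|_|).
have -> : B *m B^T *m g^T *m g *m (B *m B^T) + (1%:M - B *m B^T) =
    1%:M + B *m ((S - 1%:M) *m B^T).
  rewrite [in RHS]mulmxBl mul1mx [in RHS]mulmxBr [RHS]addrCA; congr (_ + _).
  by rewrite /S !mulmxA.
by rewrite det_Sylvester -mulmxA BB mulmx1 addrC subrK.
Qed.

Let frame_transfer F g : g \in unitmx ->
  let F' := (linfun (mulmx g) @: F)%VS in
  g *m O F = O F' *m ((O F')^T *m g *m O F).
Proof.
move=> ug F'; rewrite !mulmxA -/(orthoproj F'); apply/matrixP => a c.
have /orthoproj_fix : col c (g *m O F) \in F'.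
  apply/mem_mulmx_imgP; exists (col c (O F)); last by rewrite !colE mulmxA.
  by apply/(orthonormal_basisP F).2; exists (delta_mx c 0); rewrite colE.
by move=> /colP/(_ a); rewrite !colE !mulmxA -!colE => E; move: E; rewrite !mxE.
Qed.

Let transfer_gram F g : g \in unitmx ->
  let M := (O (linfun (mulmx g) @: F)%VS)^T *m g *m O F in
  M^T *m M = (O F)^T *m g^T *m g *m O F.
Proof.
move=> ug M; have gO := frame_transfer F ug; rewrite /= -/M in gO.
have [BB _] := orthonormal_basisP (linfun (mulmx g) @: F)%VS.
rewrite -[RHS]mulmxA -trmx_mul gO [in RHS]trmx_mul.
by rewrite -[RHS]mulmxA (mulmxA (O (linfun (mulmx g) @: F)%VS)^T) BB mul1mx.
Qed.

Lemma subspace_section_volume F T (L : set 'cV[R]_n) : T \in unitmx ->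
  measurable L ->
  (subspace_lebesgue F (L `&` [set x | x \in F]) =
   (gram_vol (orthoproj F) T)^-1%:E *
   subspace_lebesgue (linfun (mulmx T) @: F)%VS
     ((mulmx T @` L) `&` [set x | x \in (linfun (mulmx T) @: F)%VS]))%E.
Proof.
move=> uT mL; set F' := (linfun (mulmx T) @: F)%VS.
have TO := frame_transfer F uT; have MM := transfer_gram F uT.
rewrite /= -/F' in TO MM; set M := (O F')^T *m T *m O F in TO MM.
have gv := gram_vol_gt0 (orthoprojP F) uT.
have gvE := gram_vol_frame F T; rewrite -MM in gvE.
have mem_frame U (y : 'cV[R]_(\dim U)) : O U *m y \in U.
  by apply/(orthonormal_basisP U).2; exists y.
have TL (x : 'cV[R]_n) : (mulmx T @` L) x <-> L (invmx T *m x).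
  split => [[z Lz <-]|Lx]; first by rewrite mulKmx.
  by exists (invmx T *m x) => //; rewrite mulKVmx.
rewrite /subspace_lebesgue.
pose S := [set y : 'cV[R]_(\dim F') | L (invmx T *m (O F' *m y))].
have -> : [set y | ((mulmx T @` L) `&` [set x | x \in F']) (O F' *m y)] = S.
  apply/seteqP; split => y /=; first by move=> [/TL].
  by move=> Ly; split; [exact/TL|exact: mem_frame].
have -> : [set y | (L `&` [set x | x \in F]) (O F *m y)] =
    [set x : 'cV[R]_(\dim F) | S (M *m x + 0)].
  apply/seteqP; split => y /=; rewrite /S addr0 /= (mulmxA (O F')) -TO -mulmxA mulKmx//.
  by case.
have mS : measurable S.
  rewrite -[X in measurable X]setTI.
  have mf : measurable_fun setT
      (fun y : 'cV[R]_(\dim F') => invmx T *m (O F' *m y)).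
    by apply: measurable_mulmx => //; exact: measurable_mulmx.
  exact: (mf measurableT L mL).
rewrite rect_preimage_volume//; first by rewrite gvE.
- by rewrite dim_mulmx_img.
- by move: gv; rewrite gvE sqrtr_gt0 normr_gt0.
Qed.

(** In orthonormal bases the map from the projection of [L] onto [F' = M^T F] to the
projection of [M L + c] onto [F] is affine, and its linear part [N^T] is the
transpose of the matrix [N] of [M^T] from [F] to [F']. *)
Lemma subspace_projection_volume F (M : 'M[R]_n) (c : 'cV[R]_n) (L : set 'cV[R]_n) :
  M \in unitmx -> compact L ->
  (subspace_lebesgue F (mulmx (orthoproj F) @` ((fun x => M *m x + c)%R @` L)) =
   (gram_vol (orthoproj F) M^T)%:E *
   subspace_lebesgue (linfun (mulmx M^T) @: F)%VS
     (mulmx (orthoproj (linfun (mulmx M^T) @: F)%VS) @` L))%E.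
Proof.
move=> uM cL; have uMT : M^T \in unitmx by rewrite unitmx_tr.
set F' := (linfun (mulmx M^T) @: F)%VS.
have TO := frame_transfer F uMT; have MM := transfer_gram F uMT.
rewrite /= -/F' in TO MM; set N := (O F')^T *m M^T *m O F in TO MM.
have gv := gram_vol_gt0 (orthoprojP F) uMT.
have gvE := gram_vol_frame F M^T; rewrite -MM in gvE.
have dimE : \dim F' = \dim F by exact: dim_mulmx_img.
have projE U (K : set 'cV[R]_n) :
    [set y | (mulmx (orthoproj U) @` K) (O U *m y)] = mulmx (O U)^T @` K.
  have [BB _] := orthonormal_basisP U.
  apply/seteqP; split => [y [x Kx /(congr1 (mulmx (O U)^T))]|_ [x Kx <-]].
    by rewrite /orthoproj !mulmxA BB !mul1mx => <-; exists x.
  by exists x => //; rewrite /orthoproj mulmxA.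
rewrite /subspace_lebesgue !projE.
set W := mulmx (O F)^T @` _; set S := mulmx (O F')^T @` L.
have WE : W = (fun z : 'cV[R]_(\dim F') => N^T *m z + (O F)^T *m c) @` S.
  have NE : (O F)^T *m M = N^T *m (O F')^T.
    by rewrite -trmx_mul -TO trmx_mul trmxK.
  apply/seteqP; split => [_ [_ [x Lx <-] <-]|_ [_ [x Lx <-] <-]].
    exists ((O F')^T *m x); first by exists x.
    by rewrite mulmxDr !mulmxA NE.
  exists (M *m x + c); first by exists x.
  by rewrite mulmxDr !mulmxA NE.
have detN : \det (N *m N^T) != 0.
  by rewrite -det_mul_tr_rect//; move: gv; rewrite gvE sqrtr_gt0 normr_gt0.
have mW : measurable W.
  (* Preimages under the affine map are measurable but images need not be, so the
     measurability of [W] comes from compactness. *)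
  have cS : compact S.
    by apply: continuous_compact => //; apply/continuous_subspaceT => x; exact: continuous_mulmx.
  have mNS : measurable (mulmx N^T @` S).
    apply: compact_measurable_mx; apply: continuous_compact => //.
    by apply/continuous_subspaceT => x; exact: continuous_mulmx.
  rewrite [W](_ : _ = [set w | (mulmx N^T @` S) (w - (O F)^T *m c)]); last first.
    rewrite WE; apply/seteqP; split => [_ [z Sz <-]|w [z Sz zE]] /=.
      by exists z => //; rewrite addrK.
    by exists z => //; rewrite zE subrK.
  rewrite -[X in measurable X]setTI.
  have mf : measurable_fun setT (fun w : 'cV[R]_(\dim F) => w - (O F)^T *m c).
    by apply: measurable_addmx.
  exact: (mf measurableT _ mNS).
have SE : S = [set z : 'cV[R]_(\dim F') | W (N^T *m z + (O F)^T *m c)].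
  apply/seteqP; split => z; first by rewrite WE => Sz; exists z.
  rewrite /= WE => -[z' Sz' /addIr /(congr1 (mulmx N))].
  rewrite !(mulmxA N) => /(congr1 (mulmx (invmx (N *m N^T)))).
  by rewrite !mulKmx ?unitmxE ?unitfE// => <-.
rewrite [in RHS]SE rect_preimage_volume// ?trmxK//.
rewrite -det_mul_tr_rect// muleA -EFinM gvE mulfV ?mul1e//.
by move: gv; rewrite gvE => /gt_eqF ->.
Qed.

End subspace_volumes.

(** * Invariance of the flag quermassintegrals *)

Section extended_powers.
Variable R : realType.
Implicit Types (x : \bar R) (c p : R).

Lemma xpow_ge0 x p : (0 <= x)%E -> (0 <= xpow x p)%E.
Proof. by move=> x0; rewrite /xpow; case: ifP => _; rewrite ?inve_ge0 poweR_ge0. Qed.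

Lemma xpowZ c x p : 0 < c -> (0 <= x)%E ->
  xpow (c%:E * x)%E p = ((c `^ p)%:E * xpow x p)%E.
Proof.
move=> c0 x0; rewrite /xpow; case: ifPn => [p0|]; last by rewrite poweRM// lee_fin ltW.
rewrite poweRM//; last by rewrite lee_fin ltW.
have -> : c `^ p = (c `^ (- p))^-1 by rewrite powRN invrK.
rewrite poweR_EFin.
have : 0 < c `^ (- p) by exact: powR_gt0.
move: (c `^ (- p)) => a a0.
have : (0 <= poweR x (- p))%E by exact: poweR_ge0.
case: (poweR x (- p)) => [y||]//; rewrite ?lee_fin => y0.
  rewrite -EFinM !inver mulf_eq0 (gt_eqF a0) /=; case: ifP => [_|_].
    by rewrite gt0_muley// lte_fin invr_gt0.
  by rewrite -EFinM invfM.
by rewrite gt0_muley// invey mule0.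
Qed.

Lemma prod_EFinM (I : finType) (a : I -> R) (x : I -> \bar R) :
  (\prod_j ((a j)%:E * x j) = (\prod_j a j)%:E * \prod_j x j)%E.
Proof. by rewrite big_split /= prodEFin. Qed.

End extended_powers.

(** If [M] is invertible, the image of the unit cube has volume [|det M|].  If not,
the cube and its translate by a kernel vector [w] have the same image; choosing [w]
with a coordinate equal to [2] makes them disjoint, so a set of volume [2] and one
of volume [1] would have images of the same volume. *)
Lemma preserves_volume_det (R : realType) n (M : 'M[R]_n) (c : 'cV[R]_n) :
  preserves_volume (fun x : 'cV[R]_n => M *m x + c) -> `|\det M| = 1.
Proof.
move=> volM; set f := (fun x : 'cV[R]_n => M *m x + c) in volM.
pose E : set 'cV[R]_n := mx_box n 1 0 1.
have mE : measurable E by exact: measurable_mx_box.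
have E1 : lebesgue_cV R n E = 1%E by rewrite lebesgue_cV_box// subr0 expr1n.
have [dM|dM] := eqVneq (\det M) 0; last first.
  have uM : M \in unitmx by rewrite unitmxE unitfE.
  have fE : f @` E = [set y | E (invmx M *m y + - (invmx M *m c))].
    apply/seteqP; split => [_ [x Ex <-]|y Ey] /=.
      by rewrite /f mulmxDr mulKmx// addrK.
    by exists (invmx M *m y - invmx M *m c) => //; rewrite /f mulmxBr !mulKVmx// subrK.
  have := volM E mE; rewrite fE lebesgue_cV_affine_preimage//.
    by rewrite E1 mule1 det_inv normfV invrK => -[].
  by rewrite det_inv invr_eq0.
have [u u0 Mu] : exists2 u : 'cV[R]_n, u != 0 & M *m u = 0.
  have /eqP/det0P[v v0 vM] : \det M^T = 0 by rewrite det_tr.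
  exists v^T; first by rewrite trmx_eq0.
  by rewrite -[M]trmxK -trmx_mul vM trmx0.
have [k uk] : exists k, u k 0 != 0.
  apply/existsP; apply: contra_neqT u0 => /existsPn uk.
  by apply/colP => k; rewrite mxE; have := uk k; rewrite negbK => /eqP.
pose w := (2 / u k 0) *: u.
have wk : w k 0 = 2 by rewrite mxE mulfVK.
have Mw : M *m w = 0 by rewrite -scalemxAr Mu scaler0.
pose E' := [set x : 'cV[R]_n | E (1%:M *m x + - w)].
have mE' : measurable E'.
  rewrite -[X in measurable X]setTI.
  exact: (measurable_cV_affine 1%:M (- w) measurableT mE).
have E'1 : lebesgue_cV R n E' = 1%E.
  by rewrite lebesgue_cV_affine_preimage// ?det1 ?oner_eq0// normr1 invr1 mul1e.
have EE' : [disjoint E & E'].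
  apply/disj_setPS => x [/(_ k 0)/andP[_ xk1]] /= /(_ k 0)/andP[+ _].
  have -> : (1%:M *m x + - w) k 0 = x k 0 - 2 by rewrite mul1mx -wk [LHS]mxE [(- w) k 0]mxE.
  lra.
have fEE' : f @` (E `|` E') = f @` E.
  apply/seteqP; split => [_ [x [Ex|Ex] <-]|_ [x Ex <-]].
  - by exists x.
  - by exists (1%:M *m x - w) => //; rewrite /f mul1mx mulmxBr Mw subr0.
  - by exists x => //; left.
have := volM _ (measurableU _ _ mE mE'); rewrite fEE' volM// measureU//.
  rewrite E1 [X in (X + _)%E]E1 [X in (_ + X)%E]E'1 -EFinD => -[] /eqP.
  by rewrite -[X in X == _]addr0 (inj_eq (addrI _)) eq_sym oner_eq0.
exact/disj_set2P.
Qed.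

Section affine_invariance.
Variables (R : realType) (n r : nat) (i : r.-tuple nat).
Hypothesis i_incr : sorted ltn i.
Hypothesis i_range : all (fun k => (1 <= k <= n.-1)%N) i.
Variable mu : probability (r.-tuple {vspace 'cV[R]_n}) R.
Hypothesis hmu : is_flag_measure i mu.
Variables (L : set 'cV[R]_n) (cL : compact L).

Lemma prod_xpow_ge0 (v : 'I_r -> \bar R) (p : 'I_r -> R) :
  (forall j, 0 <= v j)%E -> (0 <= \prod_(j < r) xpow (v j) (p j))%E.
Proof. by move=> v0; apply: prode_ge0 => j _; exact: xpow_ge0. Qed.

Lemma flag_quermassintegral_affine (M : 'M[R]_n) (c : 'cV[R]_n) : `|\det M| = 1 ->
  flag_quermassintegral i mu ((fun x => M *m x + c) @` L) =
  flag_quermassintegral i mu L.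
Proof.
move=> dM; have uM : M \in unitmx by rewrite unitmxE unitfE -normr_eq0 dM oner_eq0.
congr xpow; apply: (@flag_change_of_variables R n r i i_incr i_range mu hmu M^T).
- by rewrite det_tr.
- by move=> xi; apply: prod_xpow_ge0 => j; exact: measure_ge0.
- by move=> xi; apply: prod_xpow_ge0 => j; exact: measure_ge0.
move=> xi Dxi; rewrite -prod_EFinM; apply: eq_bigr => j _.
have vol_gt0 : 0 < gram_vol (orthoproj (tnth xi j)) M^T.
  by apply: gram_vol_gt0; [exact: orthoprojP|rewrite unitmx_tr].
by rewrite tnth_flag_action subspace_projection_volume// xpowZ.
Qed.

(** The exponent is now positive but it is [|L :&: F|] that is written in terms of
[|TL :&: TF|], with the inverse factor; so the Jacobian is the same. *)
Lemma dual_flag_quermassintegral_linear (T : 'M[R]_n) : `|\det T| = 1 ->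
  dual_flag_quermassintegral i mu (mulmx T @` L) =
  dual_flag_quermassintegral i mu L.
Proof.
move=> dT; have uT : T \in unitmx by rewrite unitmxE unitfE -normr_eq0 dT oner_eq0.
apply/esym; congr xpow.
apply: (@flag_change_of_variables R n r i i_incr i_range mu hmu T) => //.
- by move=> xi; apply: prod_xpow_ge0 => j; exact: measure_ge0.
- by move=> xi; apply: prod_xpow_ge0 => j; exact: measure_ge0.
move=> xi Dxi; rewrite -prod_EFinM; apply: eq_bigr => j _.
have vol_gt0 := gram_vol_gt0 (orthoprojP (tnth xi j)) uT.
rewrite tnth_flag_action (subspace_section_volume _ uT); last exact: compact_measurable_mx.
by rewrite xpowZ ?invr_gt0// -powR_inv1 ?ltW// -powRrM mulN1r opprB.
Qed.

End affine_invariance.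

Theorem theorem1p1 (R : realType) (n r : nat)
  (hn : (2 <= n)%N)
  (L : set 'cV[R]_n) (hL : compact L)
  (hr : (1 <= r <= n.-1)%N)
  (i : r.-tuple nat)
  (i_incr : sorted ltn i)
  (i_range : all (fun k => (1 <= k <= n.-1)%N) i)
  (mu : probability (r.-tuple {vspace 'cV[R]_n}) R)
  (hmu : is_flag_measure i mu)
  (A : 'cV[R]_n -> 'cV[R]_n)
  (A_affine : is_affine A)
  (A_volume : preserves_volume A)
  (T : 'M[R]_n) (hT : \det T = 1) :
  flag_quermassintegral i mu (A @` L) = flag_quermassintegral i mu L /\
  dual_flag_quermassintegral i mu (mulmx T @` L) =
    dual_flag_quermassintegral i mu L.
Proof.
have [M [b AE]] := A_affine.
have {}AE : A = fun x => M *m x + b by apply/funext.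
split; last by apply: dual_flag_quermassintegral_linear; rewrite // hT normr1.
rewrite AE; apply: flag_quermassintegral_affine => //.
by apply: (@preserves_volume_det R n M b); rewrite -AE.
Qed.
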